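(* Let $\{X_t, t\in\mathbb{Z}\}$ be an $m$-variate time series satisfying Assumption A(4) and Assumption B (both defined in the context), and let $X_1,\ldots,X_n$ be observed. Fix indices $j,k\in\{1,\ldots,m\}$ and $\theta\in\{0,\pi\}$. Let $\tilde f_{jk}(\theta)=[1,0]\,(\mathbf X'\mathbf X)^{-1}\mathbf X'\mathbf Y$ be the local quadratic OLS estimator defined in the context (the estimated intercept). Then $\tilde f_{jk}(\theta)\to f_{jk}(\theta)$ in probability as $n\to\infty$ and $M\to\infty$ with $M/n\to 0$.
   Context: Setting: $\{X_t\}$ is a strictly stationary $\mathbb{R}^m$-valued time series with mean $\mu=EX_t$ and autocovariance $\gamma(h)=E[(X_{t+h}-\mu)(X_t-\mu)']$, with entries $\gamma_{jk}(h)$. The spectral density matrix is $f(w)=\frac{1}{2\pi}\sum_{h=-\infty}^{\infty}e^{-iwh}\gamma(h)$, with entries $f_{jk}(w)$; $f_{jk}(0)$ and $f_{jk}(\pi)$ are real. Assumption A($p$): $f(w)$ is well defined and each entry $f_{jk}(w)$ is $p$ times continuously differentiable for all real $w$. Assumption B: $\{X_t\}$ is strictly stationary and either (i) a linear process $X_t=\mu+\sum_{\ell}\Psi_\ell Z_{t-\ell}$ with i.i.d. mean-zero inputs $Z_t$ each of whose components has a finite fourth moment and with $\sum_\ell\|\Psi_\ell\|^2<\infty$, or (ii) its joint cumulants satisfy the summability condition (B1) of Taniguchi and Kakizawa (2000, p. 55), namely for every $r\ge 2$, every choice of components $a_1,\ldots,a_r$ and every $q=1,\ldots,r-1$, $\sum_{u_1,\ldots,u_{r-1}\in\mathbb{Z}}(1+|u_q|)\,|\mathrm{cum}(X_{u_1,a_1},\ldots,X_{u_{r-1},a_{r-1}},X_{0,a_r})|<\infty$.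 Estimator: $\bar X_n=n^{-1}\sum_{t=1}^n X_t$; for $0\le h<n$, $\hat\gamma(h)=n^{-1}\sum_{t=1}^{n-h}(X_{t+h}-\bar X_n)(X_t-\bar X_n)'$, $\hat\gamma(-h)=\hat\gamma(h)'$, and $\hat\gamma(h)=0$ for $|h|\ge n$. The periodogram matrix is $I(w)=\frac{1}{2\pi}\sum_h e^{-iwh}\hat\gamma(h)$ with entries $I_{jk}(w)$; $\mathcal R[\cdot]$ denotes real part. Fourier frequencies are $w_s=2\pi s/n$. Let $\delta=M/n$ (so $M=[\delta n]$). For $\theta=0$ the regression uses indices $s=1,\ldots,M$; for $\theta=\pi$ it uses $s=[n/2]-M+1,\ldots,[n/2]$. $\mathbf X$ is the $M\times 2$ matrix whose rows are $(1,(\theta-w_s)^2)$ and $\mathbf Y$ the $M$-vector with entries $\mathcal R[I_{jk}(w_s)]$, over these indices $s$. The estimator $\tilde f_{jk}(\theta)$ is the first coordinate of $(\mathbf X'\mathbf X)^{-1}\mathbf X'\mathbf Y$. *)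

(* Defs.v *)
From HB Require Import structures.
From mathcomp Require Import all_boot all_order all_algebra.
From mathcomp Require Import all_classical all_reals all_analysis.
Set Implicit Arguments. Unset Strict Implicit. Unset Printing Implicit Defensive.
Import Order.TTheory GRing.Theory Num.Theory.
Import numFieldNormedType.Exports.
Local Open Scope classical_set_scope.
Local Open Scope ring_scope.

Section TimeSeries.
Context {R : realType} {d : measure_display} {T : measurableType d}.
Variable P : probability T R.

(* Strict stationarity: all finite-dimensional distributions are shift
   invariant (tested on measurable rectangles, which generate the product
   sigma-algebra). *)
Definition strictly_stationary m (X : int -> 'I_m -> T -> R) :=
  forall (k : nat) (tt : 'I_k -> int) (aa : 'I_k -> 'I_m) (B : 'I_k -> set R)
         (h : int),
    (forall i, measurable (B i)) ->
    P (\bigcap_(i in [set: 'I_k]) (X (tt i + h) (aa i) @^-1` B i)) =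
    P (\bigcap_(i in [set: 'I_k]) (X (tt i) (aa i) @^-1` B i)).

(* mu = E X_t (component a), using stationarity to take t = 0 *)
Definition mean m (X : int -> 'I_m -> T -> R) (a : 'I_m) : R :=
  fine 'E_P[X 0 a].

Definition autocov m (X : int -> 'I_m -> T -> R) (j k : 'I_m) (h : int) : R :=
  fine 'E_P[(fun w => (X h j w - mean X j) * (X 0 k w - mean X k))].

(* symmetric partial sums of sum_h e^{-iwh} gamma_{jk}(h):
   real part  sum_{|h|<=N} cos(wh) gamma(h),
   imag part -sum_{|h|<=N} sin(wh) gamma(h) *)
Definition spec_ps_re m (X : int -> 'I_m -> T -> R) j k (w : R) (N : nat) : R :=
  \sum_(i < (2 * N).+1)
     cos (w * ((i%:Z - N%:Z)%:~R)) * autocov X j k (i%:Z - N%:Z).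
Definition spec_ps_im m (X : int -> 'I_m -> T -> R) j k (w : R) (N : nat) : R :=
  - \sum_(i < (2 * N).+1)
     sin (w * ((i%:Z - N%:Z)%:~R)) * autocov X j k (i%:Z - N%:Z).

Definition spec_well_defined m (X : int -> 'I_m -> T -> R) :=
  forall (j k : 'I_m) (w : R),
    cvg (spec_ps_re X j k w @ \oo) /\ cvg (spec_ps_im X j k w @ \oo).

Definition fre m (X : int -> 'I_m -> T -> R) j k (w : R) : R :=
  (2 * pi)^-1 * lim (spec_ps_re X j k w @ \oo).
Definition fim m (X : int -> 'I_m -> T -> R) j k (w : R) : R :=
  (2 * pi)^-1 * lim (spec_ps_im X j k w @ \oo).

End TimeSeries.

Definition Cp {R : realType} (p : nat) (g : R -> R) :=
  (forall i, (i < p)%N -> forall x : R, derivable (derive1n i g) x 1) /\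
  continuous (derive1n p g).

Section Assumptions.
Context {R : realType} {d : measure_display} {T : measurableType d}.
Variable P : probability T R.

Definition assumptionA (p : nat) m (X : int -> 'I_m -> T -> R) :=
  spec_well_defined P X /\
  forall j k : 'I_m, Cp p (fre P X j k) /\ Cp p (fim P X j k).

(* joint cumulant of Y_0,...,Y_{r-1} via the moment/cumulant formula over
   set partitions *)
Definition cum (r : nat) (Y : 'I_r -> T -> R) : R :=
  \sum_(Q : {set {set 'I_r}} | finset.partition Q [set: 'I_r])
    (-1) ^+ (#|Q|.-1) * (#|Q|.-1)`!%:R *
    \prod_(B : {set 'I_r} | B \in Q) fine 'E_P[(fun w => \prod_(i : 'I_r | i \in B) Y i w)].

Definition indep_vectors dZ (Z : int -> 'I_dZ -> T -> R) :=
  forall (k : nat) (tt : 'I_k -> int), injective tt ->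
  forall B : 'I_k -> 'I_dZ -> set R, (forall i c, measurable (B i c)) ->
    P (\bigcap_(i in [set: 'I_k]) \bigcap_(c in [set: 'I_dZ])
          (Z (tt i) c @^-1` B i c)) =
    (\prod_(i < k) P (\bigcap_(c in [set: 'I_dZ]) (Z (tt i) c @^-1` B i c)))%E.

Definition ident_distr dZ (Z : int -> 'I_dZ -> T -> R) :=
  forall (t : int) (B : 'I_dZ -> set R), (forall c, measurable (B c)) ->
    P (\bigcap_(c in [set: 'I_dZ]) (Z t c @^-1` B c)) =
    P (\bigcap_(c in [set: 'I_dZ]) (Z 0 c @^-1` B c)).

Definition assumptionB_linear m (X : int -> 'I_m -> T -> R) :=
  exists (dZ : nat) (mu : 'I_m -> R) (Z : int -> 'I_dZ -> T -> R)
         (Psi : int -> 'M[R]_(m, dZ)),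
    (forall t c, measurable_fun setT (Z t c)) /\
        indep_vectors Z /\ ident_distr Z /\
        (forall t c, ('E_P[Z t c] = 0)%E) /\
        (forall t c, ('E_P[(fun w => Z t c w ^+ 4)%R] < +oo)%E) /\
        (\esum_(l in [set: int])
            (\sum_(a < m) \sum_(c < dZ) Psi l a c ^+ 2)%:E < +oo)%E /\
        forall (t : int) (a : 'I_m),
          {ae P, forall w,
            (fun N : nat => \sum_(i < (2 * N).+1)
               \sum_(c < dZ) Psi (i%:Z - N%:Z) a c * Z (t - (i%:Z - N%:Z)) c w)
            @ \oo --> X t a w - mu a}.

(* Assumption B(ii): condition (B1) of Taniguchi-Kakizawa (2000, p.55);
   the cumulants presuppose finite moments of every order.
   r = s+2 >= 2, components a_1..a_r, q in {1,..,r-1}. *)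
Definition assumptionB_cumulant m (X : int -> 'I_m -> T -> R) :=
  (forall (t : int) (a : 'I_m) (p : nat),
      ('E_P[(fun w => `|X t a w| ^+ p)%R] < +oo)%E) /\
  forall (s : nat) (a : 'I_s.+2 -> 'I_m) (q : 'I_s.+1),
    (\esum_(u in [set: {ffun 'I_s.+1 -> int}])
       ((1 + `|u q|%:~R) *
        `|cum (fun i : 'I_s.+2 =>
                 X (if unlift ord_max i is Some i' then u i' else 0) (a i))|
       )%:E < +oo)%E.

Definition assumptionB m (X : int -> 'I_m -> T -> R) :=
  strictly_stationary P X /\
  (assumptionB_linear X \/ assumptionB_cumulant X).

End Assumptions.

Section Estimator.
Context {R : realType} {d : measure_display} {T : measurableType d}.
Variables (m : nat) (X : int -> 'I_m -> T -> R).

Definition xbar (n : nat) (a : 'I_m) (w : T) : R :=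
  n%:R^-1 * \sum_(t < n) X (t.+1)%:Z a w.

Definition gamhat_nat (n : nat) (j k : 'I_m) (h : nat) (w : T) : R :=
  n%:R^-1 * \sum_(t < n - h)
     (X (t.+1 + h)%:Z j w - xbar n j w) * (X (t.+1)%:Z k w - xbar n k w).

Definition gamhat (n : nat) (j k : 'I_m) (h : int) (w : T) : R :=
  match h with
  | Posz h' => if (h' < n)%N then gamhat_nat n j k h' w else 0
  | Negz h' => if (h'.+1 < n)%N then gamhat_nat n k j h'.+1 w else 0
  end.

(* real part of the periodogram entry I_{jk}(lam)
   = (2 pi)^-1 sum_h cos(lam h) hat gamma_{jk}(h)  (hat gamma real,
   and hat gamma(h) = 0 for |h| >= n, so |h| <= n suffices) *)
Definition perio_re (n : nat) (j k : 'I_m) (lam : R) (w : T) : R :=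
  (2 * pi)^-1 * \sum_(i < (2 * n).+1)
     cos (lam * ((i%:Z - n%:Z)%:~R)) * gamhat n j k (i%:Z - n%:Z) w.

Definition fourier_freq (n : nat) (s : int) : R := 2 * pi * s%:~R / n%:R.

Definition reg_start (n M : nat) (theta : R) : int :=
  if theta == 0 then 1 else (n./2)%:Z - M%:Z + 1.

Definition reg_index (n M : nat) (theta : R) (i : 'I_M) : int :=
  reg_start n M theta + i%:Z.
Arguments reg_index : clear implicits.

Definition design (n M : nat) (theta : R) : 'M[R]_(M, 2) :=
  \matrix_(i < M, c < 2)
     if c == ord0 then 1 else (theta - fourier_freq n (reg_index n M theta i)) ^+ 2.

Definition response (n M : nat) (theta : R) (j k : 'I_m) (w : T) : 'cV[R]_M :=
  \col_(i < M) perio_re n j k (fourier_freq n (reg_index n M theta i)) w.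

Definition ftilde (n M : nat) (theta : R) (j k : 'I_m) (w : T) : R :=
  let Xd := design n M theta in
  (invmx (Xd^T *m Xd) *m (Xd^T *m response n M theta j k w)) ord0 ord0.

End Estimator.

(* Main.v *)
Require Import Defs.
From HB Require Import structures.
From mathcomp Require Import all_boot all_order all_algebra.
From mathcomp Require Import all_classical all_reals all_analysis.
From mathcomp Require Import measurable_realfun ring lra zify.
Set Implicit Arguments. Unset Strict Implicit. Unset Printing Implicit Defensive.
Import Order.TTheory GRing.Theory Num.Theory.
Import numFieldNormedType.Exports.
Local Open Scope classical_set_scope.
Local Open Scope ring_scope.

(** The obstacle is how little A says at first: the symmetric partial sums converge pointwise, with
    neither absolute nor uniform convergence, so coefficients cannot be read off by integrating the
    series. The series divided by h^2 does converge uniformly; bounding its iterated second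
    differences and sampling them on a grid recovers the coefficients. What is obtained concerns
    gamma_jk(h) + gamma_jk(-h), which suits the bias. The variance would call for gamma_jk(h) lag by
    lag. Under (ii) the second cumulants supply it. Under (i) mixed terms are avoided: the
    contributions of the innovation pairs (u, v) and (v, u) are compared by 2ab <= a^2 + b^2, after
    which only Gram matrices of j with j and of k with k remain, and gamma_aa is even. The
    moving-average truncation is controlled in mean square, so products are controlled in L^1; hence
    the concentration bound is on E|Q - E Q|, with a free delta coming from |y| <= delta + y^2 /
    delta. The truncation order depends on n, so the variance bounds are made uniform in it. *)

(* The OLS intercept is an average, with weights that sum to one and are
   O(1/M), of periodogram ordinates at Fourier frequencies 2 pi s / n with
   0 < s < n. At these frequencies the sample mean cancels, so the estimator is
   a quadratic form Q in the cosine and sine transforms of X - mu.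

   Bias. By assumption A, the cosine series with coefficients
   gamma(h) + gamma(-h) converges everywhere to a function with a continuous
   second derivative; the Riemann-Schwarz theory of trigonometric series then
   gives gamma(h) + gamma(-h) = O(1/h^2). Hence the series is equicontinuous in
   the frequency, and the Cesaro means that form E Q converge to f(theta).

   Variance. Write Q = sum q(t,t') (X_t - mu)(X_t' - mu). Bessel's inequality
   gives sum q^2 = O(1/M), and q = O(1/n). Under (ii) the variance of Q splits
   into two products of covariances, bounded by Schur's test, and a fourth
   cumulant term of order n (1/n)^2. Under (i) Q is approximated in L^1 by
   the same form in a finite moving average, a quadratic form in independent
   vectors whose variance is bounded by the Gram matrices of the transforms,
   controlled by Schur's test because the covariances are summable, and by a
   diagonal term of order 1/M. In both cases E|Q - E Q| <= delta + K / (M delta) for every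
   delta > 0. *)

(** * Expectation and moments *)

Section Expectation.
Context {d} {T : measurableType d} {R : realType} (P : probability T R).
Implicit Types f g : T -> R.

Definition Ex f : R := \int[P]_x f x.
Definition itg f := P.-integrable setT (EFin \o f).
Definition L2 f := measurable_fun setT f /\ itg (fun x => f x ^+ 2).
Definition L4 f := measurable_fun setT f /\ itg (fun x => f x ^+ 4).

Lemma itg_mf f : itg f -> measurable_fun setT f.
Proof. by move=> /measurable_int/measurable_EFinP. Qed.

Lemma ExE f : fine 'E_P[f] = Ex f.
Proof. by rewrite unlock. Qed.

Lemma ExpE f : itg f -> ('E_P[f] = (Ex f)%:E)%E.
Proof. by move=> h; rewrite /Ex /Rintegral fineK ?unlock//; exact: integrable_fin_num. Qed.

Lemma eq_Ex f g : f =1 g -> Ex f = Ex g.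
Proof. by move=> fg; apply: eq_Rintegral => x _. Qed.

Lemma eq_itg f g : f =1 g -> itg f -> itg g.
Proof. by move=> fg; apply: eq_integrable => // x _ /=; rewrite fg. Qed.

Lemma itg_cst c : itg (fun=> c).
Proof. exact: finite_measure_integrable_cst. Qed.

Lemma itgD f g : itg f -> itg g -> itg (fun x => f x + g x).
Proof. by move=> hf hg; have := integrableD measurableT hf hg; exact: eq_integrable. Qed.

Lemma itgB f g : itg f -> itg g -> itg (fun x => f x - g x).
Proof. by move=> hf hg; have := integrableB measurableT hf hg; exact: eq_integrable. Qed.

Lemma itgZ c f : itg f -> itg (fun x => c * f x).
Proof. by move=> hf; have := integrableZl measurableT c hf; exact: eq_integrable. Qed.

Lemma itg_sum I (s : seq I) (Q : pred I) (h : I -> T -> R) :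
  (forall i, Q i -> itg (h i)) -> itg (fun x => \sum_(i <- s | Q i) h i x).
Proof.
move=> H; have := @integrable_sum _ _ _ P setT measurableT I s Q (fun i => EFin \o h i) H.
by apply: eq_integrable => // x _ /=; rewrite sumEFin.
Qed.

Lemma itg_abs f : itg f -> itg (fun x => `|f x|).
Proof. exact: integrable_norm. Qed.

Lemma le_itg f g : measurable_fun setT f -> (forall x, `|f x| <= g x) -> itg g -> itg f.
Proof.
move=> mf fg; apply: le_integrable => //; first exact/measurable_EFinP.
by move=> x _ /=; rewrite lee_fin (le_trans (fg x)) ?ler_norm.
Qed.

Lemma Ex_cst c : Ex (fun=> c) = c.
Proof.
rewrite /Ex Rintegral_cst//.
have := @probability_setT _ _ _ P => /= ->.
by rewrite mulr1. Qed.

Lemma ExD f g : itg f -> itg g -> Ex (fun x => f x + g x) = Ex f + Ex g.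
Proof. exact: RintegralD. Qed.

Lemma ExB f g : itg f -> itg g -> Ex (fun x => f x - g x) = Ex f - Ex g.
Proof. exact: RintegralB. Qed.

Lemma ExZ c f : itg f -> Ex (fun x => c * f x) = c * Ex f.
Proof. exact: RintegralZl. Qed.

Lemma Ex_sum I (s : seq I) (Q : pred I) (h : I -> T -> R) :
  (forall i, Q i -> itg (h i)) ->
  Ex (fun x => \sum_(i <- s | Q i) h i x) = \sum_(i <- s | Q i) Ex (h i).
Proof.
move=> H; elim: s => [|i s IH].
  by rewrite big_nil -[RHS](Ex_cst 0); apply: eq_Ex => x; rewrite big_nil.
rewrite big_cons -IH; case: ifPn => Qi.
  rewrite -ExD; [|exact: H|exact: itg_sum].
  by apply: eq_Ex => x; rewrite big_cons Qi.
by apply: eq_Ex => x; rewrite big_cons (negbTE Qi).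
Qed.

Lemma le_Ex f g : itg f -> itg g -> (forall x, f x <= g x) -> Ex f <= Ex g.
Proof. by move=> hf hg fg; apply: le_Rintegral. Qed.

Lemma Ex_ge0 f : (forall x, 0 <= f x) -> 0 <= Ex f.
Proof. by move=> fg; apply: Rintegral_ge0. Qed.

Lemma le_abs_Ex f : itg f -> `|Ex f| <= Ex (fun x => `|f x|).
Proof. by move=> fg; apply: le_normr_Rintegral. Qed.

Lemma L2M f g : L2 f -> L2 g -> itg (fun x => f x * g x).
Proof.
move=> [mf f2] [mg g2]; apply: le_itg (itgD f2 g2); first exact: measurable_funM.
by move=> x; rewrite normrM; have := real_normK (num_real (f x)); have := real_normK (num_real (g x)); move: (`|f x|) (`|g x|) => a b <- <-; nra.
Qed.

Lemma L2_cst c : L2 (fun=> c).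
Proof. by split; [exact: measurable_cst|exact: itg_cst]. Qed.

Lemma L2_itg f : L2 f -> itg f.
Proof. by move=> hf; apply: eq_itg (L2M hf (L2_cst 1)) => x; rewrite mulr1. Qed.

Lemma L2Z c f : L2 f -> L2 (fun x => c * f x).
Proof.
move=> [mf hf]; split; first exact: measurable_funM.
by apply: eq_itg (itgZ (c^+2) hf) => x; rewrite exprMn.
Qed.

Lemma L2D f g : L2 f -> L2 g -> L2 (fun x => f x + g x).
Proof.
move=> hf hg; split; first by apply: measurable_funD; [case: hf|case: hg].
apply: eq_itg (itgD (itgD (proj2 hf) (proj2 hg)) (itgZ 2 (L2M hf hg))) => x.
by ring.
Qed.

Lemma L2B f g : L2 f -> L2 g -> L2 (fun x => f x - g x).
Proof.
move=> hf hg; have -> : (fun x => f x - g x) = (fun x => f x + -1 * g x).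
  by apply/funext => x; rewrite mulN1r.
by apply: L2D => //; exact: L2Z.
Qed.

Lemma L2_sum I (s : seq I) (Q : pred I) (h : I -> T -> R) :
  (forall i, Q i -> L2 (h i)) -> L2 (fun x => \sum_(i <- s | Q i) h i x).
Proof.
move=> H; elim: s => [|i s IH].
  by under eq_fun do rewrite big_nil; exact: L2_cst.
under eq_fun do rewrite big_cons.
by case: (boolP (Q i)) => Qi //; apply: L2D => //; exact: H.
Qed.

Lemma L4_L2sqr f : L4 f -> L2 (fun x => f x ^+ 2).
Proof.
move=> [mf hf]; split; first exact: measurable_funX.
by apply: eq_itg hf => x; rewrite -exprM.
Qed.

Lemma L4_L2 f : L4 f -> L2 f.
Proof. by move=> hf; split; [case: hf|apply: L2_itg; exact: L4_L2sqr]. Qed.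

Lemma L4M f g : L4 f -> L4 g -> L2 (fun x => f x * g x).
Proof.
move=> hf hg; split; first by apply: measurable_funM; [case: hf|case: hg].
by apply: eq_itg (L2M (L4_L2sqr hf) (L4_L2sqr hg)) => x; rewrite exprMn.
Qed.

Lemma L4_cst c : L4 (fun=> c).
Proof. by split; [exact: measurable_cst|exact: itg_cst]. Qed.

Lemma L4Z c f : L4 f -> L4 (fun x => c * f x).
Proof.
move=> [mf hf]; split; first exact: measurable_funM.
by apply: eq_itg (itgZ (c^+4) hf) => x; rewrite exprMn.
Qed.

Lemma L4D f g : L4 f -> L4 g -> L4 (fun x => f x + g x).
Proof.
move=> hf hg; split; first by apply: measurable_funD; [case: hf|case: hg].
have h := L2D (L2D (L4_L2sqr hf) (L4_L2sqr hg)) (L2Z 2 (L4M hf hg)).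
by apply: eq_itg (proj2 h) => x; ring.
Qed.

Lemma L4B f g : L4 f -> L4 g -> L4 (fun x => f x - g x).
Proof.
move=> hf hg; have -> : (fun x => f x - g x) = (fun x => f x + -1 * g x).
  by apply/funext => x; rewrite mulN1r.
by apply: L4D => //; exact: L4Z.
Qed.

Lemma L4_sum I (s : seq I) (Q : pred I) (h : I -> T -> R) :
  (forall i, Q i -> L4 (h i)) -> L4 (fun x => \sum_(i <- s | Q i) h i x).
Proof.
move=> H; elim: s => [|i s IH].
  by under eq_fun do rewrite big_nil; exact: L4_cst.
under eq_fun do rewrite big_cons.
by case: (boolP (Q i)) => Qi //; apply: L4D => //; exact: H.
Qed.

Lemma Ex_CS f g : L2 f -> L2 g ->
  Ex (fun x => f x * g x) ^+ 2 <= Ex (fun x => f x ^+ 2) * Ex (fun x => g x ^+ 2).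
Proof.
move=> hf hg; set a := Ex (fun x => f x ^+ 2); set b := Ex (fun x => f x * g x).
set c := Ex (fun x => g x ^+ 2).
have H u v : 0 <= u ^+ 2 * a + 2 * u * v * b + v ^+ 2 * c.
  have : 0 <= Ex (fun x => (u * f x + v * g x) ^+ 2) by apply: Ex_ge0 => x; exact: sqr_ge0.
  suff -> : Ex (fun x => (u * f x + v * g x) ^+ 2) = u ^+ 2 * a + 2 * u * v * b + v ^+ 2 * c by [].
  rewrite /a /b /c -!ExZ ?(proj2 hf) ?(proj2 hg)//; [|exact: L2M].
  rewrite -!ExD; first by apply: eq_Ex => x; ring.
  - by apply: itgD; apply: itgZ; [case: hf|exact: L2M].
  - by apply: itgZ; case: hg.
  - by apply: itgZ; case: hf.
  - by apply: itgZ; exact: L2M.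
(* If a = 0 and b is nonzero, the form is affine in u, and at u = -(c + 1) / b, v = 1 it equals -c -
   2 < 0. Otherwise the point u = -b, v = a gives a (a c - b^2) >= 0. *)
have a0 : 0 <= a by apply: Ex_ge0 => x; exact: sqr_ge0.
clearbody a b c; have [a00|ane] := eqVneq a 0.
  have [->|bne] := eqVneq b 0; first by rewrite a00 mul0r expr0n.
  have := H 0 1; rewrite a00 => h1; have := H (- (c + 1) / b) 1; rewrite a00.
  have -> : 2 * (- (c + 1) / b) * 1 * b = - (2 * (c + 1)) by field.
  by move=> h2; exfalso; nra.
have := H (- b) a; have : 0 < a by rewrite lt_def ane.
move=> ap h; have {}h : 0 <= a * (a * c - b ^+ 2) by nra.
by rewrite -subr_ge0 -(pmulr_rge0 _ ap).
Qed.

Lemma markov_Ex f (eps : R) : itg f -> 0 < eps ->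
  (P [set w | (eps < `|f w|)%R] <= (eps^-1 * Ex (fun x => `|f x|))%:E)%E.
Proof.
move=> hf e0; have ha := itg_abs hf.
have mf := itg_mf hf.
rewrite mulrC EFinM lee_pdivlMr//.
have -> : ((Ex (fun x => `|f x|))%:E = \int[P]_x `|(f x)%:E|)%E.
  by rewrite /Ex /Rintegral fineK//; exact: integrable_fin_num ha.
have := @le_integral_comp_abse _ _ _ P setT measurableT (EFin \o f) eps id
  (@measurable_id _ _ setT) (fun r h => h) (fun x y _ _ h => h) _ e0.
rewrite muleC setTI => /(_ ((iffRL (measurable_EFinP _ _)) mf)); apply: le_trans.
rewrite lee_pmul2r ?lte_fin//; apply: le_measure.
- rewrite inE; have -> : [set w | eps < `|f w|] = (Num.norm \o f) @^-1` `]eps, +oo[%classic.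
    by apply/seteqP; split => w /=; rewrite in_itv/= andbT.
  by rewrite -[X in measurable X]setTI; apply: (measurableT_comp (@normr_measurable R setT) mf).
- rewrite inE; have -> : [set x | (eps%:E <= `|(EFin \o f) x|)%E] = (Num.norm \o f) @^-1` `[eps, +oo[%classic.
    by apply/seteqP; split => w /=; rewrite in_itv/= andbT lee_fin.
  by rewrite -[X in measurable X]setTI; apply: (measurableT_comp (@normr_measurable R setT) mf).
- by move=> w /= h; rewrite lee_fin ltW.
Qed.

End Expectation.

Lemma Ex_dominated {d} {T : measurableType d} {R : realType} (P : probability T R)
    (F : nat -> T -> R) (f g : T -> R) :
  (forall n, measurable_fun setT (F n)) -> itg P g ->
  (forall n x, `|F n x| <= g x) -> (forall x, F ^~ x @ \oo --> f x) ->
  (fun n => Ex P (F n)) @ \oo --> Ex P f.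
Proof.
move=> mF ig Fg Ff.
have mf n : measurable_fun setT (EFin \o F n) by exact/measurable_EFinP.
have cvgE x : [set: T] x -> (fun n => (EFin \o F n) x) @ \oo --> (EFin \o f) x.
  by move=> _; apply: cvg_EFin; [exact: nearW|exact: Ff].
have fg n x : [set: T] x -> (`|(EFin \o F n) x| <= (EFin \o g) x)%E.
  by move=> _ /=; rewrite lee_fin.
have := @dominated_cvg _ _ _ P setT measurableT (fun n => EFin \o F n) (EFin \o f) (EFin \o g) mf cvgE (fun x _ => erefl) ig fg.
have iF n : itg P (F n) by apply: le_itg (Fg n) ig; exact: mF.
have if_ : itg P f.
  have mf_ : measurable_fun setT (EFin \o f) by exact: (emeasurable_fun_cvg _ _ mf cvgE).
  by have [] := @dominated_convergence _ _ _ P setT measurableT (fun n => EFin \o F n) (EFin \o f) (EFin \o g) mf mf_ (aeW _ cvgE) ig (aeW _ (fun x n h => fg n x h)).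
move=> h; apply: fine_cvg.
by rewrite /Ex /Rintegral fineK//; exact: integrable_fin_num if_.
Qed.

(** * From probabilities of rectangles to moments of products *)

Section SwapCoordinate.
Context {d d'} {T : measurableType d} {T' : measurableType d'} {R : realType}.
Variables (P : probability T R) (P' : probability T' R).

Lemma indic_le1 {U : Type} (B : set U) (y : U) : `|\1_B y : R| <= 1.
Proof. by rewrite indicE; case: (_ \in _); rewrite ?normr1 ?normr0. Qed.

(** A bounded [f] is a uniform limit of step functions on its own level sets of height 1/(N+1), and
    the hypothesis covers each level set. The weights [W] and [W'] will carry the other factors of a
    product, so that coordinates can be treated one at a time. *)
Lemma Ex_swap_coord_ge0 (W : T -> R) (W' : T' -> R) (Y : T -> R) (Y' : T' -> R)
    (k K : R) (f : R -> R) :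
  itg P W -> itg P' W' -> measurable_fun setT Y -> measurable_fun setT Y' ->
  measurable_fun setT f -> (forall y, 0 <= f y <= K) ->
  (forall B, measurable B ->
    Ex P (fun x => W x * \1_B (Y x)) = k * Ex P' (fun x => W' x * \1_B (Y' x))) ->
  Ex P (fun x => W x * f (Y x)) = k * Ex P' (fun x => W' x * f (Y' x)).
Proof.
move=> iW iW' mY mY' mf f0K H.
pose L N := (Num.truncn (N.+1%:R * K)).+1.
pose A N i := f @^-1` `[i%:R / N.+1%:R, i.+1%:R / N.+1%:R[%classic.
have mA N i : measurable (A N i) by rewrite -[A N i]setTI; exact: mf.
pose g N y := \sum_(i < L N) (i%:R / N.+1%:R) * \1_(A N i) y : R.
have gf N y : `|f y - g N y| <= N.+1%:R^-1.
  have [f0 fK] := andP (f0K y).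
  have N0 : 0 < N.+1%:R :> R by rewrite ltr0n.
  have nf0 : 0 <= N.+1%:R * f y by rewrite mulr_ge0// ltW.
  have hi : (Num.truncn (N.+1%:R * f y) < L N)%N.
    by rewrite ltnS; apply: le_truncn; rewrite ler_pM2l.
  rewrite /g (bigD1 (Ordinal hi))//= big1 ?addr0; last first.
    move=> i ne; rewrite indicE memNset ?mulr0// /A /= in_itv/= => /andP[h1 h2].
    move/eqP: ne; apply; apply/val_inj => /=; apply/esym/eqP; rewrite truncn_eq//.
    by move: h1 h2; rewrite ler_pdivrMr// ltr_pdivlMr// mulrC => -> ->.
  have /andP[h1 h2] := truncn_itv nf0.
  rewrite indicE mem_set/=; last first.
    by rewrite /A /= in_itv/= ler_pdivrMr// ltr_pdivlMr// ![f y * _]mulrC h1 h2.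
  have h1' : (Num.truncn (N.+1%:R * f y))%:R / N.+1%:R <= f y by rewrite ler_pdivrMr// [leRHS]mulrC.
  have h2' : f y < (Num.truncn (N.+1%:R * f y)).+1%:R / N.+1%:R by rewrite ltr_pdivlMr// [ltLHS]mulrC.
  move: h2'; rewrite -natr1 mulrDl mul1r mulr1 => h2'.
  have aux (a b z : R) : a <= z -> z < a + b -> `|z - a| <= b.
    by move=> ? ?; rewrite ler_norml; apply/andP; split; lra.
  exact: aux h1' h2'.
have lim (d0 : measure_display) (U : measurableType d0) (Q : probability U R) (V Z : U -> R) :
   itg Q V -> measurable_fun setT Z ->
   (fun N => Ex Q (fun x => V x * g N (Z x))) @ \oo --> Ex Q (fun x => V x * f (Z x)).
  move=> iV mZ.
  have mV := itg_mf iV.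
  have mg N : measurable_fun setT (fun x => g N (Z x)).
    apply: measurable_sum => i; apply: measurable_funM => //.
    by apply: (measurableT_comp _ mZ); exact: measurable_indic.
  apply: (@Ex_dominated _ _ _ _ _ _ (fun x => (1 + K) * `|V x|)).
  - by move=> N; exact: measurable_funM.
  - by apply: itgZ; exact: itg_abs.
  - move=> N x; rewrite normrM mulrC ler_wpM2r//.
    have := gf N (Z x); have /andP[h1 h2] := f0K (Z x).
    have : N.+1%:R^-1 <= 1 :> R by rewrite invf_le1 ?ler1n ?ltr0n.
    by move=> h3 h4; have := le_trans h4 h3; rewrite ler_norml => /andP[h5 h6]; rewrite ler_norml; lra.
  - move=> x; apply: cvgM; first exact: cvg_cst.
    apply/cvgrPdist_le => e e0; near=> N.
    apply: (le_trans (gf N (Z x))); apply: ltW.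
    by near: N; exact: (near_infty_natSinv_lt (PosNum e0)).
apply: (cvg_unique _ (lim _ _ P W Y iW mY)) => //.
have -> : (fun N => Ex P (fun x => W x * g N (Y x))) = (fun N => k * Ex P' (fun x => W' x * g N (Y' x))).
  apply/funext => N.
  have E (d0 : measure_display) (U : measurableType d0) (Q : probability U R) (V Z : U -> R) :
   itg Q V -> measurable_fun setT Z ->
   Ex Q (fun x => V x * g N (Z x)) = \sum_(i < L N) (i%:R / N.+1%:R) * Ex Q (fun x => V x * \1_(A N i) (Z x)).
    move=> iV mZ.
    have iVi i : itg Q (fun x => V x * \1_(A N i) (Z x)).
      apply: le_itg (itg_abs iV).
        apply: measurable_funM; first exact: (itg_mf iV).
        by apply: (measurableT_comp _ mZ); exact: measurable_indic.
      by move=> x; rewrite normrM ler_piMr// indic_le1.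
    under [RHS]eq_bigr => i _ do rewrite -ExZ//.
    rewrite -Ex_sum; last by move=> i _; exact: itgZ.
    by apply: eq_Ex => x; rewrite /g mulr_sumr; apply: eq_bigr => i _; rewrite mulrCA.
  rewrite !E// mulr_sumr; apply: eq_bigr => i _.
  by rewrite H// mulrCA.
by apply: cvgM; [exact: cvg_cst|exact: lim].
Unshelve. all: by end_near.
Qed.

(** Adding K makes [f] nonnegative; the extra term K E W is matched by taking the whole line for
    B. *)
Lemma Ex_swap_coord (W : T -> R) (W' : T' -> R) (Y : T -> R) (Y' : T' -> R)
    (k K : R) (f : R -> R) :
  itg P W -> itg P' W' -> measurable_fun setT Y -> measurable_fun setT Y' ->
  measurable_fun setT f -> (forall y, `|f y| <= K) ->
  (forall B, measurable B ->
    Ex P (fun x => W x * \1_B (Y x)) = k * Ex P' (fun x => W' x * \1_B (Y' x))) ->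
  Ex P (fun x => W x * f (Y x)) = k * Ex P' (fun x => W' x * f (Y' x)).
Proof.
move=> iW iW' mY mY' mf fK H.
have mfK : measurable_fun setT (fun y => f y + K) by exact: measurable_funD.
have h1 : forall y, 0 <= f y + K <= 2 * K.
  by move=> y; have := fK y; rewrite ler_norml => /andP[? ?]; apply/andP; split; lra.
have := Ex_swap_coord_ge0 iW iW' mY mY' mfK h1 H.
have E (d0 : measure_display) (U : measurableType d0) (Q : probability U R) (V Z : U -> R) :
   itg Q V -> measurable_fun setT Z ->
   Ex Q (fun x => V x * (f (Z x) + K)) = Ex Q (fun x => V x * f (Z x)) + K * Ex Q V.
  move=> iV mZ; rewrite -ExZ// -ExD.
  - by apply: eq_Ex => x; ring.
  - apply: le_itg (itgZ K (itg_abs iV)).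
      by apply: measurable_funM; [exact: (itg_mf iV)|exact: (measurableT_comp mf)].
    by move=> x; rewrite normrM mulrC ler_wpM2r.
  - exact: itgZ.
rewrite !E// mulrDr; have := H setT measurableT.
have -> : Ex P (fun x => W x * \1_setT (Y x)) = Ex P W.
  by apply: eq_Ex => x; rewrite indicT mulr1.
have -> : Ex P' (fun x => W' x * \1_setT (Y' x)) = Ex P' W'.
  by apply: eq_Ex => x; rewrite indicT mulr1.
by move=> ->; lra.
Qed.

End SwapCoordinate.

Section ProductMoments.
Context {d d'} {T : measurableType d} {T' : measurableType d'} {R : realType}.
Variables (P : probability T R) (P' : probability T' R).

Lemma mf_prod {d0} {U : measurableType d0} n (Y : 'I_n -> U -> R) (Q : pred 'I_n) :
  (forall i, measurable_fun setT (Y i)) ->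
  measurable_fun setT (fun x => \prod_(i < n | Q i) Y i x).
Proof.
move=> mY; elim: (index_enum _) => [|i s IH].
  rewrite (_ : (fun _ => _) = cst 1); last by apply/funext => x; rewrite big_nil.
  exact: measurable_cst.
rewrite (_ : (fun _ => _) = (fun x => if Q i then Y i x * \prod_(j <- s | Q j) Y j x else \prod_(j <- s | Q j) Y j x)); last first.
  by apply/funext => x; rewrite big_cons.
by case: (Q i) => //; exact: measurable_funM.
Qed.

Lemma itgM_bounded {d0} {U : measurableType d0} (Q : probability U R) (V b : U -> R) (K : R) :
  itg Q V -> measurable_fun setT b -> (forall x, `|b x| <= K) -> itg Q (fun x => V x * b x).
Proof.
move=> iV mb bK; apply: le_itg (itgZ K (itg_abs iV)).
  by apply: measurable_funM => //; exact: itg_mf iV.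
by move=> x; rewrite normrM mulrC ler_wpM2r.
Qed.

Lemma Ex_prod_bounded n (W : T -> R) (W' : T' -> R) (Y : 'I_n -> T -> R) (Y' : 'I_n -> T' -> R)
    (k : R) (f : 'I_n -> R -> R) :
  itg P W -> itg P' W' ->
  (forall i, measurable_fun setT (Y i)) -> (forall i, measurable_fun setT (Y' i)) ->
  (forall i, measurable_fun setT (f i)) ->
  (forall i, exists K, forall y, `|f i y| <= K) ->
  (forall B : 'I_n -> set R, (forall i, measurable (B i)) ->
    Ex P (fun x => W x * \prod_(i < n) \1_(B i) (Y i x)) =
    k * Ex P' (fun x => W' x * \prod_(i < n) \1_(B i) (Y' i x))) ->
  Ex P (fun x => W x * \prod_(i < n) f i (Y i x)) =
  k * Ex P' (fun x => W' x * \prod_(i < n) f i (Y' i x)).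
Proof.
move=> iW iW' mY mY' mf fK H.
(* Coordinates of index at least [m] still carry indicators. Raising [m] frees one more coordinate,
   all the other factors being absorbed into the weight. *)
suff G m : forall g : 'I_n -> R -> R, (forall i, measurable_fun setT (g i)) ->
    (forall i, exists K, forall y, `|g i y| <= K) ->
    (forall i : 'I_n, (m <= i)%N -> exists2 B, measurable B & g i = \1_B) ->
  Ex P (fun x => W x * \prod_(i < n) g i (Y i x)) =
  k * Ex P' (fun x => W' x * \prod_(i < n) g i (Y' i x)).
  by apply: (G n) => // i; rewrite leqNgt ltn_ord.
elim: m => [|m IH] g mg gK gB.
  have /choice[B hB] : forall i, exists B, measurable B /\ g i = \1_B.
    by move=> i; have [B mB e] := gB i isT; exists B.
  under [in LHS]eq_Ex do under eq_bigr do rewrite (proj2 (hB _)).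
  under [in RHS]eq_Ex do under eq_bigr do rewrite (proj2 (hB _)).
  by apply: H => i; case: (hB i).
have [mn|nm] := ltnP m n; last first.
  by apply: IH => // i mi; have := ltn_ord i; rewrite ltnNge (leq_trans nm mi).
pose i0 := Ordinal mn.
have split_ d0 (U : measurableType d0) (V : U -> R) (Z : 'I_n -> U -> R) (h : 'I_n -> R -> R) x :
    V x * \prod_(i < n) h i (Z i x) = V x * (\prod_(i < n | i != i0) h i (Z i x)) * h i0 (Z i0 x).
  by rewrite (bigD1 i0)//= mulrAC -mulrA.
have [K0 hK0] := gK i0.
have iV d0 (U : measurableType d0) (Q : probability U R) (V : U -> R) (Z : 'I_n -> U -> R) :
    itg Q V -> (forall i, measurable_fun setT (Z i)) ->
    itg Q (fun x => V x * (\prod_(i < n | i != i0) g i (Z i x))).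
  move=> iV mZ; have /choice[K hK] := gK.
  apply: (@itgM_bounded _ _ _ _ _ (\prod_(i < n | i != i0) K i)) => //.
    by apply: mf_prod => i; exact: measurableT_comp.
  by move=> x; rewrite normr_prod; apply: ler_prod => i _; rewrite normr_ge0 hK.
rewrite (eq_Ex _ (split_ _ _ W Y g)) (eq_Ex _ (split_ _ _ W' Y' g)).
apply: (@Ex_swap_coord _ _ _ _ _ _ _ _ _ _ _ k K0) => //; try exact: iV.
move=> B mB.
pose g' i := if i == i0 then \1_B else g i.
have e d0 (U : measurableType d0) (V : U -> R) (Z : 'I_n -> U -> R) x :
    V x * (\prod_(i < n | i != i0) g i (Z i x)) * \1_B (Z i0 x) = V x * \prod_(i < n) g' i (Z i x).
  rewrite split_ /g' eqxx; congr (_ * _ * _).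
  by apply: eq_bigr => i /negbTE ->.
rewrite (eq_Ex _ (e _ _ W Y)) (eq_Ex _ (e _ _ W' Y')).
apply: IH.
- by move=> i; rewrite /g'; case: eqP => // _; exact: measurable_indic.
- by move=> i; rewrite /g'; case: eqP => // _; exists 1; exact: indic_le1.
- move=> i mi; rewrite /g'; case: eqP => [_|ne]; first by exists B.
  by apply: gB; rewrite ltn_neqAle mi andbT; apply/eqP => e'; apply: ne; apply/val_inj.
Qed.

Definition clip (K x : R) : R := Num.max (- K) (Num.min K x).

Lemma clip_le (K x : R) : 0 <= K -> `|clip K x| <= K.
Proof.
by move=> K0; rewrite /clip; (case: (leP K x) => ?; [case: (leP (- K) K)|case: (leP (- K) x)] => ?; rewrite ler_norml; apply/andP; split; lra).
Qed.

Lemma clip_le_norm (K x : R) : 0 <= K -> `|clip K x| <= `|x|.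
Proof.
move=> K0; rewrite /clip; case: (ger0P x) => hx; (case: (leP K x) => ?; [case: (leP (- K) K)|case: (leP (- K) x)] => ?; rewrite ler_norml; apply/andP; split; lra).
Qed.

Lemma clip_id (K x : R) : `|x| <= K -> clip K x = x.
Proof. by rewrite ler_norml => /andP[a b]; rewrite /clip; case: (leP K x) => ?; [case: (leP (- K) K)|case: (leP (- K) x)] => ?; lra. Qed.

Lemma measurable_clip (K : R) : measurable_fun setT (clip K).
Proof. by apply: measurable_maxr => //; apply: measurable_minr. Qed.

Lemma cvg_prod_clip n (y : 'I_n -> R) :
  (fun N : nat => \prod_(i < n) clip N%:R (y i)) @ \oo --> \prod_(i < n) y i.
Proof.
apply/cvgrPdist_le => e e0.
have [K hK] : exists K : nat, forall i, `|y i| <= K%:R.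
  exists (\max_(i < n) (Num.truncn `|y i|).+1)%N => i.
  apply: (@le_trans _ _ (Num.truncn `|y i|).+1%:R).
    by have /andP[_ /ltW] := truncn_itv (normr_ge0 (y i)).
  by rewrite ler_nat; exact: (@leq_bigmax _ (fun i => (Num.truncn `|y i|).+1) i).
near=> N; rewrite (_ : \prod_(i < n) clip N%:R (y i) = \prod_(i < n) y i) ?subrr ?normr0 ?ltW//.
apply: eq_bigr => i _; apply: clip_id; apply: le_trans (hK i) _.
by rewrite ler_nat; near: N; exact: nbhs_infty_ge.
Unshelve. all: by end_near.
Qed.

(** Clipping never increases the modulus of a factor, so the clipped products are dominated by the
    full product. Its integrability therefore suffices for passing to the limit, and the individual
    factors need no moments of their own. *)
Lemma Ex_prod_swap n (W : T -> R) (W' : T' -> R) (Y : 'I_n -> T -> R) (Y' : 'I_n -> T' -> R)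
    (k : R) :
  itg P W -> itg P' W' ->
  (forall i, measurable_fun setT (Y i)) -> (forall i, measurable_fun setT (Y' i)) ->
  itg P (fun x => W x * \prod_(i < n) Y i x) ->
  itg P' (fun x => W' x * \prod_(i < n) Y' i x) ->
  (forall B : 'I_n -> set R, (forall i, measurable (B i)) ->
    Ex P (fun x => W x * \prod_(i < n) \1_(B i) (Y i x)) =
    k * Ex P' (fun x => W' x * \prod_(i < n) \1_(B i) (Y' i x))) ->
  Ex P (fun x => W x * \prod_(i < n) Y i x) = k * Ex P' (fun x => W' x * \prod_(i < n) Y' i x).
Proof.
move=> iW iW' mY mY' iWY iWY' H.
have lim d0 (U : measurableType d0) (Q : probability U R) (V : U -> R) (Z : 'I_n -> U -> R) :
    itg Q V -> (forall i, measurable_fun setT (Z i)) ->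
    itg Q (fun x => V x * \prod_(i < n) Z i x) ->
    (fun N : nat => Ex Q (fun x => V x * \prod_(i < n) clip N%:R (Z i x))) @ \oo -->
      Ex Q (fun x => V x * \prod_(i < n) Z i x).
  move=> iV mZ iVZ; apply: Ex_dominated (itg_abs iVZ) _ _.
  - move=> N; apply: measurable_funM; first exact: itg_mf iV.
    by apply: mf_prod => i; apply: measurableT_comp => //; exact: measurable_clip.
  - move=> N x; rewrite !normrM ler_wpM2l// !normr_prod; apply: ler_prod => i _.
    by rewrite normr_ge0 clip_le_norm.
  - by move=> x; apply: cvgM; [exact: cvg_cst|exact: cvg_prod_clip].
apply: (cvg_unique _ (lim _ _ P W Y iW mY iWY)) => //.
rewrite (_ : (fun N : nat => Ex P _) =
  (fun N : nat => k * Ex P' (fun x => W' x * \prod_(i < n) clip N%:R (Y' i x)))).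
  by apply: cvgM; [exact: cvg_cst|exact: lim].
apply/funext => N; apply: (@Ex_prod_bounded n W W' Y Y' k (fun=> clip N%:R)) => //.
- by move=> i; exact: measurable_clip.
- by move=> i; exists N%:R => y; exact: clip_le.
Qed.

End ProductMoments.

Section ProductMomentIdentities.
Context {d} {T : measurableType d} {R : realType} (P : probability T R).

Lemma prob_indic (A : set T) : measurable A -> P A = (Ex P (\1_A : T -> R))%:E.
Proof.
move=> mA; rewrite -(setIT A) -(@integral_indic _ _ _ P setT)// setIT.
rewrite /Ex /Rintegral fineK//; apply: integrable_fin_num => //.
exact: integrable_indic.
Qed.

Lemma indic_bigcap n (Y : 'I_n -> T -> R) (B : 'I_n -> set R) x :
  \1_(\bigcap_(i in [set: 'I_n]) (Y i @^-1` B i)) x = \prod_(i < n) \1_(B i) (Y i x) :> R.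
Proof.
have [xA|xA] := boolP (x \in \bigcap_(i in [set: 'I_n]) (Y i @^-1` B i)).
  rewrite indicE xA big1// => i _; rewrite indicE mem_set//.
  by move: xA; rewrite inE => /(_ i I).
rewrite indicE (negbTE xA).
have : ~ (\bigcap_(i in [set: 'I_n]) (Y i @^-1` B i)) x by move/mem_set; apply/negP.
move/existsNP => [i /not_implyP[_ hi]].
by rewrite (bigD1 i)//= indicE memNset// mul0r.
Qed.

Lemma measurable_bigcap_ord n (A : 'I_n -> set T) :
  (forall i, measurable (A i)) -> measurable (\bigcap_(i in [set: 'I_n]) A i).
Proof.
move=> mA; apply: fin_bigcap_measurable => //; exact: finite_finpred.
Qed.

Lemma measurable_rect n (Y : 'I_n -> T -> R) (B : 'I_n -> set R) :
  (forall i, measurable_fun setT (Y i)) -> (forall i, measurable (B i)) ->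
  measurable (\bigcap_(i in [set: 'I_n]) (Y i @^-1` B i)).
Proof.
move=> mY mB; apply: measurable_bigcap_ord => i.
by rewrite -[X in measurable X]setTI; exact: mY.
Qed.

Lemma Ex_prod_indic n (Y : 'I_n -> T -> R) (B : 'I_n -> set R) :
  (forall i, measurable_fun setT (Y i)) -> (forall i, measurable (B i)) ->
  P (\bigcap_(i in [set: 'I_n]) (Y i @^-1` B i)) = (Ex P (fun x => \prod_(i < n) \1_(B i) (Y i x)))%:E.
Proof.
move=> mY mB; rewrite prob_indic; last exact: measurable_rect.
by congr EFin; apply: eq_Ex => x; rewrite indic_bigcap.
Qed.

Lemma Ex_prod_eq n (Y Y' : 'I_n -> T -> R) :
  (forall i, measurable_fun setT (Y i)) -> (forall i, measurable_fun setT (Y' i)) ->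
  itg P (fun x => \prod_(i < n) Y i x) -> itg P (fun x => \prod_(i < n) Y' i x) ->
  (forall B : 'I_n -> set R, (forall i, measurable (B i)) ->
    P (\bigcap_(i in [set: 'I_n]) (Y i @^-1` B i)) =
    P (\bigcap_(i in [set: 'I_n]) (Y' i @^-1` B i))) ->
  Ex P (fun x => \prod_(i < n) Y i x) = Ex P (fun x => \prod_(i < n) Y' i x).
Proof.
move=> mY mY' iY iY' H.
have e (Z : 'I_n -> T -> R) : (fun x => \prod_(i < n) Z i x) = (fun x => 1 * \prod_(i < n) Z i x).
  by apply/funext => x; rewrite mul1r.
rewrite e [in RHS]e -[RHS]mul1r; apply: Ex_prod_swap => //; rewrite -?e//; try exact: itg_cst.
move=> B mB; rewrite mul1r.
have := H B mB; rewrite !Ex_prod_indic// => -[].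
move=> h; rewrite (eq_Ex _ (fun x => mul1r _)) h.
by apply: eq_Ex => x; rewrite mul1r.
Qed.

(** The swap lemma is applied twice against the constant weight 1, the factor [k] being the
    expectation of the part not being moved: first the [V] are exchanged with weight the product of
    the [Y], then the [Y] with weight an indicator of the [V]. *)
Lemma Ex_prod_indep n m (Y : 'I_n -> T -> R) (V : 'I_m -> T -> R) :
  (forall i, measurable_fun setT (Y i)) -> (forall i, measurable_fun setT (V i)) ->
  itg P (fun x => \prod_(i < n) Y i x) -> itg P (fun x => \prod_(i < m) V i x) ->
  itg P (fun x => (\prod_(i < n) Y i x) * \prod_(i < m) V i x) ->
  (forall (B : 'I_n -> set R) (C : 'I_m -> set R),
    (forall i, measurable (B i)) -> (forall i, measurable (C i)) ->
    P ((\bigcap_(i in [set: 'I_n]) (Y i @^-1` B i)) `&` (\bigcap_(i in [set: 'I_m]) (V i @^-1` C i))) =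
    (P (\bigcap_(i in [set: 'I_n]) (Y i @^-1` B i)) * P (\bigcap_(i in [set: 'I_m]) (V i @^-1` C i)))%E) ->
  Ex P (fun x => (\prod_(i < n) Y i x) * \prod_(i < m) V i x) =
  Ex P (fun x => \prod_(i < n) Y i x) * Ex P (fun x => \prod_(i < m) V i x).
Proof.
move=> mY mV iY iV iYV H.
have e1 (Z : T -> R) : Ex P Z = Ex P (fun x => 1 * Z x) by apply: eq_Ex => x; rewrite mul1r.
have i1 k (Z : 'I_k -> T -> R) (B : 'I_k -> set R) : (forall i, measurable_fun setT (Z i)) ->
    (forall i, measurable (B i)) -> itg P (fun x => \prod_(i < k) \1_(B i) (Z i x)).
  move=> mZ mB; apply: eq_itg (indic_bigcap Z B) _; exact/integrable_indic/measurable_rect.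
rewrite [X in _ = _ * X]e1; apply: Ex_prod_swap => //; first exact: itg_cst.
  by apply: eq_itg iV => x; rewrite mul1r.
move=> C mC; rewrite -e1 mulrC [X in _ = _ * X]e1.
rewrite (eq_Ex _ (fun x => mulrC _ _)); apply: Ex_prod_swap => //.
- exact: i1.
- exact: itg_cst.
- apply: eq_itg (fun x => mulrC _ _) _.
  apply: (@itgM_bounded _ _ _ P _ (fun x => \prod_(i < m) \1_(C i) (V i x)) 1 iY); first exact: itg_mf (i1 _ _ _ mV mC).
  by move=> x; rewrite -indic_bigcap indic_le1.
- by apply: eq_itg iY => x; rewrite mul1r.
move=> B mB; rewrite -e1.
have := H B C mB mC; rewrite !Ex_prod_indic//.
rewrite prob_indic; last by apply: measurableI; exact: measurable_rect.
rewrite -EFinM mulrC => -[<-]; apply: eq_Ex => x.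
by rewrite indicI/= mulrC !indic_bigcap.
Qed.

End ProductMomentIdentities.

(** * The periodogram at Fourier frequencies *)

Section Trigonometric.
Context {R : realType}.
Implicit Types (x y b : R).

Lemma sinD2pin x (k : nat) : sin (x + 2 * pi * k%:R) = sin x.
Proof.
elim: k => [|k IH]; first by rewrite mulr0 addr0.
have -> : x + 2 * pi * k.+1%:R = (x + 2 * pi * k%:R) + pi *+ 2.
  by rewrite -[k.+1%:R]natr1 -mulr_natl; ring.
by rewrite sinD2pi.
Qed.

Lemma cosD2pin x (k : nat) : cos (x + 2 * pi * k%:R) = cos x.
Proof.
elim: k => [|k IH]; first by rewrite mulr0 addr0.
have -> : x + 2 * pi * k.+1%:R = (x + 2 * pi * k%:R) + pi *+ 2.
  by rewrite -[k.+1%:R]natr1 -mulr_natl; ring.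
by rewrite cosD2pi.
Qed.

Lemma sin_pi_frac_neq0 (k n : nat) : (0 < k < n)%N -> sin (pi * k%:R / n%:R : R) != 0.
Proof.
move=> /andP[k0 kn]; have n0 : 0 < n%:R :> R by rewrite ltr0n (ltn_trans k0).
rewrite gt_eqF// sin_gt0_pi//; apply/andP; split.
  by rewrite divr_gt0// mulr_gt0// ?pi_gt0 ?ltr0n.
by rewrite ltr_pdivrMr// ltr_pM2l ?pi_gt0// ltr_nat.
Qed.

(** Multiplying by sin(x/2), which is nonzero for 0 < k < n, makes the sum telescope; the two ends
    differ by k full turns. *)
Lemma sum_cos_eq0 (k n : nat) b : (0 < k < n)%N ->
  \sum_(s < n) cos (2 * pi * k%:R / n%:R * s%:R + b) = 0.
Proof.
move=> kn; have s0 := sin_pi_frac_neq0 kn.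
have n0 : n%:R != 0 :> R by rewrite pnatr_eq0; case/andP: kn; case: (n).
set x := 2 * pi * k%:R / n%:R.
have hx : x / 2 = pi * k%:R / n%:R by rewrite /x; field.
apply/eqP; rewrite -(mulrI_eq0 _ (mulfI s0)) -hx.
pose F m : R := sin (x * m%:R + b - x / 2) / 2.
have e (s : nat) : sin (x / 2) * cos (x * s%:R + b) = F s.+1 - F s.
  rewrite /F; have -> : x * s.+1%:R + b - x / 2 = (x * s%:R + b) + x / 2 by rewrite -natr1; field.
  by rewrite sinD sinB; field.
rewrite mulr_sumr (eq_bigr (fun s : 'I_n => F s.+1 - F s)); last by move=> s _; exact: e.
rewrite -(big_mkord xpredT (fun s => F s.+1 - F s)) telescope_sumr// /F.
have -> : x * n%:R + b - x / 2 = (b - x / 2) + 2 * pi * k%:R.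
  by rewrite /x; field.
by rewrite mulr0 add0r sinD2pin subrr.
Qed.

(* For frequencies [al i] whose pairwise differences are less than [n] in
   absolute value, the vectors [exp(2 pi I al_i (s + h) / n)] are orthogonal. *)
Lemma parseval (n h p : nat) (al : 'I_p -> nat) (x : 'I_p -> R) :
  (forall i i', (al i < al i' + n)%N) -> injective al ->
  \sum_(s < n) ((\sum_(i < p) x i * cos (2 * pi * (s + h)%:R / n%:R * (al i)%:R)) ^+ 2 +
                (\sum_(i < p) x i * sin (2 * pi * (s + h)%:R / n%:R * (al i)%:R)) ^+ 2) =
  n%:R * \sum_(i < p) x i ^+ 2.
Proof.
move=> aln inj_al.
have E (s : nat) : (\sum_(i < p) x i * cos (2 * pi * (s + h)%:R / n%:R * (al i)%:R)) ^+ 2 +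
    (\sum_(i < p) x i * sin (2 * pi * (s + h)%:R / n%:R * (al i)%:R)) ^+ 2 =
    \sum_(i < p) \sum_(i' < p) x i * x i' *
      cos (2 * pi * (s + h)%:R / n%:R * (al i)%:R - 2 * pi * (s + h)%:R / n%:R * (al i')%:R).
  rewrite !expr2 !big_distrlr/= -big_split/=; apply: eq_bigr => i _.
  by rewrite -big_split/=; apply: eq_bigr => i' _; rewrite cosB; ring.
under eq_bigr do rewrite E.
rewrite exchange_big mulr_sumr; apply: eq_bigr => i _ /=.
rewrite exchange_big (bigD1 i)//= [X in _ + X]big1 ?addr0.
  under eq_bigr do rewrite subrr cos0 mulr1.
  by rewrite sumr_const card_ord -expr2 mulr_natl.
move=> i' ne; rewrite -mulr_sumr.
have n0 : n%:R != 0 :> R by rewrite pnatr_eq0; have := aln i i; case: (n) => //; rewrite addn0 ltnn.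
wlog le_a : i i' ne / (al i' < al i)%N => [H|].
  have [lt|lt|/inj_al/eqP e] := ltngtP (al i') (al i); first exact: H.
    rewrite mulrC [x i * _]mulrC mulrC; under eq_bigr do rewrite -cosN opprB.
    by apply: H => //; rewrite eq_sym.
  by rewrite e in ne.
apply/eqP; rewrite mulf_eq0; apply/orP; right; apply/eqP.
have kn : (0 < al i - al i' < n)%N.
  by rewrite subn_gt0 le_a/= ltn_subLR ?aln// ltnW.
rewrite -[RHS](@sum_cos_eq0 _ _ (2 * pi * (al i - al i')%:R / n%:R * h%:R) kn).
apply: eq_bigr => s _; by congr cos; rewrite natrB ?(ltnW le_a)// natrD; field.
Qed.

End Trigonometric.

Section Periodogram.
Context {R : realType} {d : measure_display} {T : measurableType d}.
Variables (m : nat) (X : int -> 'I_m -> T -> R).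

(** Positive, negative and out-of-range lags merge into one sum over all pairs (t, t') with t - t' =
    i - n; the condition is written additively to stay within the natural numbers. *)
Lemma gamhatE n j k (i : 'I_(2 * n).+1) w :
  gamhat X n j k (i%:Z - n%:Z) w =
  n%:R^-1 * \sum_(t < n) \sum_(t' < n) (t + n == t' + i)%N%:R *
     ((X (t.+1)%:Z j w - xbar X n j w) * (X (t'.+1)%:Z k w - xbar X n k w)).
Proof.
have [ni|ilt] := leqP n i.
  have -> : i%:Z - n%:Z = (i - n)%N%:Z by rewrite subzn.
  rewrite /gamhat; case: ltnP => hn.
    rewrite /gamhat_nat; congr (_ * _); rewrite exchange_big/=.
    rewrite (big_ord_widen n (fun t => (X (t.+1 + (i - n))%:Z j w - xbar X n j w) * (X t.+1%:Z k w - xbar X n k w)) (leq_subr (i - n) n))/=.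
    rewrite big_mkcond/=; apply: eq_bigr => t' _.
    case: ltnP => ht.
      have hlt : (t' + (i - n) < n)%N by lia.
      rewrite (bigD1 (Ordinal hlt))//= big1 ?addr0.
        by rewrite (_ : (_ == _) = true) ?mul1r ?addSn//; lia.
      move=> t ne; rewrite (_ : (_ == _) = false) ?mul0r//; apply/negP => /eqP e.
      by move/eqP: ne; apply; apply/val_inj => /=; lia.
    rewrite big1// => t _; rewrite (_ : (_ == _) = false) ?mul0r//; have := ltn_ord t; lia.
  rewrite big1 ?mulr0// => t _; rewrite big1// => t' _.
  rewrite (_ : (_ == _) = false) ?mul0r//; have := ltn_ord t; lia.
have -> : i%:Z - n%:Z = Negz (n - i).-1 by rewrite NegzE; lia.
rewrite /gamhat prednK ?subn_gt0//; case: ltnP => hn.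
  rewrite /gamhat_nat; congr (_ * _).
  rewrite (big_ord_widen n (fun t => (X (t.+1 + (n - i))%:Z k w - xbar X n k w) * (X t.+1%:Z j w - xbar X n j w)) (leq_subr (n - i) n))/=.
  rewrite big_mkcond/=; apply: eq_bigr => t _.
  case: ltnP => ht.
    have hlt : (t + (n - i) < n)%N by lia.
    rewrite (bigD1 (Ordinal hlt))//= big1 ?addr0.
      by rewrite (_ : (_ == _) = true) ?mul1r ?addSn 1?mulrC//; lia.
    move=> t' ne; rewrite (_ : (_ == _) = false) ?mul0r//; apply/negP => /eqP e.
    by move/eqP: ne; apply; apply/val_inj => /=; lia.
  rewrite big1// => t' _; rewrite (_ : (_ == _) = false) ?mul0r//; have := ltn_ord t'; lia.
rewrite big1 ?mulr0// => t _; rewrite big1// => t' _.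
rewrite (_ : (_ == _) = false) ?mul0r//; have := ltn_ord t; have := ltn_ord t'; lia.
Qed.

Lemma perio_reE n j k (lam : R) w :
  perio_re X n j k lam w = (2 * pi)^-1 * (n%:R^-1 *
   ((\sum_(t < n) (X (t.+1)%:Z j w - xbar X n j w) * cos (lam * t.+1%:R)) *
    (\sum_(t < n) (X (t.+1)%:Z k w - xbar X n k w) * cos (lam * t.+1%:R)) +
    (\sum_(t < n) (X (t.+1)%:Z j w - xbar X n j w) * sin (lam * t.+1%:R)) *
    (\sum_(t < n) (X (t.+1)%:Z k w - xbar X n k w) * sin (lam * t.+1%:R)))).
Proof.
rewrite /perio_re; congr (_ * _).
under eq_bigr do rewrite gamhatE mulrCA mulr_sumr.
rewrite -mulr_sumr; congr (_ * _).
rewrite !big_distrlr/= -big_split/= exchange_big/=; apply: eq_bigr => t _.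
rewrite -big_split/=; under eq_bigr do rewrite mulr_sumr.
rewrite exchange_big/=; apply: eq_bigr => t' _.
have hi : (t + n - t' < (2 * n).+1)%N by have := ltn_ord t; have := ltn_ord t'; lia.
rewrite (bigD1 (Ordinal hi))//= big1 ?addr0; last first.
  move=> i ne; rewrite (_ : (_ == _) = false) ?mul0r ?mulr0//; apply/negP => /eqP e.
  by move/eqP: ne; apply; apply/val_inj => /=; lia.
rewrite (_ : (_ == _) = true) ?mul1r; last by have := ltn_ord t'; lia.
have -> : (t + n - t')%N%:Z - n%:Z = t.+1%:Z - t'.+1%:Z by have := ltn_ord t'; lia.
by rewrite intrB mulrBr cosB; ring.
Qed.

Lemma perio_re_fourier n j k (s : nat) (mu nu : R) w : (0 < s < n)%N ->
  perio_re X n j k (fourier_freq n s%:Z) w = (2 * pi)^-1 * (n%:R^-1 *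
   ((\sum_(t < n) (X (t.+1)%:Z j w - mu) * cos (fourier_freq n s%:Z * t.+1%:R)) *
    (\sum_(t < n) (X (t.+1)%:Z k w - nu) * cos (fourier_freq n s%:Z * t.+1%:R)) +
    (\sum_(t < n) (X (t.+1)%:Z j w - mu) * sin (fourier_freq n s%:Z * t.+1%:R)) *
    (\sum_(t < n) (X (t.+1)%:Z k w - nu) * sin (fourier_freq n s%:Z * t.+1%:R)))).
Proof.
move=> sn; rewrite perio_reE.
have c0 : \sum_(t < n) cos (fourier_freq n s%:Z * t.+1%:R) = 0 :> R.
  rewrite -[RHS](sum_cos_eq0 (fourier_freq n s%:Z) sn); apply: eq_bigr => t _.
  by rewrite /fourier_freq -[t.+1%:R]natr1 mulrDr mulr1.
have s0 : \sum_(t < n) sin (fourier_freq n s%:Z * t.+1%:R) = 0 :> R.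
  rewrite -[RHS](sum_cos_eq0 (fourier_freq n s%:Z - pi / 2) sn); apply: eq_bigr => t _.
  by rewrite addrA cosBpihalf /fourier_freq -[t.+1%:R]natr1 mulrDr mulr1.
have e a (c : R) (f : R -> R) : \sum_(t < n) f (fourier_freq n s%:Z * t.+1%:R) = 0 ->
   \sum_(t < n) (X (t.+1)%:Z a w - c) * f (fourier_freq n s%:Z * t.+1%:R) =
   \sum_(t < n) X (t.+1)%:Z a w * f (fourier_freq n s%:Z * t.+1%:R).
  move=> f0; under eq_bigr do rewrite mulrBl.
  by rewrite sumrB -mulr_sumr f0 mulr0 subr0.
by rewrite !(e _ _ cos c0) !(e _ _ sin s0).
Qed.

End Periodogram.

(** * Regression weights *)

Section Weights.
Context {R : realType}.

Lemma lagrange_identity M (y : 'I_M -> R) :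
  M%:R * \sum_(i < M) y i ^+ 2 - (\sum_(i < M) y i) ^+ 2 =
  2^-1 * \sum_(i < M) \sum_(i' < M) (y i - y i') ^+ 2.
Proof.
have -> : \sum_(i < M) \sum_(i' < M) (y i - y i') ^+ 2 =
    \sum_(i < M) \sum_(i' < M) (y i ^+ 2 + y i' ^+ 2 - 2 * (y i * y i')).
  by apply: eq_bigr => i _; apply: eq_bigr => i' _; ring.
under [X in _ = 2^-1 * X]eq_bigr do rewrite sumrB big_split/= sumr_const card_ord -mulr_sumr.
rewrite sumrB big_split/= sumr_const card_ord -mulr_sumr expr2 big_distrlr/=.
rewrite sumrMnl.
move: (\sum_(i < M) \sum_(j < M) _) (\sum_(i < M) y i ^+ 2) => A B.
by rewrite -[B *+ M]mulr_natl; field.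
Qed.

Lemma sum_sqr_ord M : \sum_(i < M) i%:R ^+ 2 = M%:R * (M%:R - 1) * (2 * M%:R - 1) / 6 :> R.
Proof.
elim: M => [|M IH]; first by rewrite big_ord0 !mul0r.
by rewrite big_ord_recr/= IH -[M.+1%:R]natr1; field.
Qed.

Lemma sum_expr4_ord M : \sum_(i < M) i%:R ^+ 4 =
  M%:R * (M%:R - 1) * (2 * M%:R - 1) * (3 * M%:R ^+ 2 - 3 * M%:R - 1) / 30 :> R.
Proof.
elim: M => [|M IH]; first by rewrite big_ord0 !mul0r.
by rewrite big_ord_recr/= IH -[M.+1%:R]natr1; field.
Qed.

(** By Lagrange's identity the right side is half a sum of squared differences, and a shift [e] >= 0
    only enlarges the differences of the squares. The worst case [e] = 0 is a polynomial of degree 6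
    in M by the power sums. *)
Lemma sqr_var_lower : exists eta : R, 0 < eta /\ forall M (kap e : R), (2 <= M)%N -> 0 <= e ->
  kap ^+ 2 * M%:R ^+ 6 * eta <=
  M%:R * \sum_(i < M) (kap * (i%:R + e) ^+ 2) ^+ 2 - (\sum_(i < M) kap * (i%:R + e) ^+ 2) ^+ 2.
Proof.
exists 360^-1; split; first by rewrite invr_gt0 ltr0n.
move=> M kap e M2 e0; rewrite lagrange_identity.
have h : kap ^+ 2 * (2^-1 * \sum_(i < M) \sum_(i' < M) (i%:R ^+ 2 - i'%:R ^+ 2) ^+ 2) <=
   2^-1 * \sum_(i < M) \sum_(i' < M) (kap * (i%:R + e) ^+ 2 - kap * (i'%:R + e) ^+ 2) ^+ 2.
  rewrite mulrCA ler_wpM2l// mulr_sumr; apply: ler_sum => i _.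
  rewrite mulr_sumr; apply: ler_sum => i' _.
  rewrite -mulrBr exprMn ler_wpM2l ?sqr_ge0//.
  have -> : (i%:R + e) ^+ 2 - (i'%:R + e) ^+ 2 = (i%:R - i'%:R) * (i%:R + i'%:R + 2 * e) by ring.
  rewrite subr_sqr !exprMn ler_wpM2l ?sqr_ge0// ler_sqr ?nnegrE ?addr_ge0 ?mulr_ge0//.
  by rewrite lerDl mulr_ge0.
apply: le_trans h; rewrite -lagrange_identity -mulrA ler_wpM2l ?sqr_ge0//.
under [X in M%:R * X]eq_bigr do rewrite -exprM.
rewrite sum_sqr_ord sum_expr4_ord.
have : 2 <= M%:R :> R by rewrite ler_nat.
move: (M%:R) => x x2.
have -> : x * (x * (x - 1) * (2 * x - 1) * (3 * x ^+ 2 - 3 * x - 1) / 30) -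
   (x * (x - 1) * (2 * x - 1) / 6) ^+ 2 = x ^+ 2 * ((x - 1) * (2 * x - 1) * ((8 * x - 11) * (x + 1))) / 180 by field.
have -> : x ^+ 6 / 360 = x ^+ 2 * ((x / 2) * x * (x * x)) / 180 by field.
rewrite ler_wpM2r// ler_wpM2l ?sqr_ge0//.
(* For x >= 2 the factors compare one by one: x - 1 >= x/2, 2x - 1 >= x, 8x - 11 >= x and x + 1 >=
   x. This is where 1/360 comes from. *)
by apply: ler_pM; [nra|nra|apply: ler_pM; lra|apply: ler_pM; lra].
Qed.

Lemma det_mx2E (A : 'M[R]_2) : let i1 := lift ord0 ord0 in
  \det A = A ord0 ord0 * A i1 i1 - A ord0 i1 * A i1 ord0.
Proof.
move=> i1; rewrite (expand_det_row _ ord0) !big_ord_recl big_ord0 /cofactor !det_mx11 !mxE/=.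
rewrite -/i1 addr0 /bump/= expr0 expr1 mul1r mulN1r mulrN.
by congr (_ * A _ _ - _ * A _ _); apply/val_inj.
Qed.

Lemma intercept_weights M (x y : 'I_M -> R) :
  let T1 := \sum_(i < M) x i in let T2 := \sum_(i < M) x i ^+ 2 in
  let D := M%:R * T2 - T1 ^+ 2 in
  let Xd := \matrix_(i < M, c < 2) if c == ord0 then 1 else x i in
  D != 0 ->
  (invmx (Xd^T *m Xd) *m (Xd^T *m (\col_(i < M) y i))) ord0 ord0 =
  \sum_(i < M) (T2 - T1 * x i) / D * y i.
Proof.
move=> T1 T2 D Xd D0.
set G := Xd^T *m Xd; set V := Xd^T *m _.
pose i1 : 'I_2 := lift ord0 ord0.
have G00 : G ord0 ord0 = M%:R.
  rewrite mxE (eq_bigr (fun=> 1)) ?sumr_const ?card_ord// => i _.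
  by rewrite !mxE eqxx mulr1.
have G01 : G ord0 i1 = T1 by rewrite mxE; apply: eq_bigr => i _; rewrite !mxE eqxx mul1r.
have G10 : G i1 ord0 = T1 by rewrite mxE; apply: eq_bigr => i _; rewrite !mxE eqxx mulr1.
have G11 : G i1 i1 = T2 by rewrite mxE; apply: eq_bigr => i _; rewrite !mxE /= expr2.
have V0 : V ord0 ord0 = \sum_(i < M) y i.
  by rewrite mxE; apply: eq_bigr => i _; rewrite !mxE eqxx mul1r.
have V1 : V i1 ord0 = \sum_(i < M) x i * y i.
  by rewrite mxE; apply: eq_bigr => i _; rewrite !mxE.
have Gu : G \in unitmx.
  rewrite unitmxE unitfE det_mx2E -/i1 G00 G01 G10 G11 -expr2.
  by [].
have eD : D = M%:R * T2 - T1 ^+ 2 by [].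
clearbody G V D T1 T2.
(* By Cramer's rule, the first row of the inverse of the normal matrix. *)
pose g : 'rV[R]_2 := \row_c if c == ord0 then T2 / D else - T1 / D.
have gG : g *m G = delta_mx ord0 ord0.
  apply/rowP => c; rewrite !mxE !big_ord_recl big_ord0 !mxE/= addr0 -/i1.
  have [->|->] : c = ord0 \/ c = i1.
    by case: c => -[|[|//]] hc; [left|right]; apply/val_inj.
  - rewrite G00 G10 eqxx; transitivity (D / D); last by rewrite divff.
    by rewrite {3}eD; field.
  - by rewrite G01 G11 /=; field.
have -> : (invmx G *m V) ord0 ord0 = (g *m V) ord0 ord0.
  have -> : g = delta_mx ord0 ord0 *m invmx G by rewrite -gG mulmxK.
  by rewrite -mulmxA -rowE [RHS]mxE.
rewrite mxE !big_ord_recl big_ord0 !mxE/= -/i1 V0 V1 addr0 !mulr_sumr -big_split/=.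
by apply: eq_bigr => i _; field.
Qed.

(** Each regressor is at most kap M^2, so the numerator is at most 2 kap^2 M^5, against D >= eta
    kap^2 M^6: the frequency scale [kap] cancels and O(1/M) remains. The permutation [rho] covers
    both an index moving away from the target frequency and one moving towards it. *)
Lemma intercept_weights_bound (eta : R) M (x : 'I_M -> R) (kap e : R) (rho : 'I_M -> 'I_M) :
  0 < eta ->
  kap ^+ 2 * M%:R ^+ 6 * eta <=
    M%:R * \sum_(i < M) (kap * (i%:R + e) ^+ 2) ^+ 2 - (\sum_(i < M) kap * (i%:R + e) ^+ 2) ^+ 2 ->
  (2 <= M)%N -> 0 < kap -> 0 <= e <= 1 -> injective rho ->
  (forall i, x i = kap * ((rho i)%:R + e) ^+ 2) ->
  let T1 := \sum_(i < M) x i in let T2 := \sum_(i < M) x i ^+ 2 in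
  let D := M%:R * T2 - T1 ^+ 2 in
  [/\ 0 < D, \sum_(i < M) (T2 - T1 * x i) / D = 1 &
    forall i, `|(T2 - T1 * x i) / D| <= 2 / eta / M%:R].
Proof.
move=> eta0 Dlow M2 kap0 /andP[e0 e1] inj_rho xE T1 T2 D.
have M0 : 0 < M%:R :> R by rewrite ltr0n (leq_trans _ M2).
have T1E : T1 = \sum_(i < M) kap * (i%:R + e) ^+ 2.
  by rewrite [RHS](reindex_inj inj_rho)/=; apply: eq_bigr => i _; rewrite xE.
have T2E : T2 = \sum_(i < M) (kap * (i%:R + e) ^+ 2) ^+ 2.
  by rewrite [RHS](reindex_inj inj_rho)/=; apply: eq_bigr => i _; rewrite xE.
move: Dlow; rewrite -T1E -T2E -/D => Dlow.
have D0 : 0 < D.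
  by apply: lt_le_trans Dlow; rewrite mulr_gt0// mulr_gt0// exprn_gt0.
have x0 i : 0 <= x i by rewrite xE mulr_ge0 ?sqr_ge0// (ltW kap0).
have xM i : x i <= kap * M%:R ^+ 2.
  rewrite xE ler_wpM2l ?(ltW kap0)// ler_sqr ?nnegrE ?addr_ge0// ?(ltW M0)//.
  apply: (@le_trans _ _ ((rho i)%:R + 1)); first by rewrite lerD2l.
  by rewrite natr1 ler_nat ltn_ord.
split=> //.
  rewrite -mulr_suml sumrB sumr_const card_ord -mulr_sumr -/T1 -mulr_natl -expr2.
  by rewrite divff// gt_eqF.
move=> i; rewrite normrM normfV (gtr0_norm D0) ler_pdivrMr//.
have T10 : 0 <= T1 by apply: sumr_ge0.
have T20 : 0 <= T2 by apply: sumr_ge0 => ? _; exact: sqr_ge0.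
have T1b : T1 <= M%:R * (kap * M%:R ^+ 2).
  apply: (le_trans (ler_sum _ (fun i _ => xM i))).
  by rewrite sumr_const card_ord mulr_natl.
have T2b : T2 <= M%:R * (kap * M%:R ^+ 2) ^+ 2.
  apply: (@le_trans _ _ (\sum_(i < M) (kap * M%:R ^+ 2) ^+ 2)).
    by apply: ler_sum => i' _; rewrite ler_sqr ?nnegrE// mulr_ge0// ?sqr_ge0// (ltW kap0).
  by rewrite sumr_const card_ord mulr_natl.
apply: (@le_trans _ _ (T2 + T1 * x i)).
  by apply: (le_trans (ler_normB _ _)); rewrite !ger0_norm// mulr_ge0.
apply: (@le_trans _ _ (M%:R * (kap * M%:R ^+ 2) ^+ 2 + (M%:R * (kap * M%:R ^+ 2)) * (kap * M%:R ^+ 2))).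
  by apply: lerD => //; apply: ler_pM.
apply: (@le_trans _ _ (2 / eta / M%:R * (kap ^+ 2 * M%:R ^+ 6 * eta))); last first.
  by rewrite ler_wpM2l// !divr_ge0// ltW.
rewrite le_eqVlt; apply/orP; left; apply/eqP; field.
by rewrite !gt_eqF.
Qed.

(** The condition 2 M <= n keeps the block a, ..., a + M - 1 strictly between 0 and n for both
    targets, so that the sample mean cancels at each of its frequencies. *)
Lemma ols_weights : exists C : R, 0 < C /\ forall (n M : nat) (theta : R),
  (2 <= M)%N -> (2 * M <= n)%N -> theta = 0 \/ theta = pi ->
  exists (a : nat) (c : 'I_M -> R),
    [/\ (0 < a)%N, (a + M <= n)%N, \sum_(i < M) c i = 1,
      (forall i, `|c i| <= C / M%:R) &
      (forall i : 'I_M, `|fourier_freq n (a + i)%N%:Z - theta| <= 2 * pi * M%:R / n%:R) /\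
      forall d (T : measurableType d) m (X : int -> 'I_m -> T -> R) j k w,
        ftilde X n M theta j k w =
        \sum_(i < M) c i * perio_re X n j k (fourier_freq n (a + i)%N%:Z) w].
Proof.
have [eta [eta0 etaP]] := sqr_var_lower.
exists (2 / eta); split; first by rewrite divr_gt0.
move=> n M theta M2 Mn theta0pi.
have n0 : 0 < n%:R :> R by rewrite ltr0n; lia.
have npi : n%:R != 0 :> R by rewrite gt_eqF.
have pi0 := pi_gt0 R.
(* Both targets have this shape: the distance to theta is (2 pi / n) (rho i + e), with e = 1 at
   0. *)
suff [a [e [rho [a0 aM e01 inj_rho [rE xE]]]]] : exists (a : nat) (e : R) (rho : 'I_M -> 'I_M),
    [/\ (0 < a)%N, (a + M <= n)%N, 0 <= e <= 1, injective rho &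
     (forall i : 'I_M, reg_start n M theta + i%:Z = (a + i)%N%:Z) /\
     forall i : 'I_M, (theta - fourier_freq n (a + i)%N%:Z) ^+ 2 =
       (2 * pi / n%:R) ^+ 2 * ((rho i)%:R + e) ^+ 2].
  pose x i := (theta - fourier_freq n (a + i)%N%:Z) ^+ 2 : R.
  have kap0 : 0 < (2 * pi / n%:R) ^+ 2 :> R by rewrite exprn_gt0// divr_gt0// mulr_gt0.
  have [D0 c1 cb] := @intercept_weights_bound eta M x _ e rho eta0 (etaP _ _ _ M2 (proj1 (andP e01))) M2 kap0 e01 inj_rho xE.
  exists a, (fun i => (\sum_(i < M) x i ^+ 2 - (\sum_(i < M) x i) * x i) /
     (M%:R * (\sum_(i < M) x i ^+ 2) - (\sum_(i < M) x i) ^+ 2)); split => //; split.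
    move=> i.
    have h0 : 0 <= 2 * pi * M%:R / n%:R :> R.
      by rewrite divr_ge0 ?mulr_ge0// ?(ltW pi0).
    rewrite -ler_sqr ?nnegrE//.
    rewrite real_normK ?num_real// -sqrrN opprB xE.
    have -> : (2 * pi * M%:R / n%:R) ^+ 2 = (2 * pi / n%:R) ^+ 2 * M%:R ^+ 2 :> R by field.
    have /andP[e0 e1] := e01.
    rewrite ler_wpM2l ?sqr_ge0// ler_sqr ?nnegrE ?addr_ge0//.
    apply: (@le_trans _ _ ((rho i)%:R + 1)); first by rewrite lerD2l.
    by rewrite natr1 ler_nat ltn_ord.
  move=> d T m X j k w.
  rewrite /ftilde/= -(@intercept_weights M x (fun i => perio_re X n j k (fourier_freq n (a + i)%N%:Z) w)) ?gt_eqF//.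
  have -> : design n M theta = \matrix_(i < M, c < 2) (if c == ord0 then 1 else x i).
    by apply/matrixP => i c; rewrite !mxE /reg_index rE.
  have -> // : response X n M theta j k w = \col_(i < M) perio_re X n j k (fourier_freq n (a + i)%N%:Z) w.
  by apply/colP => i; rewrite !mxE /reg_index rE.
case: theta0pi => ->.
  exists 1%N, 1, id; split => //; first by lia.
    by rewrite ler01 lexx.
  split; first by move=> i; rewrite /reg_start eqxx; lia.
  move=> i; rewrite sub0r sqrrN /fourier_freq -exprMn; congr (_ ^+ 2).
  by rewrite -pmulrn natrD; field.
have pin0 : (pi == 0 :> R) = false by apply/negbTE; rewrite gt_eqF.
(* The indices now approach pi, hence the reversal. For odd n the frequency pi lies half a step
   beyond the last index, whence the offset 1/2. *)
exists (n./2 - M + 1)%N, ((odd n)%:R / 2), (@rev_ord M); split.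
- by rewrite addn1.
- have := odd_double_half n; lia.
- by case: (odd n) => /=; apply/andP; split; lra.
- exact: rev_ord_inj.
split.
  move=> i; rewrite /reg_start pin0; have := odd_double_half n; lia.
move=> i; rewrite -exprMn; congr (_ ^+ 2).
rewrite /fourier_freq -pmulrn/=.
have hM : (M <= n./2)%N by have := odd_double_half n; lia.
have -> : (n./2 - M + 1 + i)%N%:R = (n./2)%:R - (M - i.+1)%N%:R :> R.
  by rewrite -natrB; [congr (_%:R); have := ltn_ord i; lia|lia].
have -> : n%:R = (odd n)%:R + 2 * (n./2)%:R :> R.
  by rewrite -{1}(odd_double_half n) natrD -mul2n natrM.
field.
by move: npi; rewrite -{1}(odd_double_half n) natrD -mul2n natrM.
Qed.

End Weights.

(** * Coefficients of cosine series *)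

Section SecondDifference.
Context {R : realType}.
Implicit Types (f g H F : R -> R) (w x t del : R).

Definition D2 t f x : R := f (x + t) + f (x - t) - 2 * f x.

(* Schwarz: a continuous function whose second symmetric derivative is at most
   [c] everywhere differs from [c x^2 / 2] by a concave function. If the
   conclusion failed, then [H] minus a suitable quadratic would have an
   interior minimum, where the second symmetric derivative exceeds [c]. *)
Lemma schwarz_second_difference H (c : R) : continuous H ->
  (forall x (e : R), 0 < e -> exists2 del, 0 < del &
     forall t, 0 < t -> t < del -> D2 t H x <= (c + e) * t ^+ 2) ->
  forall w t, 0 < t -> D2 t H w <= c * t ^+ 2.
Proof.
move=> cH HD w t t0; rewrite leNgt; apply/negP => lt.
(* Half of the excess over [c], so that (c + e) t^2 lies midway between c t^2 and the second
   difference. *)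
pose e := (D2 t H w - c * t ^+ 2) / (2 * t ^+ 2).
have t20 : 0 < t ^+ 2 by rewrite exprn_gt0.
have e0 : 0 < e by rewrite divr_gt0 ?subr_gt0// mulr_gt0.
have eE : (c + e) * t ^+ 2 < D2 t H w.
  have -> : (c + e) * t ^+ 2 = (c * t ^+ 2 + D2 t H w) / 2.
    by rewrite /e; field; rewrite gt_eqF.
  by move: lt; lra.
(* The slope of the chord: with it [u] takes equal values at the two ends, both above [u w], and its
   minimum is interior. *)
pose sl := (H (w + t) - H (w - t)) / (2 * t).
pose q x := (c + e) * (x - w) ^+ 2 / 2 + sl * (x - w).
pose u x := H x - q x.
have cu : continuous u.
  move=> x; apply: cvgB; first exact: cH.
  apply: cvgD.
    apply: cvgMr_tmp; apply: cvgMl_tmp.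
    by apply: (@cvgM _ _ _ _ (fun x => x - w) (fun x => x - w)); apply: cvgB => //; apply: cvg_cst.
  by apply: cvgMl_tmp; apply: cvgB => //; apply: cvg_cst.
have ut : u (w + t) = (H (w + t) + H (w - t)) / 2 - (c + e) * t ^+ 2 / 2.
  by rewrite /u /q /sl; field; rewrite gt_eqF.
have umt : u (w - t) = (H (w + t) + H (w - t)) / 2 - (c + e) * t ^+ 2 / 2.
  by rewrite /u /q /sl; field; rewrite gt_eqF.
have u0 : u w = H w by rewrite /u /q subrr; ring.
have ult : u w < u (w + t) by rewrite ut u0; move: eE; rewrite /D2; lra.
have [|x xin xmin] := @EVT_min R u (w - t) (w + t) _ (continuous_subspaceT cu).
  lra.
have xw : u x <= u w by apply: xmin; rewrite in_itv/=; apply/andP; split; lra.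
move: xin; rewrite in_itv/= => /andP[x1 x2].
have x1' : w - t < x.
  rewrite lt_neqAle x1 andbT; apply/eqP => E; move: xw ult.
  by rewrite -E umt -ut => h1 h2; move: (le_lt_trans h1 h2); rewrite ltxx.
have x2' : x < w + t.
  rewrite lt_neqAle x2 andbT; apply/eqP => E; move: xw ult.
  by rewrite E => h1 h2; move: (le_lt_trans h1 h2); rewrite ltxx.
(* At the minimum the second difference of [u] is nonnegative, so that of [H] is at least (c + e)
   s^2, which contradicts the bound with e/2. *)
have [del del0 hdel] := HD x (e / 2) (divr_gt0 e0 (ltr0Sn _ 1)).
pose s := Num.min (del / 2) (Num.min (x - (w - t)) (w + t - x)).
have s0 : 0 < s by rewrite !lt_min divr_gt0//= !subr_gt0 x1' x2'.
have sd : s < del.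
  by apply: (@le_lt_trans _ _ (del / 2)); [rewrite ge_min lexx|lra].
have s1 : s <= x - (w - t) by rewrite !ge_min lexx orbT.
have s2 : s <= w + t - x by rewrite !ge_min lexx !orbT.
have a1 : u x <= u (x + s) by apply: xmin; rewrite in_itv/=; apply/andP; split; lra.
have a2 : u x <= u (x - s) by apply: xmin; rewrite in_itv/=; apply/andP; split; lra.
have := hdel s s0 sd.
have -> : D2 s H x = u (x + s) + u (x - s) - 2 * u x + (c + e) * s ^+ 2.
  by rewrite /D2 /u /q; field.
have : 0 < e * s ^+ 2 by rewrite mulr_gt0 ?exprn_gt0.
move: (u (x + s)) (u (x - s)) (u x) a1 a2 => A1 A2 A0 a1 a2 h1 h2.
have : (c + e / 2) * s ^+ 2 = c * s ^+ 2 + e * s ^+ 2 / 2 by field.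
have : (c + e) * s ^+ 2 = c * s ^+ 2 + e * s ^+ 2 by ring.
move: (c * s ^+ 2) (e * s ^+ 2) h1 h2 => C E h1 h2 e1 e2; lra.
Qed.

End SecondDifference.

(** * Riemann's summation factors (sin x / x)^2 *)

Section Sinc.
Context {R : realType}.
Implicit Types x y : R.

Definition sinc2 x : R := if x == 0 then 1 else (sin x / x) ^+ 2.

Lemma sin_mvt x y : x < y -> exists2 z, x < z < y & sin y - sin x = cos z * (y - x).
Proof.
move=> xy; have [|z zin e] := @MVT R sin cos x y xy (fun z _ => is_derive_sin z).
  by apply: continuous_subspaceT => z; exact: continuous_sin.
by exists z => //; move: zin; rewrite in_itv.
Qed.

Lemma cos_ge (x y : R) : 0 <= x -> x <= y -> y <= pi -> cos y <= cos x.
Proof.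
move=> x0; rewrite le_eqVlt => /predU1P[-> //|xy ypi].
apply: ltW; rewrite ltr_cos// in_itv/=; apply/andP; split => //.
- by rewrite (le_trans _ ypi)// ltW.
- by rewrite (le_trans x0)// ltW.
Qed.

(** The sine is concave on [0, pi], so its chord slope from the origin decreases; the two mean value
    points compare the slopes on [0, x] and [x, y]. *)
Lemma sinc_decr x y : 0 < x -> x <= y -> y <= pi -> 0 <= sin y / y <= sin x / x.
Proof.
move=> x0; rewrite le_eqVlt => /predU1P[<- xpi|xy ypi].
  by rewrite lexx andbT divr_ge0 ?(ltW x0)// sin_ge0_pi// (ltW x0).
have y0 : 0 < y by exact: lt_trans xy.
apply/andP; split; first by rewrite divr_ge0 ?(ltW y0)// sin_ge0_pi// (ltW y0).
have [z1 /andP[a1 a2]] := sin_mvt x0; rewrite sin0 !subr0 => e1.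
have [z2 /andP[b1 b2] e2] := sin_mvt xy.
have cz : cos z2 <= cos z1 by apply: cos_ge; lra.
have -> : sin x / x = cos z1 by rewrite e1 mulfK// gt_eqF.
rewrite ler_pdivrMr//; have -> : sin y = sin x + cos z2 * (y - x) by rewrite -e2; ring.
rewrite e1; nra.
Qed.

Lemma sinc_ge_cos x : 0 < x -> x <= pi -> cos x <= sin x / x <= 1.
Proof.
move=> x0 xpi; have [z1 /andP[a1 a2]] := sin_mvt x0; rewrite sin0 !subr0 => e1.
have -> : sin x / x = cos z1 by rewrite e1 mulfK// gt_eqF.
by rewrite cos_le1 andbT; apply: cos_ge; lra.
Qed.

Lemma sin_sqr_le x : sin x ^+ 2 <= x ^+ 2.
Proof.
wlog x0 : x / 0 < x.
  move=> h; have [x0|x0|->] := ltgtP x 0; [|exact: h|by rewrite sin0].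
  by have := h (- x); rewrite oppr_gt0 => /(_ x0); rewrite sinN !sqrrN.
have [z1 _] := sin_mvt x0; rewrite sin0 !subr0 => ->.
by rewrite exprMn ler_piMl ?sqr_ge0// -(cos2Dsin2 z1) lerDl sqr_ge0.
Qed.

Lemma sinc2_ge0 x : 0 <= sinc2 x.
Proof. by rewrite /sinc2; case: eqP => // _; exact: sqr_ge0. Qed.

Lemma sinc2_le1 x : sinc2 x <= 1.
Proof.
rewrite /sinc2; case: eqVneq => // x0.
by rewrite exprMn exprVn ler_pdivrMr ?mul1r ?sin_sqr_le// lt_def sqr_ge0 andbT expf_neq0.
Qed.

Lemma sinc2_decr x y : 0 <= x -> x <= y -> y <= pi -> sinc2 y <= sinc2 x.
Proof.
rewrite le_eqVlt => /predU1P[<- _ _|x0 xy ypi]; first by rewrite {2}/sinc2 eqxx sinc2_le1.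
have /andP[h1 h2] := sinc_decr x0 xy ypi.
have y0 := lt_le_trans x0 xy.
rewrite /sinc2 !gt_eqF// ler_sqr ?nnegrE//.
exact: le_trans h2.
Qed.

Lemma sinc2_ge x : 0 <= x -> x <= 1 -> 1 - x ^+ 2 <= sinc2 x.
Proof.
rewrite le_eqVlt => /predU1P[<- _|x0 x1]; first by rewrite /sinc2 eqxx; lra.
rewrite /sinc2 gt_eqF//.
have pi2 := @pihalf_ge1 R.
have /andP[h1 _] : cos x <= sin x / x <= 1 by apply: sinc_ge_cos => //; lra.
have c0 : 0 <= cos x by apply: cos_ge0_pihalf; apply/andP; split; lra.
have : cos x ^+ 2 <= (sin x / x) ^+ 2 by rewrite ler_sqr ?nnegrE// (le_trans c0).
have := cos2Dsin2 x; have := sin_sqr_le x; lra.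
Qed.

(** From sin^2 x - sin^2 y = sin(x - y) sin(x + y), the squared sine changes by at most eta; the
    remaining term is the decrease of 1/x^2. *)
Lemma sinc2_dist x eta : 1 <= x -> 0 < eta ->
  `|sinc2 x - sinc2 (x + eta)| <= eta / x ^+ 2 + (x ^- 2 - (x + eta) ^- 2).
Proof.
move=> x1 e0; have x0 : 0 < x by lra.
have y0 : 0 < x + eta by lra.
rewrite /sinc2 !gt_eqF// !exprMn !exprVn.
have sx : sin x ^+ 2 <= 1 by rewrite -(cos2Dsin2 x) lerDr sqr_ge0.
have d : `|sin x ^+ 2 - sin (x + eta) ^+ 2| <= eta.
  have -> : sin x ^+ 2 - sin (x + eta) ^+ 2 = sin (x - (x + eta)) * sin (x + (x + eta)).
    rewrite sinB (sinD x (x + eta)).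
    have := cos2Dsin2 x; have := cos2Dsin2 (x + eta).
    move: (sin x) (cos x) (sin (x + eta)) (cos (x + eta)) => a b c f h1 h2.
    have -> : (a * f - b * c) * (a * f + b * c) = a ^+ 2 * f ^+ 2 - b ^+ 2 * c ^+ 2 by ring.
    have -> : f ^+ 2 = 1 - c ^+ 2 by lra.
    have -> : b ^+ 2 = 1 - a ^+ 2 by lra.
    by ring.
  rewrite normrM -[leRHS]mulr1; apply: ler_pM => //.
    rewrite -ler_sqr ?nnegrE ?(ltW e0)// real_normK ?num_real//.
    apply: le_trans (sin_sqr_le _) _; rewrite opprD addrA subrr add0r sqrrN//.
  by rewrite ler_norml sin_geN1 sin_le1.
have p1 : 0 < x ^- 2 by rewrite invr_gt0 exprn_gt0.
have p2 : 0 < (x + eta) ^- 2 by rewrite invr_gt0 exprn_gt0.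
have p12 : (x + eta) ^- 2 <= x ^- 2.
  by rewrite lef_pV2 ?posrE ?exprn_gt0// ler_sqr ?nnegrE ?(ltW x0) ?(ltW y0)//; lra.
have -> : sin x ^+ 2 * x ^- 2 - sin (x + eta) ^+ 2 * (x + eta) ^- 2 =
  sin x ^+ 2 * (x ^- 2 - (x + eta) ^- 2) + (sin x ^+ 2 - sin (x + eta) ^+ 2) * (x + eta) ^- 2 by ring.
apply: (le_trans (ler_normD _ _)); rewrite addrC; apply: lerD.
  by rewrite normrM (gtr0_norm p2); apply: ler_pM => //; rewrite ltW.
by rewrite normrM (ger0_norm (sqr_ge0 _)) ger0_norm ?subr_ge0// ler_piMl// subr_ge0.
Qed.

(* The sequence [sinc2 (h * eta)] has total variation at most 4, uniformly in
   [eta]: it decreases until [h * eta] reaches 1 and its increments are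
   dominated by those of [2 / (eta h) + 1 / (eta h)^2] afterwards. *)
Lemma sinc2_variation (eta : R) (N L : nat) : 0 < eta -> eta <= 1 ->
  \sum_(N <= h < L) `|sinc2 (h%:R * eta) - sinc2 (h.+1%:R * eta)| <= 4.
Proof.
move=> e0 e1.
have [LN|NL] := leqP L N; first by rewrite big_geq.
pose v h := `|sinc2 (h%:R * eta) - sinc2 (h.+1%:R * eta)|.
have v0 h : 0 <= v h by exact: normr_ge0.
apply: (@le_trans _ _ (\sum_(0 <= h < L) v h)).
  by rewrite (@big_cat_nat _ _ _ N 0 L)//= ?(ltnW NL)// lerDr sumr_ge0.
(* The split index satisfies 1 <= H0 eta <= 2. The lower bound makes the tail estimate applicable;
   the upper one, with 2 <= pi, keeps the head where [sinc2] decreases. *)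
pose H0 := (Num.truncn (eta^-1)).+1.
have i0 : 0 <= eta^-1 by rewrite invr_ge0 ltW.
have /andP[h1 h2] := truncn_itv i0.
have H0e : 1 <= H0%:R * eta.
  by rewrite -[leLHS](@mulVf _ eta) ?gt_eqF// ler_pM2r//; exact: ltW h2.
have H0e2 : H0%:R * eta <= 2.
  rewrite /H0 -natr1 mulrDl mul1r.
  have : (Num.truncn eta^-1)%:R * eta <= 1.
    by rewrite -[leRHS](@mulVf _ eta) ?gt_eqF// ler_pM2r.
  by move: e1; lra.
have H0p : 0 < H0%:R :> R by rewrite ltr0n.
(* Its decrements dominate those of [sinc2] because 1/h^2 <= 2/h - 2/(h+1). The head contributes at
   most 1 and the tail at most [phi H0] <= 3. *)
pose phi h := 2 / (eta * h%:R) + (h%:R * eta) ^- 2 : R.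
have tail : \sum_(H0 <= h < maxn H0 L) v h <= 3.
  apply: (@le_trans _ _ (\sum_(H0 <= h < maxn H0 L) (- phi h.+1 - - phi h))).
    rewrite big_nat [leRHS]big_nat; apply: ler_sum => h /andP[Hh _].
    have hp : 0 < h%:R :> R by rewrite (lt_le_trans H0p)// ler_nat.
    have he : 1 <= h%:R * eta by apply: le_trans H0e _; rewrite ler_pM2r// ler_nat.
    have ev : v h <= eta / (h%:R * eta) ^+ 2 + ((h%:R * eta) ^- 2 - (h.+1%:R * eta) ^- 2).
      rewrite /v; have -> : h.+1%:R * eta = h%:R * eta + eta by rewrite -[h.+1%:R]natr1 mulrDl mul1r.
      exact: sinc2_dist.
    apply: (le_trans ev).
    have -> : - phi h.+1 - - phi h = (- (2 / (eta * h.+1%:R)) + 2 / (eta * h%:R)) +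
        ((h%:R * eta) ^- 2 - (h.+1%:R * eta) ^- 2).
      by rewrite /phi opprK opprD addrACA [- _ ^- 2 + _]addrC.
    rewrite lerD2r.
    (* 1/h^2 <= 2/h - 2/(h+1) *)
    have hp1 : 0 < h.+1%:R :> R by rewrite ltr0n.
    have -> : - (2 / (eta * h.+1%:R)) + 2 / (eta * h%:R) = 2 / (eta * (h%:R * h.+1%:R)).
      by rewrite -[h.+1%:R]natr1; field; rewrite !gt_eqF// natr1.
    have -> : eta / (h%:R * eta) ^+ 2 = 2 / (eta * (h%:R * (2 * h%:R))).
      by field; rewrite !gt_eqF.
    rewrite ler_wpM2l// lef_pV2 ?posrE ?mulr_gt0// !ler_pM2l// -natr1.
    have : 1 <= h%:R :> R by rewrite (le_trans _ (_ : H0%:R <= _))// ?ler_nat// ler1n.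
    lra.
  rewrite telescope_sumr ?leq_maxl// opprK.
  have : phi H0 <= 3.
    rewrite /phi (_ : 3 = 2 + 1); last by lra.
    apply: lerD.
      by rewrite ler_pdivrMr ?mulr_gt0// mulrC; move: H0e; lra.
    rewrite invf_le1 ?exprn_gt0 ?mulr_gt0//.
    by move: H0e; move: (H0%:R * eta) => y hy; nra.
  have : 0 <= phi (maxn H0 L).
    by rewrite /phi addr_ge0// ?invr_ge0 ?sqr_ge0// divr_ge0// mulr_ge0// ltW.
  lra.
have pi3 := @pi_ge2 R.
have head : \sum_(0 <= h < H0) v h <= 1.
  apply: (@le_trans _ _ (\sum_(0 <= h < H0) (- sinc2 (h.+1%:R * eta) - - sinc2 (h%:R * eta)))).
    rewrite big_nat [leRHS]big_nat; apply: ler_sum => h /andP[_ Hh].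
    have dec : sinc2 (h.+1%:R * eta) <= sinc2 (h%:R * eta).
      apply: sinc2_decr.
      - by rewrite mulr_ge0// ltW.
      - by rewrite ler_pM2r// ler_nat.
      - by apply: le_trans pi3; apply: le_trans H0e2; rewrite ler_pM2r// ler_nat.
    by rewrite /v ger0_norm ?subr_ge0// opprK addrC.
  rewrite telescope_sumr// opprK mul0r {2}/sinc2 eqxx.
  by have := sinc2_ge0 (H0%:R * eta); lra.
apply: (@le_trans _ _ (\sum_(0 <= h < maxn H0 L) v h)).
  rewrite (@big_cat_nat _ _ _ L 0 (maxn H0 L))//= ?leq_maxr// lerDl sumr_ge0//.
rewrite (@big_cat_nat _ _ _ H0 0 (maxn H0 L))//= ?leq_maxl//.
lra.
Qed.

End Sinc.

(** * Decay of the coefficients of an everywhere convergent cosine series *)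

Section CosineSeries.
Context {R : realType}.
Implicit Types (w t del : R).

Lemma cvg_le_bound (u : nat -> R) (l c : R) :
  u @ \oo --> l -> (\forall n \near \oo, u n <= c) -> l <= c.
Proof.
move=> ul h; rewrite -(cvg_lim (@Rhausdorff R) ul); apply: limr_le => //.
by apply/cvg_ex; exists l.
Qed.

Lemma abs_bounded_is_cvg (u : nat -> R) (C : R) :
  (forall N, \sum_(h < N) `|u h| <= C) -> cvgn (fun N => \sum_(h < N) u h).
Proof.
move=> uC.
have -> : (fun N => \sum_(h < N) u h) = series u.
  by apply/funext => N; rewrite /series/= big_mkord.
apply: normed_cvg.
have -> : [normed series u] = (fun N => \sum_(h < N) `|u h|).
  by apply/funext => N; exact: (big_mkord xpredT).
apply: nondecreasing_is_cvgn.
  by apply/nondecreasing_seqP => n; rewrite big_ord_recr/= lerDl.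
by exists C => _ [N _ <-]; exact: uC.
Qed.

Lemma abel_summation (u lam : nat -> R) (G : R) L : lam 0%N = 1 ->
  \sum_(h < L.+1) u h * lam h - G = (\sum_(h < L.+1) u h - G) * lam L +
    \sum_(h < L) (\sum_(i < h.+1) u i - G) * (lam h - lam h.+1).
Proof.
move=> l0; elim: L => [|L IH].
  by rewrite !big_ord_recr !big_ord0/= l0; ring.
rewrite big_ord_recr/= addrAC IH [\sum_(h < L.+2) u h]big_ord_recr/= [X in _ = _ + X]big_ord_recr/=.
ring.
Qed.

(** Each cos(h w) is an eigenfunction of the second difference, with eigenvalue 2 cos(h t) - 2. *)
Lemma D2_cos_sum (e : nat -> R) L t w :
  D2 t (fun w => \sum_(h < L) e h * cos (h%:R * w)) w =
  \sum_(h < L) (e h * (2 * cos (h%:R * t) - 2)) * cos (h%:R * w).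
Proof.
rewrite /D2 -big_split/= mulr_sumr -sumrB; apply: eq_bigr => h _.
by rewrite mulrDr mulrBr cosD cosB; ring.
Qed.

Lemma two_cos_sub2 (x : R) : 2 * cos x - 2 = - (4 * sin (x / 2) ^+ 2).
Proof.
have -> : cos x = cos (x / 2 + x / 2) by congr cos; field.
by rewrite cosD; have := cos2Dsin2 (x / 2); nra.
Qed.

(** The cosines of order below L are orthogonal on a grid of 2 L points, where sampling takes the
    place of integration. The squared norm of a cosine of positive order is half the number of
    points, whence the factor 2. *)
Lemma cos_coef_bound (e : nat -> R) (L k : nat) (kap : R) : (0 < k < L)%N ->
  (forall w, `|\sum_(h < L) e h * cos (h%:R * w)| <= kap) -> `|e k| <= 2 * kap.
Proof.
move=> /andP[k0 kL] H.
pose N := (2 * L)%N.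
have N0 : 0 < N%:R :> R by rewrite ltr0n /N; lia.
have N0' : N%:R != 0 :> R by rewrite gt_eqF.
pose W (s : nat) : R := 2 * pi * s%:R / N%:R.
have z (q : nat) : (0 < q < N)%N -> \sum_(s < N) cos (q%:R * W s) = 0.
  move=> qN; rewrite -[RHS](sum_cos_eq0 0 qN); apply: eq_bigr => s _.
  by rewrite addr0 /W; congr cos; field.
have ort (h : nat) : (h < L)%N ->
    \sum_(s < N) cos (h%:R * W s) * cos (k%:R * W s) = (h == k)%:R * (N%:R / 2).
  move=> hL.
  have e1 (s : nat) : cos (h%:R * W s) * cos (k%:R * W s) =
      2^-1 * cos ((h + k)%N%:R * W s) + 2^-1 * cos ((maxn h k - minn h k)%N%:R * W s).
    have -> : cos ((maxn h k - minn h k)%N%:R * W s) = cos (h%:R * W s - k%:R * W s).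
      have [hk|hk] := leqP h k.
        by rewrite natrB// -[LHS]cosN; congr cos; ring.
      by rewrite natrB 1?ltnW//; congr cos; ring.
    by rewrite natrD mulrDl cosD cosB; field.
  under eq_bigr do rewrite e1.
  rewrite big_split/= -!mulr_sumr z ?mulr0 ?add0r; last by rewrite /N; lia.
  case: eqVneq => [->|ne]; last by rewrite z ?mulr0 ?mul0r//; rewrite /N; lia.
  rewrite maxnn minnn subnn; under eq_bigr do rewrite mul0r cos0.
  by rewrite sumr_const card_ord mul1r mulrC.
have E : \sum_(s < N) (\sum_(h < L) e h * cos (h%:R * W s)) * cos (k%:R * W s) = e k * (N%:R / 2).
  under eq_bigr do rewrite mulr_suml.
  rewrite exchange_big/= (bigD1 (Ordinal kL))//= [X in _ + X]big1 ?addr0.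
    under eq_bigr do rewrite -mulrA.
    by rewrite -mulr_sumr ort// eqxx mul1r.
  move=> h ne; under eq_bigr do rewrite -mulrA.
  rewrite -mulr_sumr ort// (_ : (nat_of_ord h == k) = false) ?mul0r ?mulr0//.
  by apply/negbTE.
have : `|e k * (N%:R / 2)| <= N%:R * kap.
  rewrite -E; apply: (le_trans (ler_norm_sum _ _ _)).
  apply: (@le_trans _ _ (\sum_(s < N) kap)); last by rewrite sumr_const card_ord mulr_natl.
  apply: ler_sum => s _; rewrite normrM -[leRHS]mulr1; apply: ler_pM => //.
  exact: cos_max.
rewrite normrM [X in _ * X]gtr0_norm ?divr_gt0// => h.
rewrite -(ler_pM2r N0); move: h; set x := `|e k|; move: (N%:R) => n; lra.
Qed.

Section Riemann.
Variables (a : nat -> R) (B : R) (g : R -> R).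
Hypothesis aB : forall h, `|a h| <= B.
Hypothesis ag : forall w, (fun N => \sum_(h < N) a h * cos (h%:R * w)) @ \oo --> g w.

(** Coefficients of the twice integrated series, up to sign. Division by zero gives [b 0] = 0, so
    the constant term [a 0] is not integrated and reappears separately in the second differences. *)
Let b h := a h / h%:R ^+ 2.
Let FL L w := \sum_(h < L) b h * cos (h%:R * w).
Let F w := limn (FL ^~ w).

Let B0 : 0 <= B. Proof. exact: le_trans (normr_ge0 _) (aB 0). Qed.

Let FL_dist (L L' : nat) w : (0 < L)%N -> (L <= L')%N -> \sum_(L <= h < L') `|b h * cos (h%:R * w)| <= 2 * B / L%:R.
Proof.
move=> L0 LL'.
apply: (@le_trans _ _ (\sum_(L <= h < L') (- (2 * B / h.+1%:R) - - (2 * B / h%:R)))).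
  rewrite big_nat [leRHS]big_nat; apply: ler_sum => h /andP[Lh _].
  have h0 : 0 < h%:R :> R by rewrite ltr0n (leq_trans L0).
  have h1 : 1 <= h%:R :> R by rewrite ler1n (leq_trans L0).
  apply: (@le_trans _ _ (B / h%:R ^+ 2)).
    rewrite normrM -[leRHS]mulr1; apply: ler_pM => //; last exact: cos_max.
    by rewrite /b normrM normfV (ger0_norm (sqr_ge0 _)) ler_wpM2r// invr_ge0 sqr_ge0.
  have -> : - (2 * B / h.+1%:R) - - (2 * B / h%:R) = B * (2 / (h%:R * (h%:R + 1))).
    by rewrite -[h.+1%:R]natr1; field; rewrite !gt_eqF// ltr_wpDl// ltW.
  rewrite ler_wpM2l// -[2]invrK -invfM lef_pV2 ?posrE ?mulr_gt0 ?exprn_gt0 ?addr_gt0//.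
  by rewrite mulrA expr2 mulrC; nra.
rewrite telescope_sumr// opprK addrC lerBlDr lerDl divr_ge0// mulr_ge0//.
Qed.

Let FL_cvg w : (FL ^~ w) @ \oo --> F w.
Proof.
apply: (@abs_bounded_is_cvg (fun h => b h * cos (h%:R * w)) (2 * B)) => -[|N].
  by rewrite big_ord0 mulr_ge0.
rewrite -(big_mkord xpredT (fun h => `|b h * cos (h%:R * w)|)) big_nat_recl//= /b.
rewrite expr0n/= invr0 mulr0 mul0r normr0 add0r.
rewrite -(big_add1 _ _ 0 N.+1 xpredT (fun h => `|a h / h%:R ^+ 2 * cos (h%:R * w)|)).
by apply: le_trans (@FL_dist 1 N.+1 w isT isT) _; rewrite divr1.
Qed.

Let F_rate (L : nat) w : (0 < L)%N -> `|F w - FL L w| <= 2 * B / L%:R.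
Proof.
move=> L0; apply: (@cvg_le_bound (fun L' => `|FL L' w - FL L w|)).
  by apply: cvg_norm; apply: cvgB; [exact: FL_cvg|exact: cvg_cst].
near=> L'.
have LL' : (L <= L')%N by near: L'; exact: nbhs_infty_ge.
rewrite /FL -!(big_mkord xpredT (fun h => b h * cos (h%:R * w))).
rewrite (@big_cat_nat _ _ _ L 0 L')//= addrAC subrr add0r.
exact: le_trans (ler_norm_sum _ _ _) (FL_dist _ L0 LL').
Unshelve. all: by end_near.
Qed.

Let FL_approx (e : R) : 0 < e -> exists L0 : nat, forall L, (L0 < L)%N -> forall w, `|F w - FL L w| <= e.
Proof.
move=> e0; exists (Num.truncn (2 * B / e)).+1 => L L0 w.
have Lp : (0 < L)%N by exact: leq_trans L0.
apply: (le_trans (F_rate w Lp)).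
rewrite ler_pdivrMr ?ltr0n// [leRHS]mulrC -ler_pdivrMr//.
have /andP[_ /ltW h] := truncn_itv (divr_ge0 (mulr_ge0 (ler0n _ 2) B0) (ltW e0)).
by apply: le_trans h _; rewrite ler_nat ltnW.
Qed.

Let FL_continuous L : continuous (FL L).
Proof.
move=> w; rewrite /FL; elim: L => [|L IH].
  have -> : (fun w => \sum_(h < 0) b h * cos (h%:R * w)) = cst 0 :> (R -> R).
    by apply/funext => x; rewrite big_ord0.
  exact: cvg_cst.
have -> : (fun w => \sum_(h < L.+1) b h * cos (h%:R * w)) =
    (fun w => \sum_(h < L) b h * cos (h%:R * w) + b L * cos (L%:R * w)) :> (R -> R).
  by apply/funext => x; rewrite big_ord_recr.
apply: cvgD => //; apply: cvgMl_tmp.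
by apply: continuous_comp; [apply: cvgMl_tmp|exact: continuous_cos].
Qed.

Let F_continuous : continuous F.
Proof.
move=> w; apply/cvgrPdist_le => e e0.
have [L0 hL] := FL_approx (divr_gt0 e0 (ltr0Sn R 2)).
have := hL L0.+1 (ltnSn _); set L := L0.+1 => {}hL.
have : FL L x @[x --> w] --> FL L w by exact: FL_continuous.
move/cvgrPdist_le/(_ _ (divr_gt0 e0 (ltr0Sn R 2))) => H.
near=> x.
have h1 := hL w; have h2 := hL x.
have h3 : `|FL L w - FL L x| <= e / 3 by near: x.
move: h1 h2 h3; rewrite !ler_norml => /andP[? ?] /andP[? ?] /andP[? ?].
by apply/andP; split; lra.
Unshelve. all: by end_near.
Qed.

Let D2_FL L t w : 0 < t -> D2 t (FL L.+1) w =
  - (t ^+ 2 * (\sum_(h < L.+1) (a h * cos (h%:R * w)) * sinc2 (h%:R * (t / 2)) - a 0)).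
Proof.
move=> t0; rewrite /FL D2_cos_sum !big_ord_recl/= !mul0r cos0 /sinc2 eqxx.
rewrite (_ : 2 * 1 - 2 = 0 :> R); last by ring.
rewrite mulr0 mul0r add0r !mulr1 [a 0 + _]addrC addrK mulr_sumr -sumrN.
apply: eq_bigr => h _; rewrite two_cos_sub2 /b.
have hp : 0 < (lift ord0 h)%:R :> R by rewrite ltr0n.
rewrite mulf_eq0 !gt_eqF ?divr_gt0//=.
have -> : (lift ord0 h)%:R * t / 2 = (lift ord0 h)%:R * (t / 2) :> R by rewrite mulrA.
by field; rewrite !gt_eqF.
Qed.

(* Riemann: the second symmetric derivative of the twice integrated series is
   the sum of the series. *)
Let riemann w (e : R) : 0 < e -> exists2 del, 0 < del & forall t, 0 < t -> t < del ->
  `|D2 t F w + t ^+ 2 * (g w - a 0)| <= e * t ^+ 2.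
Proof.
move=> e0.
pose r h := \sum_(i < h.+1) a i * cos (i%:R * w) - g w.
(* Summation by parts will be split at N0, beyond which the remainders are at most e/16. The budget
   is e/16 for the boundary term, e/2 for the head and 4 (e/16) for the tail, 4 bounding the total
   variation of the factors. *)
have r0 : r @ \oo --> 0.
  rewrite -(subrr (g w)); apply: cvgB; last exact: cvg_cst.
  by have := @ag w; rewrite -cvg_shiftS.
have e16 : 0 < e / 16 by rewrite divr_gt0.
have [N0 _ hN0] : \forall h \near \oo, `|r h| <= e / 16.
  by move/cvgrPdist_le : r0 => /(_ _ e16); apply: filterS => h; rewrite sub0r normrN.
pose Rm := \sum_(h < N0) `|r h|.
have Rm0 : 0 <= Rm by apply: sumr_ge0.
have p1 : 0 < (Rm + 1) * N0.+1%:R by rewrite mulr_gt0// ltr_wpDl.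
(* The first bound keeps N0 eta within [0, 1], where 1 - [lam N0] <= N0 eta. The second brings [Rm]
   (1 - [lam N0]), the cost of the head, below e/2. *)
pose del := Num.min (N0.+1%:R^-1) (e / 2 / ((Rm + 1) * N0.+1%:R)).
have del0 : 0 < del by rewrite lt_min invr_gt0 ltr0n/= divr_gt0// divr_gt0.
exists del => // t t0 td.
have t1 : t * N0.+1%:R <= 1.
  by rewrite -ler_pdivlMr// mul1r ltW// (lt_le_trans td)// ge_min lexx.
have t2 : t * ((Rm + 1) * N0.+1%:R) <= e / 2.
  by rewrite -ler_pdivlMr// ltW// (lt_le_trans td)// ge_min lexx orbT.
have tle1 : t <= 1.
  by apply: le_trans t1; rewrite ler_peMr// ?(ltW t0)// ler1n.
pose eta := t / 2.
have eta0 : 0 < eta by rewrite divr_gt0.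
have eta1 : eta <= 1 by rewrite /eta; lra.
pose lam (h : nat) := sinc2 (h%:R * eta).
have lam0 : lam 0 = 1 by rewrite /lam mul0r /sinc2 eqxx.
have N0e : N0%:R * eta <= t * N0.+1%:R.
  by rewrite -[N0.+1%:R]natr1 /eta; (have : 0 <= N0%:R * t by rewrite mulr_ge0// ltW); lra.
have lamN0 : 1 - lam N0 <= t * N0.+1%:R.
  have h0 : 0 <= N0%:R * eta by rewrite mulr_ge0// ltW.
  have h1 : N0%:R * eta <= 1 by exact: le_trans t1.
  have := sinc2_ge h0 h1; rewrite -/(lam N0) => h2.
  apply: le_trans N0e; nra.
have key L : (N0 <= L)%N ->
   `|\sum_(h < L.+1) (a h * cos (h%:R * w)) * lam h - g w| <= e.
  move=> NL; rewrite (@abel_summation (fun h => a h * cos (h%:R * w)))//.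
  apply: (@le_trans _ _ (e / 16 + (Rm * (1 - lam N0) + e / 16 * 4))); last first.
    have : Rm * (1 - lam N0) <= e / 2.
      apply: le_trans t2; rewrite mulrCA; apply: (@le_trans _ _ (Rm * (t * N0.+1%:R))).
        by rewrite ler_wpM2l.
      by rewrite mulrDl mul1r lerDl mulr_ge0// ltW.
    by lra.
  apply: (le_trans (ler_normD _ _)); apply: lerD.
    rewrite normrM -[leRHS]mulr1; apply: ler_pM => //; first exact: hN0.
    by rewrite ger0_norm ?sinc2_ge0// sinc2_le1.
  rewrite -(big_mkord xpredT (fun h => (\sum_(i < h.+1) a i * cos (i%:R * w) - g w) * (lam h - lam h.+1))).
  rewrite (@big_cat_nat _ _ _ N0 0 L)//=.
  apply: (le_trans (ler_normD _ _)); apply: lerD.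
    rewrite big_mkord mulr_suml; apply: (le_trans (ler_norm_sum _ _ _)).
    apply: ler_sum => h _; rewrite normrM ler_wpM2l//.
    have mono (p q : nat) : (p <= q)%N -> (q <= N0)%N -> lam q <= lam p.
      move=> pq qN; apply: sinc2_decr.
      - by rewrite mulr_ge0// ltW.
      - by rewrite ler_pM2r// ler_nat.
      - apply: (@le_trans _ _ (N0%:R * eta)); first by rewrite ler_pM2r// ler_nat.
        by have := @pi_ge2 R; lra.
    have h1 := mono h h.+1 (leqnSn _) (ltn_ord h).
    have h2 := mono h.+1 N0 (ltn_ord h) (leqnn _).
    have h3 := sinc2_le1 (h%:R * eta).
    by rewrite ger0_norm ?subr_ge0// lerB.
  apply: (le_trans (ler_norm_sum _ _ _)).
  apply: (@le_trans _ _ (\sum_(N0 <= h < L) e / 16 * `|lam h - lam h.+1|)).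
    rewrite big_nat [leRHS]big_nat; apply: ler_sum => h /andP[Nh _].
    by rewrite normrM ler_wpM2r//; exact: hN0.
  by rewrite -mulr_sumr ler_wpM2l ?(ltW e16)//; exact: sinc2_variation.
apply: (@cvg_le_bound (fun L => `|D2 t (FL L.+1) w + t ^+ 2 * (g w - a 0)|)).
  apply: cvg_norm; apply: cvgD; last exact: cvg_cst.
  have s x : (fun L => FL L.+1 x) @ \oo --> F x by have := @FL_cvg x; rewrite -cvg_shiftS.
  by apply: cvgB; [apply: cvgD|apply: cvgMl_tmp]; exact: s.
near=> L.
have NL : (N0 <= L)%N by near: L; exact: nbhs_infty_ge.
rewrite D2_FL// (_ : - _ + _ = - (t ^+ 2 * (\sum_(h < L.+1) (a h * cos (h%:R * w)) * lam h - g w))); last first.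
  by rewrite /lam /eta; ring.
by rewrite normrN normrM (ger0_norm (sqr_ge0 _)) mulrC ler_wpM2r ?sqr_ge0//; exact: key.
Unshelve. all: by end_near.
Qed.

(** Schwarz's argument is applied to [D2 del F] rather than to [F]: by Riemann its second symmetric
    derivative is minus [D2 del g], the constant [a 0] cancelling, and this is at most [kap]. Hence
    the iterated second difference of [F] is at most kap del^2. It multiplies the k-th coefficient
    by (2 cos(k del) - 2)^2, and the grid argument on a partial sum isolates that coefficient. *)
Lemma cos_series_coef_bound del (kap : R) (k : nat) : 0 < del -> (0 < k)%N ->
  (forall w, `|D2 del g w| <= kap) ->
  `|a k / k%:R ^+ 2| * (2 * cos (k%:R * del) - 2) ^+ 2 <= 2 * (kap * del ^+ 2).
Proof.
move=> del0 k0 gk.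
have d2d2 G t x : D2 t (D2 del G) x = D2 t G (x + del) + D2 t G (x - del) - 2 * D2 t G x.
  rewrite /D2 -!addrA.
  by rewrite ![t + _]addrC ![- t + _]addrC !addrA; ring.
have Hc : continuous (D2 del F).
  move=> x; apply: cvgB; last by apply: cvgMl_tmp; exact: F_continuous.
  apply: cvgD; (apply: continuous_comp; last exact: F_continuous).
    by apply: cvgD => //; exact: cvg_cst.
  by apply: cvgB => //; exact: cvg_cst.
have loc x (e : R) : 0 < e -> exists2 d, 0 < d & forall t, 0 < t -> t < d ->
    `|D2 t (D2 del F) x| <= (kap + e) * t ^+ 2.
  move=> e0; have e4 : 0 < e / 4 by rewrite divr_gt0.
  have [d1 d10 h1] := riemann (x + del) e4.
  have [d2 d20 h2] := riemann (x - del) e4.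
  have [d3 d30 h3] := riemann x e4.
  exists (Num.min d1 (Num.min d2 d3)); first by rewrite !lt_min d10 d20.
  move=> t t0; rewrite !lt_min => /and3P[t1 t2 t3].
  have := h1 t t0 t1; have := h2 t t0 t2; have := h3 t t0 t3.
  have := gk x; rewrite d2d2 {1}/D2.
  have : 0 <= t ^+ 2 by exact: sqr_ge0.
  rewrite !ler_norml.
  move: (D2 t F (x + del)) (D2 t F (x - del)) (D2 t F x) (g (x + del)) (g (x - del)) (g x) => A1 A2 A3 g1 g2 g3 tt /andP[k1 k2] /andP[? ?] /andP[? ?] /andP[? ?].
  have k1' : - kap * t ^+ 2 <= (g1 + g2 - 2 * g3) * t ^+ 2 by rewrite ler_wpM2r.
  have k2' : (g1 + g2 - 2 * g3) * t ^+ 2 <= kap * t ^+ 2 by rewrite ler_wpM2r.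
  by apply/andP; split; lra.
have up w : D2 del (D2 del F) w <= kap * del ^+ 2.
  apply: schwarz_second_difference => // x e e0; have [d d0 hd] := loc x e e0.
  by exists d => // t t0 td; apply: le_trans (hd t t0 td); exact: ler_norm.
have dn w : D2 del (fun x => - D2 del F x) w <= kap * del ^+ 2.
  apply: schwarz_second_difference => //.
    by move=> x; apply: cvgN; exact: Hc.
  move=> x e e0; have [d d0 hd] := loc x e e0.
  exists d => // t t0 td; apply: le_trans (hd t t0 td).
  rewrite (_ : D2 t _ x = - D2 t (D2 del F) x); first by rewrite -normrN ler_norm.
  by rewrite [in RHS]/D2 [in LHS]/D2; ring.
have bnd w : `|D2 del (D2 del F) w| <= kap * del ^+ 2.
  rewrite ler_norml up andbT lerNl; apply: le_trans (dn w).
  by rewrite le_eqVlt; apply/orP; left; apply/eqP; rewrite [in RHS]/D2 [in LHS]/D2; ring.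
apply/ler_addgt0Pr => e e0.
(* The iterated second difference has weights of total modulus 16, so an error e/32 in [F] becomes
   e/2, doubled to [e] by the coefficient bound. *)
have e32 : 0 < e / 32 by rewrite divr_gt0.
have [L0 hL] := FL_approx e32.
pose L := (L0 + k).+1.
have {}hL := hL L (leq_addr _ _).
have e2 w : \sum_(h < L) (b h * (2 * cos (h%:R * del) - 2) * (2 * cos (h%:R * del) - 2)) * cos (h%:R * w) =
    D2 del (D2 del (FL L)) w.
  have -> : D2 del (FL L) = (fun w => \sum_(h < L) (b h * (2 * cos (h%:R * del) - 2)) * cos (h%:R * w)).
    by apply/funext => x; rewrite /FL D2_cos_sum.
  by rewrite (D2_cos_sum (fun h => b h * (2 * cos (h%:R * del) - 2))).
have fin w : `|\sum_(h < L) (b h * (2 * cos (h%:R * del) - 2) * (2 * cos (h%:R * del) - 2)) * cos (h%:R * w)| <= kap * del ^+ 2 + e / 2.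
  rewrite e2; have := bnd w; rewrite !d2d2 /D2.
  have h1 := hL (w + del + del); have h2 := hL (w + del - del); have h3 := hL (w + del).
  have h4 := hL (w - del + del); have h5 := hL (w - del - del); have h6 := hL (w - del).
  have h7 := hL w; move: h1 h2 h3 h4 h5 h6 h7.
  rewrite !ler_norml => /andP[? ?] /andP[? ?] /andP[? ?] /andP[? ?] /andP[? ?] /andP[? ?] /andP[? ?] /andP[? ?].
  by apply/andP; split; lra.
have kL : (0 < k < L)%N by rewrite k0/= /L ltnS leq_addl.
have := @cos_coef_bound (fun h => b h * (2 * cos (h%:R * del) - 2) * (2 * cos (h%:R * del) - 2)) L k _ kL fin; rewrite -mulrA -expr2 normrM (ger0_norm (sqr_ge0 _)) /b.
lra.
Qed.

End Riemann.

Lemma mvt_C1 (f f' : R -> R) (x y : R) : x < y ->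
  (forall z, is_derive z (1 : R) f (f' z)) -> exists2 z, x < z < y & f y - f x = f' z * (y - x).
Proof.
move=> xy df; have [|z zin e] := @MVT R f f' x y xy (fun z _ => df z).
  apply: continuous_subspaceT => z; apply: differentiable_continuous.
  by apply/derivable1_diffP; exact: ex_derive.
by exists z => //; move: zin; rewrite in_itv.
Qed.

Lemma D2_bound_local (g g1 g2 : R -> R) (K lo hi w del : R) :
  (forall z, is_derive z (1 : R) g (g1 z)) -> (forall z, is_derive z (1 : R) g1 (g2 z)) ->
  (forall z, lo <= z <= hi -> `|g2 z| <= K) -> 0 < del -> lo <= w - del -> w + del <= hi ->
  `|D2 del g w| <= 2 * K * del ^+ 2.
Proof.
move=> dg dg1 gK del0 low hiw.
pose u t := g (w + t) + g (w - t).
have du z : is_derive z (1 : R) u (g1 (w + z) - g1 (w - z)).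
  have -> : g1 (w + z) - g1 (w - z) = g1 (w + z) * 1 + g1 (w - z) * (-1) by ring.
  have dp : is_derive z (1 : R) (fun t => w + t) 1.
    by have := @is_deriveD _ _ _ (cst w) id z 1 0 1 (is_derive_cst w z 1) (is_derive_id z 1); rewrite add0r.
  have dm : is_derive z (1 : R) (fun t => w - t) (-1).
    by have := @is_deriveB _ _ _ (cst w) id z 1 0 1 (is_derive_cst w z 1) (is_derive_id z 1); rewrite sub0r.
  exact: is_deriveD.
have [c /andP[c0 cd] e] := mvt_C1 del0 du.
have cc : w - c < w + c by lra.
have [c' /andP[a1 a2] e'] := mvt_C1 cc dg1.
have -> : D2 del g w = g2 c' * ((w + c - (w - c)) * (del - 0)).
  by rewrite mulrA -e' -e /u /D2 addr0 subr0; ring.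
have g2K : `|g2 c'| <= K by apply: gK; apply/andP; split; lra.
have -> : (w + c - (w - c)) * (del - 0) = 2 * (c * del) by ring.
rewrite normrM [X in _ * X]ger0_norm ?mulr_ge0 ?(ltW c0) ?(ltW del0)//.
have -> : 2 * K * del ^+ 2 = K * (2 * (del * del)) by ring.
apply: ler_pM => //; first by rewrite !mulr_ge0 ?(ltW c0) ?(ltW del0).
by rewrite ler_pM2l// ler_pM2r// ltW.
Qed.

Lemma periodic_reduce (g : R -> R) : (forall x, g (x + 2 * pi) = g x) -> forall w,
  exists s, (forall x, g (x + s) = g x) /\ 0 <= w + s <= 2 * pi.
Proof.
move=> gp w; have p0 : 0 < 2 * pi :> R by rewrite mulr_gt0// pi_gt0.
have gpn (k : nat) x : g (x + 2 * pi * k%:R) = g x.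
  elim: k x => [|k IH] x; first by rewrite mulr0 addr0.
  have -> : x + 2 * pi * k.+1%:R = (x + 2 * pi * k%:R) + 2 * pi by rewrite -[k.+1%:R]natr1; ring.
  by rewrite gp.
have gmn (k : nat) x : g (x - 2 * pi * k%:R) = g x by rewrite -[LHS](gpn k) subrK.
have [w0|w0] := leP 0 w.
  exists (- (2 * pi * (Num.truncn (w / (2 * pi)))%:R)); split; first exact: gmn.
  have /andP[h1 h2] := truncn_itv (divr_ge0 w0 (ltW p0)).
  move: h1 h2; rewrite ler_pdivlMr// ltr_pdivrMr// -natr1 => h1 h2.
  by apply/andP; split; lra.
exists (2 * pi * (Num.truncn (- w / (2 * pi))).+1%:R); split; first exact: gpn.
have nw0 : 0 <= - w by rewrite oppr_ge0 ltW.
have /andP[h1 h2] := truncn_itv (divr_ge0 nw0 (ltW p0)).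
move: h1 h2; rewrite ler_pdivlMr// ltr_pdivrMr// -natr1 => h1 h2.
by apply/andP; split; lra.
Qed.

(** After reducing w to [0, 2 pi], a step of at most pi stays in [-pi, 3 pi], where [g2] is bounded
    by compactness. *)
Lemma D2_bound_periodic (g g1 g2 : R -> R) :
  (forall z, is_derive z (1 : R) g (g1 z)) -> (forall z, is_derive z (1 : R) g1 (g2 z)) ->
  continuous g2 -> (forall x, g (x + 2 * pi) = g x) ->
  exists K, forall del w, 0 < del -> del <= pi -> `|D2 del g w| <= K * del ^+ 2.
Proof.
move=> dg dg1 cg2 gp; have p0 := @pi_gt0 R.
have lh : - pi <= 3 * pi :> R by lra.
have cn : continuous (fun z => `|g2 z|).
  by move=> z; apply: cvg_norm; exact: cg2.
have [z0 _ z0max] := @EVT_max R _ _ _ lh (continuous_subspaceT cn).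
exists (2 * `|g2 z0|) => del w del0 dpi.
have [s [gs /andP[s0 s1]]] := periodic_reduce gp w.
have -> : D2 del g w = D2 del g (w + s).
  rewrite /D2; have -> : w + s + del = w + del + s by ring.
  have -> : w + s - del = w - del + s by ring.
  by rewrite !gs.
apply: (@D2_bound_local g g1 g2 _ (- pi) (3 * pi)) => //; lra.
Qed.

(** The step del = pi / k is tuned to the coefficient: there 2 cos(k del) - 2 = -4. Thus 16 |a k| /
    k^2 <= 2 K (pi / k)^4, which gives the constant K pi^4 / 8. *)
Lemma cos_series_coef_quadratic (a : nat -> R) (B : R) (g g1 g2 : R -> R) :
  (forall h, `|a h| <= B) ->
  (forall w, (fun N => \sum_(h < N) a h * cos (h%:R * w)) @ \oo --> g w) ->
  (forall z, is_derive z (1 : R) g (g1 z)) -> (forall z, is_derive z (1 : R) g1 (g2 z)) ->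
  continuous g2 ->
  exists C, forall k, (0 < k)%N -> `|a k| <= C / k%:R ^+ 2.
Proof.
move=> aB ag dg dg1 cg2.
have gp x : g (x + 2 * pi) = g x.
  apply: (@cvg_unique _ _ ((fun N => \sum_(h < N) a h * cos (h%:R * (x + 2 * pi))) @ \oo)) => //.
    exact: ag.
  rewrite (_ : (fun N => _) = (fun N => \sum_(h < N) a h * cos (h%:R * x))); first exact: ag.
  apply/funext => N; apply: eq_bigr => h _; congr (_ * _).
  by rewrite mulrDr [h%:R * (2 * pi)]mulrC cosD2pin.
have [K HK] := D2_bound_periodic dg dg1 cg2 gp.
exists (K * pi ^+ 4 / 8) => k k0.
have k0' : 0 < k%:R :> R by rewrite ltr0n.
have p0 := @pi_gt0 R.
have del0 : 0 < pi / k%:R :> R by rewrite divr_gt0.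
have del_le_pi : pi / k%:R <= pi :> R.
  by rewrite ler_pdivrMr// ler_peMr ?(ltW p0)// ler1n.
have := cos_series_coef_bound aB ag del0 k0 (fun w => HK _ w del0 del_le_pi).
have -> : k%:R * (pi / k%:R) = pi :> R by field; rewrite gt_eqF.
rewrite cospi normrM normfV (ger0_norm (sqr_ge0 _)).
have -> : (2 * -1 - 2) ^+ 2 = 16 :> R by ring.
move=> h; rewrite -(@ler_pM2r _ (16 / k%:R ^+ 2)) ?divr_gt0 ?exprn_gt0//.
have -> : `|a k| * (16 / k%:R ^+ 2) = `|a k| / k%:R ^+ 2 * 16 by field; rewrite gt_eqF.
apply: (le_trans h); rewrite le_eqVlt; apply/orP; left; apply/eqP.
by field; rewrite gt_eqF.
Qed.

End CosineSeries.

(** * Quadratic forms in independent vectors *)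

Section MomentTools.
Context {d} {T : measurableType d} {R : realType} (P : probability T R).

Lemma Ex_bilinear (I J : finType) (al : I -> R) (be : J -> R) (f : I -> T -> R) (g : J -> T -> R) :
  (forall i j, itg P (fun x => f i x * g j x)) ->
  Ex P (fun x => (\sum_i al i * f i x) * (\sum_j be j * g j x)) =
  \sum_i \sum_j al i * be j * Ex P (fun x => f i x * g j x).
Proof.
move=> H.
have -> : (fun x => (\sum_i al i * f i x) * (\sum_j be j * g j x)) =
    (fun x => \sum_i \sum_j (al i * be j) * (f i x * g j x)).
  apply/funext => x; rewrite big_distrlr/=; apply: eq_bigr => i _.
  by apply: eq_bigr => j _; ring.
rewrite Ex_sum; last by move=> i _; apply: itg_sum => j _; exact: itgZ.
apply: eq_bigr => i _; rewrite Ex_sum; last by move=> j _; exact: itgZ.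
by apply: eq_bigr => j _; rewrite ExZ.
Qed.

Lemma Ex_sqr_centered (f : T -> R) : L2 P f ->
  Ex P (fun x => (f x - Ex P f) ^+ 2) = Ex P (fun x => f x ^+ 2) - Ex P f ^+ 2.
Proof.
move=> hf; have if_ := L2_itg hf.
have -> : (fun x => (f x - Ex P f) ^+ 2) = (fun x => (f x ^+ 2 - (2 * Ex P f) * f x) + Ex P f ^+ 2).
  by apply/funext => x; ring.
have iZ := itgZ (2 * Ex P f) if_.
have iB := itgB (proj2 hf) iZ.
rewrite ExD//; last exact: itg_cst.
by rewrite (ExB (proj2 hf) iZ) (ExZ _ if_) Ex_cst; ring.
Qed.

(** Each variable is correlated at most with itself and with its partner under [s], and the latter
    covariance is at most the mean of the two second moments; reindexing along [s] doubles the
    orthogonal bound. *)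
Lemma Ex_almost_orthogonal (J : finType) (s : J -> J) (W : J -> T -> R) :
  involutive s -> (forall p, L2 P (W p)) ->
  (forall p p', p' != p -> p' != s p -> Ex P (fun x => W p x * W p' x) = 0) ->
  Ex P (fun x => (\sum_p W p x) ^+ 2) <= 2 * \sum_p Ex P (fun x => W p x ^+ 2).
Proof.
move=> ss L2W H.
have -> : Ex P (fun x => (\sum_p W p x) ^+ 2) = \sum_p \sum_p' Ex P (fun x => W p x * W p' x).
  have := @Ex_bilinear J J (fun=> 1) (fun=> 1) W W (fun p p' => L2M (L2W p) (L2W p')).
  under [X in _ = X -> _]eq_bigr do under eq_bigr do rewrite !mul1r.
  move=> <-; apply: eq_Ex => x; rewrite expr2.
  by congr (_ * _); apply: eq_bigr => p _; rewrite mul1r.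
apply: (@le_trans _ _ (\sum_p (Ex P (fun x => W p x ^+ 2) +
    (Ex P (fun x => W p x ^+ 2) + Ex P (fun x => W (s p) x ^+ 2)) / 2))).
  apply: ler_sum => p _; rewrite (bigD1 p)//=; apply: lerD.
    by rewrite le_eqVlt; apply/orP; left; apply/eqP; apply: eq_Ex => x; rewrite expr2.
  have pos : 0 <= (Ex P (fun x => W p x ^+ 2) + Ex P (fun x => W (s p) x ^+ 2)) / 2.
    by rewrite divr_ge0// addr_ge0//; apply: Ex_ge0 => x; exact: sqr_ge0.
  have [sp|sp] := eqVneq (s p) p.
    rewrite big1// => p' ne; apply: H => //; by rewrite sp.
  rewrite (bigD1 (s p))//= big1 ?addr0; last by move=> p' /andP[? ?]; exact: H.
  rewrite -ExD; [|exact: (proj2 (L2W p))|exact: (proj2 (L2W (s p)))].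
  rewrite mulrC -ExZ; last by apply: itgD; [exact: (proj2 (L2W p))|exact: (proj2 (L2W (s p)))].
  apply: le_Ex; first exact: L2M.
    by apply: itgZ; apply: itgD; [exact: (proj2 (L2W p))|exact: (proj2 (L2W (s p)))].
  by move=> x; have := sqr_ge0 (W p x - W (s p) x); nra.
have e : \sum_p Ex P (fun x => W (s p) x ^+ 2) = \sum_p Ex P (fun x => W p x ^+ 2).
  by rewrite [RHS](reindex_inj (inv_inj ss)).
by rewrite big_split/= -mulr_suml big_split/= e; lra.
Qed.

Lemma itg_prod_le4 n (Y : 'I_n -> T -> R) : (n <= 4)%N -> (forall i, L4 P (Y i)) ->
  itg P (fun x => \prod_(i < n) Y i x).
Proof.
case: n Y => [|[|[|[|[|n]]]]] Y // _ hY.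
- by apply: eq_itg (itg_cst P 1) => x; rewrite big_ord0.
- by apply: eq_itg (L2_itg (L4_L2 (hY ord0))) => x; rewrite big_ord1.
- have h := L2M (L4_L2 (hY ord0)) (L4_L2 (hY (lift ord0 ord0))).
  by apply: eq_itg h => x; rewrite !big_ord_recl big_ord0 mulr1.
- have h := L2M (L4M (hY ord0) (hY (lift ord0 ord0))) (L4_L2 (hY (lift ord0 (lift ord0 ord0)))).
  by apply: eq_itg h => x; rewrite !big_ord_recl big_ord0 mulr1 mulrA.
- have h := L2M (L4M (hY ord0) (hY (lift ord0 ord0)))
    (L4M (hY (lift ord0 (lift ord0 ord0))) (hY (lift ord0 (lift ord0 (lift ord0 ord0))))).
  by apply: eq_itg h => x; rewrite !big_ord_recl big_ord0 mulr1 !mulrA.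
Qed.

Lemma Ex_sqr_eq0_ae (f : T -> R) : L2 P f -> Ex P (fun x => f x ^+ 2) = 0 ->
  {ae P, forall x, f x = 0}.
Proof.
move=> [mf hf] h.
have : (\int[P]_x `|(f x ^+ 2)%:E| = 0)%E.
  rewrite -[RHS]/(0%:E) -h /Ex /Rintegral fineK; last exact: integrable_fin_num hf.
  by apply: eq_integral => x _; rewrite /= ger0_norm ?sqr_ge0.
have m2 : measurable_fun setT (fun x => (f x ^+ 2)%:E).
  by apply/measurable_EFinP; exact: itg_mf hf.
move/(ae_eq_integral_abs P measurableT m2) => [A [mA A0 sub]].
exists A; split => // x /= fx; apply: sub => /= e; apply: fx.
by have /eqP := e I; rewrite eqe sqrf_eq0 => /eqP.
Qed.

Lemma Ex_ae_eq (f g : T -> R) : measurable_fun setT f -> measurable_fun setT g ->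
  {ae P, forall x, f x = g x} -> Ex P f = Ex P g.
Proof.
move=> mf mg fg; rewrite /Ex /Rintegral; congr fine.
apply: ae_eq_integral => //; try exact/measurable_EFinP.
by apply: filterS fg => x -> _.
Qed.

End MomentTools.

(** * Moments of linear forms in independent, identically distributed vectors *)

Section Innovations.
Context {d} {T : measurableType d} {R : realType} (P : probability T R).
Variables (dZ : nat) (Z : int -> 'I_dZ -> T -> R).
Hypothesis mZ : forall t c, measurable_fun setT (Z t c).
Hypothesis indZ : indep_vectors P Z.
Hypothesis idZ : ident_distr P Z.
Hypothesis meanZ : forall t c, Ex P (Z t c) = 0.
Hypothesis L4Z_ : forall t c, L4 P (Z t c).

Let slice (B : int -> 'I_dZ -> set R) (t : int) : set T :=
  \bigcap_(c in [set: 'I_dZ]) (Z t c @^-1` B t c).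

(** Several indices may refer to the same variable [Z t c]; their constraints are intersected, and a
    variable with no constraint gets the whole line. *)
Let merge n (u : 'I_n -> int) (cc : 'I_n -> 'I_dZ) (B : 'I_n -> set R) : int -> 'I_dZ -> set R :=
  fun t c => \bigcap_(i in [set i : 'I_n | u i = t /\ cc i = c]) B i.

Let measurable_merge n (u : 'I_n -> int) cc (B : 'I_n -> set R) t c :
  (forall i, measurable (B i)) -> measurable (merge u cc B t c).
Proof.
move=> mB; apply: fin_bigcap_measurable => //; exact: finite_finset.
Qed.

Let merge_rect n (u : 'I_n -> int) cc (B : 'I_n -> set R) (s : seq int) :
  (forall i, u i \in s) ->
  \bigcap_(i in [set: 'I_n]) (Z (u i) (cc i) @^-1` B i) =
  \bigcap_(t in [set t | t \in s]) slice (merge u cc B) t.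
Proof.
move=> us; apply/seteqP; split => [x H t /= ts c _ i /= [ut cci]|x H i _ /=].
  by rewrite -ut -cci; exact: H.
by apply: (H (u i)) => //=; exact: us.
Qed.

Let prob_slices (B : int -> 'I_dZ -> set R) (s : seq int) : uniq s ->
  (forall t c, measurable (B t c)) ->
  P (\bigcap_(t in [set t | t \in s]) slice B t) = (\prod_(t <- s) P (slice B t))%E.
Proof.
move=> us mB; have inj_nth : injective (fun i : 'I_(size s) => nth 0 s i).
  by move=> i j /eqP; rewrite nth_uniq// => /eqP/val_inj.
rewrite (big_nth 0) big_mkord -(indZ inj_nth (fun i c => mB (nth 0 s i) c)).
congr (P _); apply/seteqP; split => [x H i _|x H t /= ts].
  by apply: H => /=; exact: mem_nth.
have hi : (index t s < size s)%N by rewrite index_mem.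
by have := H (Ordinal hi) I; rewrite /= nth_index.
Qed.

(** Independence is available for vectors at distinct times, whereas monomials repeat times and
    components. Merging brings each family to one constraint per time, and the two disjoint lists of
    times are then concatenated. *)
Lemma rect_indep n m (u1 : 'I_n -> int) c1 (u2 : 'I_m -> int) c2
    (B : 'I_n -> set R) (C : 'I_m -> set R) :
  (forall i i', u1 i != u2 i') ->
  (forall i, measurable (B i)) -> (forall i, measurable (C i)) ->
  P ((\bigcap_(i in [set: 'I_n]) (Z (u1 i) (c1 i) @^-1` B i)) `&`
     (\bigcap_(i in [set: 'I_m]) (Z (u2 i) (c2 i) @^-1` C i))) =
  (P (\bigcap_(i in [set: 'I_n]) (Z (u1 i) (c1 i) @^-1` B i)) *
   P (\bigcap_(i in [set: 'I_m]) (Z (u2 i) (c2 i) @^-1` C i)))%E.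
Proof.
move=> u12 mB mC.
pose s1 := undup (codom u1); pose s2 := undup (codom u2).
have us1 : uniq s1 by exact: undup_uniq.
have us2 : uniq s2 by exact: undup_uniq.
have h1 i : u1 i \in s1 by rewrite mem_undup codom_f.
have h2 i : u2 i \in s2 by rewrite mem_undup codom_f.
have dis t : t \in s2 -> t \notin s1.
  rewrite mem_undup => /codomP[i ->]; apply/negP; rewrite mem_undup => /codomP[i' e].
  by have := u12 i' i; rewrite e eqxx.
have us : uniq (s1 ++ s2).
  by rewrite cat_uniq us1 us2 andbT/=; apply/hasPn => t; exact: dis.
pose D t c := if t \in s1 then merge u1 c1 B t c else merge u2 c2 C t c.
have mD t c : measurable (D t c).
  by rewrite /D; case: ifP => _; exact: measurable_merge.
have D1 t : t \in s1 -> slice D t = slice (merge u1 c1 B) t.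
  by move=> ts; rewrite /slice /D ts.
have D2 t : t \in s2 -> slice D t = slice (merge u2 c2 C) t.
  by move=> /dis/negbTE ts; rewrite /slice /D ts.
rewrite (merge_rect c1 B h1) (merge_rect c2 C h2).
rewrite (prob_slices us1); last by move=> *; exact: measurable_merge.
rewrite (prob_slices us2); last by move=> *; exact: measurable_merge.
rewrite -(eq_big_seq _ (fun t ts => congr1 P (D1 t ts))) -(eq_big_seq _ (fun t ts => congr1 P (D2 t ts))).
rewrite -big_cat -prob_slices//; congr (P _).
apply/seteqP; split => [x [H1 H2] t /=|x H].
  rewrite mem_cat => /orP[ts|ts]; first by rewrite D1//; exact: H1.
  by rewrite D2//; exact: H2.
split => t /= ts; first by rewrite -D1//; apply: H; rewrite /= mem_cat ts.
by rewrite -D2//; apply: H; rewrite /= mem_cat ts orbT.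
Qed.

Lemma Ex_monomial_indep n m (u1 : 'I_n -> int) c1 (u2 : 'I_m -> int) c2 :
  (n + m <= 4)%N -> (forall i i', u1 i != u2 i') ->
  itg P (fun x => (\prod_(i < n) Z (u1 i) (c1 i) x) * \prod_(i < m) Z (u2 i) (c2 i) x) ->
  Ex P (fun x => (\prod_(i < n) Z (u1 i) (c1 i) x) * \prod_(i < m) Z (u2 i) (c2 i) x) =
  Ex P (fun x => \prod_(i < n) Z (u1 i) (c1 i) x) * Ex P (fun x => \prod_(i < m) Z (u2 i) (c2 i) x).
Proof.
move=> nm u12 iI; apply: Ex_prod_indep => //.
- by apply: itg_prod_le4 => //; apply: leq_trans nm; exact: leq_addr.
- by apply: itg_prod_le4 => //; apply: leq_trans nm; exact: leq_addl.
- by move=> B C mB mC; exact: rect_indep.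
Qed.

Lemma Ex_monomial_ident n (u : int) (cc : 'I_n -> 'I_dZ) : (n <= 4)%N ->
  Ex P (fun x => \prod_(i < n) Z u (cc i) x) = Ex P (fun x => \prod_(i < n) Z 0 (cc i) x).
Proof.
move=> n4; apply: Ex_prod_eq => //; try exact: itg_prod_le4.
move=> B mB.
rewrite (@merge_rect n (fun=> u) cc B [:: u]); last by move=> i; rewrite inE.
rewrite (@merge_rect n (fun=> 0) cc B [:: 0]); last by move=> i; rewrite inE.
have one t (B' : int -> 'I_dZ -> set R) : \bigcap_(t' in [set t' | t' \in [:: t]]) slice B' t' = slice B' t.
  apply/seteqP; split => [x H|x H t' /=]; first by apply: H; rewrite /= inE.
  by rewrite inE => /eqP ->.
rewrite !one /slice.
have e t : merge (fun=> t) cc B t = fun c => \bigcap_(i in [set i : 'I_n | cc i = c]) B i.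
  apply/funext => c; rewrite /merge (_ : [set i | t = t /\ cc i = c] = [set i | cc i = c])//.
  by apply/seteqP; split => i /=; [case|].
rewrite !e; apply: (idZ u) => c; apply: fin_bigcap_measurable => //; exact: finite_finset.
Qed.

Definition lform (phi : 'I_dZ -> R) (u : int) (x : T) : R := \sum_(c < dZ) phi c * Z u c x.

Lemma L4_lform phi u : L4 P (lform phi u).
Proof. by apply: L4_sum => c _; exact: L4Z. Qed.

Lemma Ex_Z2 u v a b : u != v -> Ex P (fun x => Z u a x * Z v b x) = 0.
Proof.
move=> uv.
have e x : Z u a x * Z v b x = (\prod_(i < 1) Z u a x) * \prod_(i < 1) Z v b x by rewrite !big_ord1.
rewrite (eq_Ex _ e) (@Ex_monomial_indep 1 1 (fun=> u) (fun=> a) (fun=> v) (fun=> b))//.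
  by rewrite (eq_Ex _ (fun x => big_ord1 _ _)) meanZ mul0r.
by apply: eq_itg e _; apply: L2M; exact: L4_L2.
Qed.

Lemma Ex_Z4_isolated u v w y a b c e : u != v -> u != w -> u != y ->
  Ex P (fun x => (Z u a x * Z v b x) * (Z w c x * Z y e x)) = 0.
Proof.
move=> uv uw uy.
pose f i := nth 0 [:: v; w; y] i; pose g i := nth a [:: b; c; e] i.
have h (i i' : nat) : (i' < 3)%N -> u != f i' by case: i' => [|[|[|]]].
have e' x : (Z u a x * Z v b x) * (Z w c x * Z y e x) =
    (\prod_(i < 1) Z u a x) * \prod_(i < 3) Z (f i) (g i) x.
  by rewrite big_ord1 !big_ord_recl big_ord0 mulr1 /f /g/= !mulrA.
rewrite (eq_Ex _ e') (@Ex_monomial_indep 1 3 (fun=> u) (fun=> a) (fun i => f i) (fun i => g i))//.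
- by rewrite (eq_Ex _ (fun x => big_ord1 _ _)) meanZ mul0r.
- by move=> i i'; exact: h.
- by apply: eq_itg e' _; apply: L2M; exact: L4M.
Qed.

Lemma Ex_Z4_pairs u v a b c e : u != v ->
  Ex P (fun x => (Z u a x * Z u b x) * (Z v c x * Z v e x)) =
  Ex P (fun x => Z u a x * Z u b x) * Ex P (fun x => Z v c x * Z v e x).
Proof.
move=> uv.
pose f i := nth a [:: a; b] i; pose g i := nth a [:: c; e] i.
have e2 t (h : nat -> 'I_dZ) x : \prod_(i < 2) Z t (h i) x = Z t (h 0%N) x * Z t (h 1%N) x.
  by rewrite !big_ord_recl big_ord0 mulr1.
have e' x : (Z u a x * Z u b x) * (Z v c x * Z v e x) =
    (\prod_(i < 2) Z u (f i) x) * \prod_(i < 2) Z v (g i) x by rewrite !e2.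
rewrite (eq_Ex _ e') (@Ex_monomial_indep 2 2 (fun=> u) (fun i => f i) (fun=> v) (fun i => g i))//.
  by rewrite (eq_Ex _ (e2 u f)) (eq_Ex _ (e2 v g)).
by apply: eq_itg e' _; apply: L2M; exact: L4M.
Qed.

Lemma Ex_Z2_ident u a b : Ex P (fun x => Z u a x * Z u b x) = Ex P (fun x => Z 0 a x * Z 0 b x).
Proof.
pose f i := nth a [:: a; b] i.
have := @Ex_monomial_ident 2 u (fun i => f i) isT.
have e2 t (h : nat -> 'I_dZ) x : \prod_(i < 2) Z t (h i) x = Z t (h 0%N) x * Z t (h 1%N) x.
  by rewrite !big_ord_recl big_ord0 mulr1.
by rewrite (eq_Ex _ (e2 u f)) (eq_Ex _ (e2 0 f)).
Qed.

Lemma lformM phi psi u v x : lform phi u x * lform psi v x =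
  \sum_(p : 'I_dZ * 'I_dZ) (phi p.1 * psi p.2) * (Z u p.1 x * Z v p.2 x).
Proof.
rewrite /lform big_distrlr/= pair_big/=; apply: eq_bigr => p _; ring.
Qed.

Lemma itg_Z4 u v w y a b c e : itg P (fun x => (Z u a x * Z v b x) * (Z w c x * Z y e x)).
Proof. by apply: L2M; exact: L4M. Qed.

Lemma Ex_lform4 p1 p2 p3 p4 u v w y :
  Ex P (fun x => (lform p1 u x * lform p2 v x) * (lform p3 w x * lform p4 y x)) =
  \sum_(p : 'I_dZ * 'I_dZ) \sum_(q : 'I_dZ * 'I_dZ) (p1 p.1 * p2 p.2) * (p3 q.1 * p4 q.2) *
    Ex P (fun x => (Z u p.1 x * Z v p.2 x) * (Z w q.1 x * Z y q.2 x)).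
Proof.
rewrite -Ex_bilinear; last by move=> i j; exact: itg_Z4.
by apply: eq_Ex => x; rewrite !lformM.
Qed.

Lemma Ex_lform2 p1 p2 u v :
  Ex P (fun x => lform p1 u x * lform p2 v x) =
  \sum_(p : 'I_dZ * 'I_dZ) (p1 p.1 * p2 p.2) * Ex P (fun x => Z u p.1 x * Z v p.2 x).
Proof.
rewrite (eq_Ex _ (lformM p1 p2 u v)) Ex_sum; last first.
  by move=> i _; apply: itgZ; apply: L2M; exact: L4_L2.
by apply: eq_bigr => p _; rewrite ExZ//; apply: L2M; exact: L4_L2.
Qed.

Lemma Ex_lform4_isolated p1 p2 p3 p4 u v w y : u != v -> u != w -> u != y ->
  Ex P (fun x => (lform p1 u x * lform p2 v x) * (lform p3 w x * lform p4 y x)) = 0.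
Proof.
move=> uv uw uy; rewrite Ex_lform4 big1// => p _; rewrite big1// => q _.
by rewrite Ex_Z4_isolated// mulr0.
Qed.

Lemma Ex_lform4_pairs p1 p2 p3 p4 u v : u != v ->
  Ex P (fun x => (lform p1 u x * lform p2 u x) * (lform p3 v x * lform p4 v x)) =
  Ex P (fun x => lform p1 u x * lform p2 u x) * Ex P (fun x => lform p3 v x * lform p4 v x).
Proof.
move=> uv; rewrite Ex_lform4 !Ex_lform2 big_distrlr/=; apply: eq_bigr => p _.
by apply: eq_bigr => q _; rewrite Ex_Z4_pairs//; ring.
Qed.

Lemma Ex_lform2_neq p1 p2 u v : u != v -> Ex P (fun x => lform p1 u x * lform p2 v x) = 0.
Proof. by move=> uv; rewrite Ex_lform2 big1// => p _; rewrite Ex_Z2// mulr0. Qed.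

Lemma Ex_lform2_ident p1 p2 u v :
  Ex P (fun x => lform p1 u x * lform p2 u x) = Ex P (fun x => lform p1 v x * lform p2 v x).
Proof.
by rewrite !Ex_lform2; apply: eq_bigr => p _; rewrite Ex_Z2_ident [in RHS]Ex_Z2_ident.
Qed.

Lemma Ex_lform p u : Ex P (lform p u) = 0.
Proof.
rewrite /lform Ex_sum; last by move=> c _; apply: itgZ; exact: L2_itg (L4_L2 _).
by rewrite big1// => c _; rewrite ExZ ?meanZ ?mulr0//; exact: L2_itg (L4_L2 _).
Qed.

Definition lvar (phi : 'I_dZ -> R) : R := Ex P (fun x => lform phi 0 x ^+ 2).

Lemma Ex_lform_sqr phi u : Ex P (fun x => lform phi u x ^+ 2) = lvar phi.
Proof.
rewrite /lvar -[RHS]/(Ex P (fun x => lform phi 0 x * lform phi 0 x)) -(Ex_lform2_ident phi phi u 0).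
by apply: eq_Ex => x; rewrite expr2.
Qed.

Lemma lvar_ge0 phi : 0 <= lvar phi.
Proof. by apply: Ex_ge0 => x; exact: sqr_ge0. Qed.

Let S : 'M[R]_dZ := \matrix_(a, b) Ex P (fun x => Z 0 a x * Z 0 b x).

Let rowS (phi : 'I_dZ -> R) : 'rV[R]_dZ := (\row_c phi c) *m S.

Let rowSE phi b : rowS phi ord0 b = Ex P (fun x => lform phi 0 x * Z 0 b x).
Proof.
rewrite /rowS mxE /lform.
have -> : (fun x => (\sum_(c < dZ) phi c * Z 0 c x) * Z 0 b x) =
    (fun x => \sum_(c < dZ) phi c * (Z 0 c x * Z 0 b x)).
  by apply/funext => x; rewrite mulr_suml; apply: eq_bigr => c _; rewrite mulrA.
rewrite Ex_sum; last by move=> c _; apply: itgZ; apply: L2M; exact: L4_L2.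
apply: eq_bigr => c _; rewrite !mxE ExZ//; by apply: L2M; exact: L4_L2.
Qed.

Let rowS_sqr phi b : rowS phi ord0 b ^+ 2 <= lvar phi * S b b.
Proof.
rewrite rowSE mxE; apply: le_trans (Ex_CS _ _) _.
- exact: L4_L2 (L4_lform _ _).
- exact: L4_L2 (L4Z_ _ _).
- by [].
Qed.

Let normal phi : 'I_dZ -> R := fun c => (rowS phi *m pinvmx S) ord0 c.

(** The row [rowS phi] lies in the row space of [S], so multiplying it by the pseudo-inverse and
    then by [S] returns it. The difference of the two coefficient rows is thus annihilated by [S],
    and its form has variance zero. *)
Let normal_ae phi u : {ae P, forall x, lform phi u x = lform (normal phi) u x}.
Proof.
pose del c := phi c - normal phi c.
have del0 : rowS del = 0.
  rewrite /rowS; have -> : \row_c del c = \row_c phi c - rowS phi *m pinvmx S.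
    by apply/rowP => c; rewrite !mxE /del /normal mxE.
  by rewrite mulmxBl mulmxKpV ?submxMl// subrr.
have v0 : lvar del = 0.
  have -> : lvar del = \sum_(b < dZ) del b * rowS del ord0 b.
    under eq_bigr do rewrite rowSE.
    under eq_bigr do rewrite -ExZ ?[itg _ _](L2M (L4_L2 (L4_lform _ _)) (L4_L2 (L4Z_ _ _)))//.
    rewrite -Ex_sum; last by move=> b _; apply: itgZ; apply: L2M; [exact: L4_L2 (L4_lform _ _)|exact: L4_L2].
    apply: eq_Ex => x; rewrite expr2 {2}/lform mulr_sumr; apply: eq_bigr => b _; ring.
  by rewrite del0 big1// => b _; rewrite mxE mulr0.
have := Ex_sqr_eq0_ae (L4_L2 (L4_lform del u)).
rewrite Ex_lform_sqr => /(_ v0); apply: filterS => x.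
have -> : lform del u x = lform phi u x - lform (normal phi) u x.
  by rewrite /lform -sumrB; apply: eq_bigr => c _; rewrite /del mulrBl.
by move/eqP; rewrite subr_eq0 => /eqP.
Qed.

Lemma sqr_sum_le (I : finType) (a b : I -> R) :
  (\sum_i a i * b i) ^+ 2 <= (\sum_i a i ^+ 2) * (\sum_i b i ^+ 2).
Proof.
have H (s : seq I) : (\sum_(i <- s) a i * b i) ^+ 2 <= (\sum_(i <- s) a i ^+ 2) * (\sum_(i <- s) b i ^+ 2).
  elim: s => [|i s IH]; first by rewrite !big_nil expr0n mul0r.
  rewrite !big_cons; set A := \sum_(j <- s) a j ^+ 2 in IH *; set B := \sum_(j <- s) b j ^+ 2 in IH *.
  set C := \sum_(j <- s) a j * b j in IH *.
  have A0 : 0 <= A by apply: sumr_ge0 => j _; exact: sqr_ge0.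
  have B0 : 0 <= B by apply: sumr_ge0 => j _; exact: sqr_ge0.
  clearbody A B C.
  suff : 2 * (a i * b i) * C <= a i ^+ 2 * B + b i ^+ 2 * A by move=> h; nra.
  have h1 : (2 * (a i * b i) * C) ^+ 2 <= (a i ^+ 2 * B + b i ^+ 2 * A) ^+ 2.
    have := sqr_ge0 (a i ^+ 2 * B - b i ^+ 2 * A).
    have : (a i * b i) ^+ 2 * C ^+ 2 <= (a i * b i) ^+ 2 * (A * B) by rewrite ler_wpM2l// sqr_ge0.
    by move: (a i) (b i) => x y; nra.
  apply: le_trans (ler_norm _) _; rewrite -ler_sqr ?nnegrE//.
    by rewrite real_normK ?num_real.
  by rewrite addr_ge0// mulr_ge0// sqr_ge0.
exact: H.
Qed.

(* Linear forms in an innovation satisfy a reverse Hoelder inequality. The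
   covariance matrix [S] may be singular, so a form is first replaced by the
   almost surely equal one whose coefficients are [rowS phi *m pinvmx S]; the
   latter are controlled by the variance of the form. *)
Lemma lform_moment4 : exists2 C, 0 <= C & forall phi psi u,
  Ex P (fun x => lform phi u x ^+ 2 * lform psi u x ^+ 2) <= C * lvar phi * lvar psi.
Proof.
pose Zn u x := \sum_(c < dZ) Z u c x ^+ 2.
pose A := \sum_(c < dZ) \sum_(b < dZ) pinvmx S b c ^+ 2 : R.
pose B := \sum_(b < dZ) S b b : R.
have S0 b : 0 <= S b b by rewrite mxE; apply: Ex_ge0 => x; rewrite -expr2 sqr_ge0.
have A0 : 0 <= A by apply: sumr_ge0 => c _; apply: sumr_ge0 => b _; exact: sqr_ge0.
have B0 : 0 <= B by apply: sumr_ge0.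
have L2Zn u : L2 P (Zn u) by apply: L2_sum => c _; exact: L4_L2sqr.
pose K := Ex P (fun x => \sum_(a < dZ) \sum_(b < dZ) (Z 0 a x ^+ 4 + Z 0 b x ^+ 4)).
have i4 u a b : itg P (fun x => Z u a x ^+ 4 + Z u b x ^+ 4).
  by apply: itgD; [exact: (proj2 (L4Z_ _ _))|exact: (proj2 (L4Z_ _ _))].
have Zn4 u : Ex P (fun x => Zn u x ^+ 2) <= K.
  have -> : K = Ex P (fun x => \sum_(a < dZ) \sum_(b < dZ) (Z u a x ^+ 4 + Z u b x ^+ 4)).
    have id4 a : Ex P (fun x => Z u a x ^+ 4) = Ex P (fun x => Z 0 a x ^+ 4).
      have := @Ex_monomial_ident 4 u (fun=> a) isT.
      have e4 t x : \prod_(i < 4) Z t a x = Z t a x ^+ 4 by rewrite big_const_ord iter_mulr_1.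
      by rewrite (eq_Ex _ (e4 u)) (eq_Ex _ (e4 0)).
    rewrite /K Ex_sum; last by move=> a _; apply: itg_sum => b _; exact: i4.
    rewrite [RHS]Ex_sum; last by move=> a _; apply: itg_sum => b _; exact: i4.
    apply: eq_bigr => a _; rewrite !Ex_sum; [|by move=> b _; exact: i4|by move=> b _; exact: i4].
    apply: eq_bigr => b _; rewrite !ExD; try exact: (proj2 (L4Z_ _ _)).
    by rewrite !id4.
  apply: le_Ex; first exact: (proj2 (L2Zn u)).
    by apply: itg_sum => a _; apply: itg_sum => b _; exact: i4.
  move=> x; rewrite expr2 big_distrlr/=; apply: ler_sum => a _; apply: ler_sum => b _.
  have := sqr_ge0 (Z u a x ^+ 2 - Z u b x ^+ 2); have := sqr_ge0 (Z u a x ^+ 2).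
  have := sqr_ge0 (Z u b x ^+ 2); rewrite -!exprM.
  by move: (Z u a x) (Z u b x) => y z; nra.
have K0 : 0 <= K by apply: le_trans (Zn4 0); apply: Ex_ge0 => x; exact: sqr_ge0.
have bnd phi u x : lform (normal phi) u x ^+ 2 <= lvar phi * (A * B) * Zn u x.
  apply: le_trans (sqr_sum_le _ _) _; apply: ler_wpM2r.
    by apply: sumr_ge0 => c _; exact: sqr_ge0.
  rewrite [A * B]mulrC mulrA mulr_sumr; apply: ler_sum => c _.
  rewrite /normal mxE; apply: le_trans (sqr_sum_le _ _) _; apply: ler_wpM2r.
    by apply: sumr_ge0 => b _; exact: sqr_ge0.
  by rewrite mulr_sumr; apply: ler_sum => b _; exact: rowS_sqr.
exists ((A * B) ^+ 2 * K); first by rewrite mulr_ge0// sqr_ge0.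
move=> phi psi u.
have AB0 : 0 <= A * B by exact: mulr_ge0.
have Lnn : itg P (fun x => lform (normal phi) u x ^+ 2 * lform (normal psi) u x ^+ 2).
  by apply: L2M; apply: L4_L2sqr; exact: L4_lform.
have -> : Ex P (fun x => lform phi u x ^+ 2 * lform psi u x ^+ 2) =
    Ex P (fun x => lform (normal phi) u x ^+ 2 * lform (normal psi) u x ^+ 2).
  apply: Ex_ae_eq; last first.
  - by apply: filterS2 (normal_ae phi u) (normal_ae psi u) => x -> ->.
  - exact: itg_mf Lnn.
  - by apply: (@itg_mf _ _ _ P); apply: L2M; apply: L4_L2sqr; exact: L4_lform.
apply: (@le_trans _ _ (Ex P (fun x => (lvar phi * lvar psi * (A * B) ^+ 2) * Zn u x ^+ 2))).
  apply: le_Ex => //; first by apply: itgZ; exact: (proj2 (L2Zn u)).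
  move=> x; have -> : lvar phi * lvar psi * (A * B) ^+ 2 * Zn u x ^+ 2 =
    (lvar phi * (A * B) * Zn u x) * (lvar psi * (A * B) * Zn u x) by ring.
  by apply: ler_pM => //; exact: sqr_ge0.
rewrite ExZ; last exact: (proj2 (L2Zn u)).
have -> : (A * B) ^+ 2 * K * lvar phi * lvar psi = lvar phi * lvar psi * (A * B) ^+ 2 * K by ring.
by apply: ler_wpM2l => //; rewrite !mulr_ge0 ?lvar_ge0// sqr_ge0.
Qed.

Lemma lvar_bound : exists2 C, 0 <= C & forall phi, lvar phi <= C * \sum_(c < dZ) phi c ^+ 2.
Proof.
have L2Zn : itg P (fun x => \sum_(c < dZ) Z 0 c x ^+ 2).
  by apply: itg_sum => c _; exact: (proj2 (L4_L2 (L4Z_ _ _))).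
exists (Ex P (fun x => \sum_(c < dZ) Z 0 c x ^+ 2)).
  by apply: Ex_ge0 => x; apply: sumr_ge0 => c _; exact: sqr_ge0.
move=> phi; rewrite mulrC -ExZ//; apply: le_Ex.
- exact: (proj2 (L4_L2 (L4_lform _ _))).
- exact: itgZ.
- by move=> x; exact: sqr_sum_le.
Qed.

(** When the unordered time pairs differ, either both pairs are constant and independence factors
    the expectation, or some time occurs once among the four and both sides vanish. *)
Lemma Ex_lform4_uncorrelated p1 p2 p3 p4 u v u' v' :
  (u', v') != (u, v) -> (u', v') != (v, u) ->
  Ex P (fun x => (lform p1 u x * lform p2 v x) * (lform p3 u' x * lform p4 v' x)) =
  Ex P (fun x => lform p1 u x * lform p2 v x) * Ex P (fun x => lform p3 u' x * lform p4 v' x).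
Proof.
have sw q1 q2 q3 q4 a b c e :
    Ex P (fun x => (lform q1 a x * lform q2 b x) * (lform q3 c x * lform q4 e x)) =
    Ex P (fun x => (lform q2 b x * lform q1 a x) * (lform q3 c x * lform q4 e x)).
  by apply: eq_Ex => x; ring.
have sw2 q1 q2 q3 q4 a b c e :
    Ex P (fun x => (lform q1 a x * lform q2 b x) * (lform q3 c x * lform q4 e x)) =
    Ex P (fun x => (lform q3 c x * lform q4 e x) * (lform q1 a x * lform q2 b x)).
  by apply: eq_Ex => x; ring.
rewrite !xpair_eqE; have [<-|uv] := eqVneq u v.
  have [<-|uv'] := eqVneq u' v'.
    by rewrite andbb => uu _; rewrite Ex_lform4_pairs// eq_sym.
  rewrite [in RHS](Ex_lform2_neq _ _ uv') mulr0.
  have [->|uu] := eqVneq u' u; rewrite /=.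
    move=> vu _; rewrite sw2 sw Ex_lform4_isolated//.
  by move=> _ _; rewrite sw2 Ex_lform4_isolated.
rewrite (Ex_lform2_neq _ _ uv) mul0r => h1 h2.
have [uu|uu] := eqVneq u u'.
  have [vv|vv] := eqVneq v v'; first by move: h1; rewrite uu vv !eqxx.
  by rewrite sw Ex_lform4_isolated// 1?eq_sym// -?uu// eq_sym.
have [uv'|uv'] := eqVneq u v'; last by rewrite Ex_lform4_isolated.
have [vu|vu] := eqVneq v u'; first by move: h2; rewrite uv' vu !eqxx.
by rewrite sw Ex_lform4_isolated// 1?eq_sym// -uv'.
Qed.

Section QuadraticForm.
Variables (J : finType) (dw : J -> R) (K : nat) (tau : 'I_K -> int) (A A' : J -> 'I_K -> 'I_dZ -> R).
Hypothesis inj_tau : injective tau.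

Let L (B : J -> 'I_K -> 'I_dZ -> R) s u x := lform (B s u) (tau u) x.
Let D (B : J -> 'I_K -> 'I_dZ -> R) s x := \sum_u L B s u x.
Let Q x := \sum_s dw s * (D A s x * D A' s x).
Let N (p : 'I_K * 'I_K) x := \sum_s dw s * (L A s p.1 x * L A' s p.2 x).

Let L4L B s u : L4 P (L B s u). Proof. exact: L4_lform. Qed.

Let L2N p : L2 P (N p).
Proof. by apply: L2_sum => s _; apply: L2Z; exact: L4M. Qed.

Let QE x : Q x = \sum_p N p x.
Proof.
rewrite /Q /N exchange_big/=; apply: eq_bigr => s _.
by rewrite -mulr_sumr /D big_distrlr/= pair_big.
Qed.

Let W p x := N p x - Ex P (N p).

Let L2W p : L2 P (W p). Proof. by apply: L2B => //; exact: L2_cst. Qed.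

Let W_uncorrelated p p' : p' != p -> p' != (p.2, p.1) -> Ex P (fun x => W p x * W p' x) = 0.
Proof.
move=> pp pp'.
have h : Ex P (fun x => N p x * N p' x) = Ex P (N p) * Ex P (N p').
  rewrite Ex_bilinear; last by move=> *; apply: L2M; exact: L4M.
  rewrite /N !Ex_sum; try by move=> s _; apply: itgZ; apply: L2M; exact: L4_L2.
  rewrite big_distrlr/=; apply: eq_bigr => s _; apply: eq_bigr => s' _.
  rewrite !ExZ; try by apply: L2M; exact: L4_L2.
  rewrite Ex_lform4_uncorrelated; first by ring.
    by apply: contra pp; rewrite !xpair_eqE !(inj_eq inj_tau); case: (p) => ? ?; case: (p').
  by apply: contra pp'; rewrite !xpair_eqE !(inj_eq inj_tau); case: (p) => ? ?; case: (p').
have -> : (fun x => W p x * W p' x) = (fun x => (N p x * N p' x - Ex P (N p) * N p' x) -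
    (Ex P (N p') * N p x - Ex P (N p) * Ex P (N p'))).
  by apply/funext => x; rewrite /W; ring.
have i1 := L2M (L2N p) (L2N p').
have i2 := itgZ (Ex P (N p)) (L2_itg (L2N p')).
have i3 := itgZ (Ex P (N p')) (L2_itg (L2N p)).
have i4 := itg_cst P (Ex P (N p) * Ex P (N p')).
rewrite (ExB (itgB i1 i2) (itgB i3 i4)) (ExB i1 i2) (ExB i3 i4) h Ex_cst.
by rewrite !ExZ; [ring|exact: L2_itg|exact: L2_itg].
Qed.

Definition gram (B : J -> 'I_K -> 'I_dZ -> R) s s' : R := Ex P (fun x => D B s x * D B s' x).

Let g B u s s' := Ex P (fun x => L B s u x * L B s' u x).

Let gramE B s s' : gram B s s' = \sum_u g B u s s'.
Proof.
rewrite /gram.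
have -> : (fun x => D B s x * D B s' x) = (fun x => \sum_u \sum_v L B s u x * L B s' v x).
  by apply/funext => x; rewrite /D big_distrlr.
have i2 u v : itg P (fun x => L B s u x * L B s' v x) by apply: L2M; exact: L4_L2.
rewrite Ex_sum; last by move=> u _; apply: itg_sum.
apply: eq_bigr => u _; rewrite Ex_sum// (bigD1 u)//= big1 ?addr0// => v vu.
by apply: Ex_lform2_neq; rewrite (inj_eq inj_tau) eq_sym.
Qed.

(** Off the diagonal this is the second moment of [N (u, v)]. The diagonal terms are included
    because only the sum over all pairs factors through the Gram matrices. *)
Let G u v := \sum_s \sum_s' dw s * dw s' * (g A u s s' * g A' v s s').

Let Ex_N_sqr u v : u != v -> Ex P (fun x => N (u, v) x ^+ 2) = G u v.
Proof.
move=> uv; rewrite (eq_Ex _ (fun x => expr2 _)) Ex_bilinear; last by move=> *; apply: L2M; exact: L4M.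
apply: eq_bigr => s _; apply: eq_bigr => s' _; congr (_ * _).
rewrite /g /L -Ex_lform4_pairs ?(inj_eq inj_tau)//.
by apply: eq_Ex => x /=; ring.
Qed.

(** The second factor is moved to another time [w]. Identical distribution leaves [G u u] unchanged,
    and independence exhibits it as the expectation of a square. *)
Let G_diag_ge0 u : 0 <= G u u.
Proof.
pose w := tau u + 1; have uw : tau u != w by rewrite /w; lia.
have -> : G u u = Ex P (fun x => (\sum_s dw s * (L A s u x * lform (A' s u) w x)) ^+ 2).
  rewrite (eq_Ex _ (fun x => expr2 _)) Ex_bilinear; last first.
    by move=> *; apply: L2M; apply: L4M => //; exact: L4_lform.
  apply: eq_bigr => s _; apply: eq_bigr => s' _; congr (_ * _).
  rewrite /g /L [X in _ * X](Ex_lform2_ident _ _ (tau u) w) -Ex_lform4_pairs//.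
  by apply: eq_Ex => x /=; ring.
by apply: Ex_ge0 => x; exact: sqr_ge0.
Qed.

Let sum_G : \sum_(p : 'I_K * 'I_K) G p.1 p.2 =
  \sum_s \sum_s' dw s * dw s' * (gram A s s' * gram A' s s').
Proof.
rewrite /G exchange_big/=; apply: eq_bigr => s _.
rewrite exchange_big/=; apply: eq_bigr => s' _.
by rewrite -mulr_sumr !gramE big_distrlr/= pair_big.
Qed.

Let H u := \sum_s (lvar (A s u) + lvar (A' s u)).

(** Both factors involve the same innovation, so independence does not apply; |x y| <= x^2 + y^2
    reduces [N (u, u)] to a sum of squared forms, to whose products the fourth-moment hypothesis
    applies. *)
Let Ex_N_diag (C dmax : R) u : 0 <= C ->
  (forall phi psi u, Ex P (fun x => lform phi u x ^+ 2 * lform psi u x ^+ 2) <= C * lvar phi * lvar psi) ->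
  (forall s, `|dw s| <= dmax) ->
  Ex P (fun x => N (u, u) x ^+ 2) <= C * dmax ^+ 2 * H u ^+ 2.
Proof.
move=> C0 HC hd.
pose B (j : J * bool) := if j.2 then A j.1 u else A' j.1 u.
pose V x := \sum_j lform (B j) (tau u) x ^+ 2.
have L2V : L2 P V by apply: L2_sum => j _; apply: L4_L2sqr; exact: L4_lform.
have VE x : V x = \sum_s (L A s u x ^+ 2 + L A' s u x ^+ 2).
  rewrite /V -(pair_bigA _ (fun s b => lform (B (s, b)) (tau u) x ^+ 2))/=.
  by apply: eq_bigr => s _; rewrite big_bool.
have HE : H u = \sum_j lvar (B j).
  rewrite -(pair_bigA _ (fun s b => lvar (B (s, b))))/=.
  by apply: eq_bigr => s _; rewrite big_bool.
have NV x : N (u, u) x ^+ 2 <= dmax ^+ 2 * V x ^+ 2.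
  have h : `|N (u, u) x| <= dmax * V x.
    rewrite VE mulr_sumr; apply: le_trans (ler_norm_sum _ _ _) _; apply: ler_sum => s _ /=.
    rewrite normrM; apply: ler_pM => //.
    rewrite ler_norml; have := sqr_ge0 (L A s u x - L A' s u x); have := sqr_ge0 (L A s u x + L A' s u x).
    have := sqr_ge0 (L A s u x); have := sqr_ge0 (L A' s u x).
    by move=> *; apply/andP; split; nra.
  rewrite -exprMn -[leLHS]real_normK ?num_real// ler_sqr ?nnegrE//.
  exact: le_trans h.
apply: (@le_trans _ _ (Ex P (fun x => dmax ^+ 2 * V x ^+ 2))).
  by apply: le_Ex => //; [exact: (proj2 (L2N _))|apply: itgZ; exact: (proj2 L2V)].
rewrite ExZ; last exact: (proj2 L2V).
rewrite -mulrA [C * _]mulrCA; apply: ler_wpM2l; first exact: sqr_ge0.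
have -> : (fun x => V x ^+ 2) = (fun x => \sum_j \sum_j' lform (B j) (tau u) x ^+ 2 * lform (B j') (tau u) x ^+ 2).
  by apply/funext => x; rewrite expr2 /V big_distrlr.
have i2 j j' : itg P (fun x => lform (B j) (tau u) x ^+ 2 * lform (B j') (tau u) x ^+ 2).
  by apply: L2M; apply: L4_L2sqr; exact: L4_lform.
rewrite Ex_sum; last by move=> j _; exact: itg_sum.
rewrite HE expr2 big_distrlr/= mulr_sumr; apply: ler_sum => j _.
rewrite Ex_sum// mulr_sumr; apply: ler_sum => j' _.
by rewrite mulrA; exact: HC.
Qed.

(** The term [N p] is correlated only with itself and with the term of the swapped pair. Paying the
    factor 2 for the swap keeps mixed Gram matrices of [A] with [A'] out of the bound. *)
Lemma quadratic_form_variance (C dmax : R) : 0 <= C ->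
  (forall phi psi u, Ex P (fun x => lform phi u x ^+ 2 * lform psi u x ^+ 2) <= C * lvar phi * lvar psi) ->
  (forall s, `|dw s| <= dmax) ->
  Ex P (fun x => ((\sum_s dw s * ((\sum_u lform (A s u) (tau u) x) * (\sum_u lform (A' s u) (tau u) x))) -
    Ex P (fun x => \sum_s dw s * ((\sum_u lform (A s u) (tau u) x) * (\sum_u lform (A' s u) (tau u) x)))) ^+ 2) <=
  2 * (\sum_s \sum_s' dw s * dw s' * (gram A s s' * gram A' s s') +
    C * dmax ^+ 2 * \sum_u (\sum_s (lvar (A s u) + lvar (A' s u))) ^+ 2).
Proof.
move=> C0 HC hd.
rewrite -/Q -/(Q _).
have -> : (fun x => (Q x - Ex P Q) ^+ 2) = (fun x => (\sum_p W p x) ^+ 2).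
  have EQ : Ex P Q = \sum_p Ex P (N p).
    by rewrite (eq_Ex _ QE) Ex_sum// => p _; exact: L2_itg.
  by apply/funext => x; rewrite QE EQ -sumrB.
have inv : involutive (fun p : 'I_K * 'I_K => (p.2, p.1)) by case.
apply: le_trans (Ex_almost_orthogonal inv L2W W_uncorrelated) _.
apply: ler_wpM2l => //.
apply: (@le_trans _ _ (\sum_p Ex P (fun x => N p x ^+ 2))).
  apply: ler_sum => p _; rewrite Ex_sqr_centered// lerBlDr lerDl sqr_ge0//.
rewrite -sum_G -(pair_bigA _ G)/=.
rewrite (_ : \sum_p _ = \sum_u \sum_v Ex P (fun x => N (u, v) x ^+ 2)); last first.
  by rewrite pair_bigA/=; apply: eq_bigr => -[].
apply: (@le_trans _ _ (\sum_u ((\sum_v G u v) + C * dmax ^+ 2 * H u ^+ 2))); last first.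
  by rewrite big_split/= mulr_sumr.
apply: ler_sum => u _; rewrite (bigD1 u)//= [X in X + _ <= _](_ : _ = Ex P (fun x => N (u, u) x ^+ 2))//.
rewrite addrC; apply: lerD; last exact: Ex_N_diag.
rewrite [leRHS](bigD1 u)//=; apply: ler_wpDl; first exact: G_diag_ge0.
by apply: ler_sum => v vu; rewrite Ex_N_sqr// eq_sym.
Qed.

End QuadraticForm.

End Innovations.

(** * Weights of the quadratic form *)

Section SchurTest.
Context {R : realType}.

(** Replacing the product of two entries of [q] by the mean of their squares leaves, for each fixed
    entry, a row or column sum of |A| times one of |B|. *)
Lemma schur_test (n : nat) (q A B : 'I_n -> 'I_n -> R) (K K' : R) :
  0 <= K -> 0 <= K' ->
  (forall t, \sum_t' `|A t t'| <= K) -> (forall t', \sum_t `|A t t'| <= K) ->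
  (forall t, \sum_t' `|B t t'| <= K') -> (forall t', \sum_t `|B t t'| <= K') ->
  \sum_(p : 'I_n * 'I_n) \sum_(r : 'I_n * 'I_n) q p.1 r.1 * q p.2 r.2 * (A p.1 p.2 * B r.1 r.2) <=
  K * K' * \sum_t \sum_t' q t t' ^+ 2.
Proof.
move=> K0 K0' A1 A2 B1 B2.
apply: (@le_trans _ _ (\sum_(p : 'I_n * 'I_n) \sum_(r : 'I_n * 'I_n)
   (q p.1 r.1 ^+ 2 * (`|A p.1 p.2| * `|B r.1 r.2|) / 2 + q p.2 r.2 ^+ 2 * (`|A p.1 p.2| * `|B r.1 r.2|) / 2))).
  apply: ler_sum => p _; apply: ler_sum => r _.
  apply: (le_trans (ler_norm _)); rewrite normrM [X in _ * X]normrM.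
  have h0 : 0 <= `|A p.1 p.2| * `|B r.1 r.2| by rewrite mulr_ge0.
  have h1 : `|q p.1 r.1 * q p.2 r.2| <= (q p.1 r.1 ^+ 2 + q p.2 r.2 ^+ 2) / 2.
    have := sqr_ge0 (q p.1 r.1 - q p.2 r.2); have := sqr_ge0 (q p.1 r.1 + q p.2 r.2).
    by move: (q p.1 r.1) (q p.2 r.2) => x y ? ?; rewrite ler_norml; apply/andP; split; nra.
  apply: le_trans (ler_wpM2r h0 h1) _.
  by rewrite le_eqVlt; apply/orP; left; apply/eqP; field.
have h1 : \sum_(p : 'I_n * 'I_n) \sum_(r : 'I_n * 'I_n) q p.1 r.1 ^+ 2 * (`|A p.1 p.2| * `|B r.1 r.2|) <=
    K * K' * \sum_t \sum_t' q t t' ^+ 2.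
  rewrite -(pair_bigA _ (fun t1 t3 => \sum_(r : 'I_n * 'I_n) q t1 r.1 ^+ 2 * (`|A t1 t3| * `|B r.1 r.2|)))/=.
  rewrite mulr_sumr; apply: ler_sum => t1 _.
  rewrite exchange_big/= -(pair_bigA _ (fun t2 t4 => \sum_t3 q t1 t2 ^+ 2 * (`|A t1 t3| * `|B t2 t4|)))/=.
  rewrite mulr_sumr; apply: ler_sum => t2 _.
  under eq_bigr do rewrite -mulr_sumr -mulr_suml.
  rewrite -mulr_sumr -mulr_sumr mulrC; apply: ler_wpM2r; first exact: sqr_ge0.
  by apply: ler_pM => //; apply: sumr_ge0.
have h2 : \sum_(p : 'I_n * 'I_n) \sum_(r : 'I_n * 'I_n) q p.2 r.2 ^+ 2 * (`|A p.1 p.2| * `|B r.1 r.2|) <=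
    K * K' * \sum_t \sum_t' q t t' ^+ 2.
  rewrite -(pair_bigA _ (fun t1 t3 => \sum_(r : 'I_n * 'I_n) q t3 r.2 ^+ 2 * (`|A t1 t3| * `|B r.1 r.2|)))/=.
  rewrite exchange_big/= mulr_sumr; apply: ler_sum => t3 _.
  rewrite exchange_big/= -(pair_bigA _ (fun t2 t4 => \sum_t1 q t3 t4 ^+ 2 * (`|A t1 t3| * `|B t2 t4|)))/=.
  rewrite exchange_big/= mulr_sumr; apply: ler_sum => t4 _.
  under eq_bigr do rewrite -mulr_sumr -mulr_suml.
  rewrite -mulr_sumr -mulr_sumr mulrC; apply: ler_wpM2r; first exact: sqr_ge0.
  by apply: ler_pM => //; apply: sumr_ge0.
have split2 (f g : 'I_n * 'I_n -> 'I_n * 'I_n -> R) : \sum_p \sum_r (f p r / 2 + g p r / 2) =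
    (\sum_p \sum_r f p r) / 2 + (\sum_p \sum_r g p r) / 2.
  rewrite 2!mulr_suml -big_split/=; apply: eq_bigr => p _.
  by rewrite 2!mulr_suml -big_split.
rewrite (split2 (fun p r => q p.1 r.1 ^+ 2 * (`|A p.1 p.2| * `|B r.1 r.2|))
  (fun p r => q p.2 r.2 ^+ 2 * (`|A p.1 p.2| * `|B r.1 r.2|))).
by move: h1 h2; lra.
Qed.

(** Summing over frequencies first turns the product of two Gram sums into the bilinear expression
    of [schur_test], with kernel [q] = sum of dw E E. *)
Lemma schur_test_factored (n : nat) (J : finType) (dw : J -> R) (E : J -> 'I_n -> R)
    (A B : 'I_n -> 'I_n -> R) (K K' : R) :
  0 <= K -> 0 <= K' ->
  (forall t, \sum_t' `|A t t'| <= K) -> (forall t', \sum_t `|A t t'| <= K) ->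
  (forall t, \sum_t' `|B t t'| <= K') -> (forall t', \sum_t `|B t t'| <= K') ->
  \sum_s \sum_s' dw s * dw s' *
    ((\sum_t \sum_t' E s t * E s' t' * A t t') * (\sum_t \sum_t' E s t * E s' t' * B t t')) <=
  K * K' * \sum_t \sum_t' (\sum_s dw s * (E s t * E s t')) ^+ 2.
Proof.
move=> K0 K0' A1 A2 B1 B2.
apply: le_trans (schur_test _ K0 K0' A1 A2 B1 B2).
rewrite le_eqVlt; apply/orP; left; apply/eqP.
transitivity (\sum_s \sum_s' \sum_(p : 'I_n * 'I_n) \sum_(r : 'I_n * 'I_n)
   (dw s * (E s p.1 * E s r.1)) * (dw s' * (E s' p.2 * E s' r.2)) * (A p.1 p.2 * B r.1 r.2)).
  apply: eq_bigr => s _; apply: eq_bigr => s' _.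
  rewrite (pair_bigA _ (fun t t' => E s t * E s' t' * A t t'))/=.
  rewrite (pair_bigA _ (fun t t' => E s t * E s' t' * B t t'))/=.
  rewrite big_distrlr/= mulr_sumr; apply: eq_bigr => p _.
  by rewrite mulr_sumr; apply: eq_bigr => r _; ring.
under eq_bigr do rewrite exchange_big/=.
rewrite exchange_big/=; apply: eq_bigr => p _.
under eq_bigr do rewrite exchange_big/=.
rewrite exchange_big/=; apply: eq_bigr => r _.
rewrite big_distrlr/= mulr_suml; apply: eq_bigr => s _.
by rewrite mulr_suml.
Qed.

End SchurTest.

(** * Size of the kernel of the quadratic form in the time domain *)

Section FourierWeights.
Context {R : realType}.
Variables (n M a : nat).
Hypothesis aM : (a + M <= n)%N.

Definition trig_fourier (i : nat) (p : bool) (t : nat) : R :=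
  let x := fourier_freq n (a + i)%N%:Z * t.+1%:R in if p then cos x else sin x.

Lemma trig_fourier_le1 i p t : `|trig_fourier i p t| <= 1.
Proof. by rewrite /trig_fourier; case: p; rewrite ?cos_max ?sin_max. Qed.

(** The M frequencies are part of the n Fourier frequencies, over which Parseval's identity
    holds. *)
Lemma bessel_freq (x : 'I_n -> R) :
  \sum_(s : 'I_M * bool) (\sum_t x t * trig_fourier s.1 s.2 t) ^+ 2 <= n%:R * \sum_t x t ^+ 2.
Proof.
have inj : injective (fun t : 'I_n => t.+1) by move=> t t' [] /val_inj.
rewrite -(@parseval _ n 0 n (fun t => t.+1) x)//; last first.
  by move=> i i'; have := ltn_ord i; lia.
pose F s := (\sum_t x t * cos (2 * pi * (s + 0)%N%:R / n%:R * t.+1%:R)) ^+ 2 +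
  (\sum_t x t * sin (2 * pi * (s + 0)%N%:R / n%:R * t.+1%:R)) ^+ 2 : R.
have F0 s : 0 <= F s by rewrite addr_ge0// sqr_ge0.
rewrite -(pair_bigA _ (fun (i : 'I_M) (p : bool) => (\sum_t x t * trig_fourier i p t) ^+ 2))/=.
apply: (@le_trans _ _ (\sum_(a <= s < a + M) F s)).
  rewrite -{1}[a]add0n [(a + M)%N]addnC big_addn addnK big_mkord.
  rewrite le_eqVlt; apply/orP; left; apply/eqP; apply: eq_bigr => i _.
  rewrite big_bool/= /F; congr (_ ^+ 2 + _ ^+ 2); apply: eq_bigr => t _;
  by rewrite /trig_fourier/= /fourier_freq addn0 [(i + a)%N]addnC.
rewrite -(big_mkord xpredT F) (@big_cat_nat _ _ _ a 0 n)//=; last by apply: leq_trans aM; exact: leq_addr.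
rewrite (@big_cat_nat _ _ _ (a + M) a n)//= ?leq_addr// addrCA lerDl.
by rewrite addr_ge0//; apply: sumr_ge0.
Qed.

(** Parseval's identity with the roles of times and frequencies exchanged; the shift h = 1 is there
    because times start at 1. Only the cosine or the sine half is kept. *)
Lemma bessel_time p (x : 'I_M -> R) :
  \sum_(t < n) (\sum_i x i * trig_fourier i p t) ^+ 2 <= n%:R * \sum_i x i ^+ 2.
Proof.
have inj : injective (fun i : 'I_M => (a + i)%N) by move=> i i' /addnI/val_inj.
rewrite -(@parseval _ n 1 M (fun i => (a + i)%N) x)//; last first.
  by move=> i i'; have := ltn_ord i; lia.
apply: ler_sum => t _.
have e (f : R -> R) : \sum_i x i * f (2 * pi * (t + 1)%N%:R / n%:R * (a + i)%N%:R) =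
   \sum_i x i * f (fourier_freq n (a + i)%N%:Z * t.+1%:R).
  apply: eq_bigr => i _; congr (_ * f _); rewrite /fourier_freq addn1 -pmulrn; ring.
rewrite !e; rewrite /trig_fourier; case: p; rewrite ?lerDl ?lerDr sqr_ge0//.
Qed.

Variables (c : 'I_M -> R) (C : R).
Hypothesis C0 : 0 <= C.
Hypothesis cC : forall i, `|c i| <= C / M%:R.
Hypothesis M0 : (0 < M)%N.

Let n0 : 0 < n%:R :> R.
Proof. by rewrite ltr0n (leq_trans M0)// (leq_trans _ aM)// leq_addl. Qed.
Let Mr : 0 < M%:R :> R. Proof. by rewrite ltr0n. Qed.

Definition wfreq (s : 'I_M * bool) : R := (2 * pi)^-1 * n%:R^-1 * c s.1.

Definition qweight (t t' : 'I_n) : R :=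
  \sum_(s : 'I_M * bool) wfreq s * (trig_fourier s.1 s.2 t * trig_fourier s.1 s.2 t').

Let k1 : (2 * pi)^-1 <= 2^-1 :> R.
Proof.
have p := @pi_gt0 R; have p2 := @pi_ge2 R.
by rewrite lef_pV2 ?posrE ?mulr_gt0//; lra.
Qed.
Let k0 : 0 <= (2 * pi)^-1 :> R.
Proof. by rewrite invr_ge0 mulr_ge0// pi_ge0. Qed.

Lemma wfreq_le s : `|wfreq s| <= C / (n%:R * M%:R).
Proof.
rewrite /wfreq !normrM (ger0_norm k0) ger0_norm ?invr_ge0 ?(ltW n0)//.
have -> : C / (n%:R * M%:R) = 1 * n%:R^-1 * (C / M%:R) by field; rewrite !gt_eqF.
apply: ler_pM => //; first by apply: mulr_ge0 => //; rewrite invr_ge0 (ltW n0).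
by rewrite ler_wpM2r ?invr_ge0 ?(ltW n0)//; move: k1; lra.
Qed.

Lemma qweight_abs t t' : `|qweight t t'| <= 2 * C / n%:R.
Proof.
apply: (le_trans (ler_norm_sum _ _ _)).
apply: (@le_trans _ _ (\sum_(s : 'I_M * bool) C / (n%:R * M%:R))).
  apply: ler_sum => s _; rewrite normrM -[leRHS]mulr1; apply: ler_pM => //; first exact: wfreq_le.
  by rewrite normrM -[leRHS]mulr1; apply: ler_pM => //; exact: trig_fourier_le1.
rewrite sumr_const card_prod card_ord card_bool -[_ *+ (M * 2)]mulr_natl natrM.
by rewrite le_eqVlt; apply/orP; left; apply/eqP; field; rewrite !gt_eqF.
Qed.

Lemma qweight_sym t t' : qweight t t' = qweight t' t.
Proof. by apply: eq_bigr => s _; rewrite [trig_fourier _ _ t * _]mulrC. Qed.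

(** For fixed t', a row is a trigonometric polynomial in t with coefficients at most C / (n M).
    Bessel bounds its cosine and sine parts by n M (C / (n M))^2 each, and there are n rows. *)
Lemma qweight_frobenius : \sum_t \sum_t' qweight t t' ^+ 2 <= 4 * C ^+ 2 / M%:R.
Proof.
have row t' : \sum_t qweight t t' ^+ 2 <= 4 * C ^+ 2 / (n%:R * M%:R).
  pose u p t := \sum_(i < M) (wfreq (i, p) * trig_fourier i p t') * trig_fourier i p t.
  have qE t : qweight t t' = u true t + u false t.
    rewrite /qweight -(pair_bigA _ (fun (i : 'I_M) (p : bool) => wfreq (i, p) * (trig_fourier i p t * trig_fourier i p t')))/=.
    rewrite /u -big_split/=; apply: eq_bigr => i _; rewrite big_bool/=; ring.
  apply: (@le_trans _ _ (\sum_(t < n) (2 * u true t ^+ 2 + 2 * u false t ^+ 2))).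
    apply: ler_sum => t _; rewrite qE; have := sqr_ge0 (u true t - u false t); nra.
  rewrite big_split/= -!mulr_sumr.
  have b p : \sum_(t < n) u p t ^+ 2 <= C ^+ 2 / (n%:R * M%:R).
    apply: (le_trans (bessel_time p (fun i => wfreq (i, p) * trig_fourier i p t'))).
    apply: (@le_trans _ _ (n%:R * \sum_(i < M) (C / (n%:R * M%:R)) ^+ 2)).
      rewrite ler_wpM2l ?(ltW n0)//; apply: ler_sum => i _.
      rewrite -[leLHS]real_normK ?num_real// ler_sqr ?nnegrE//.
        rewrite normrM -[leRHS]mulr1; apply: ler_pM => //; first exact: wfreq_le.
        exact: trig_fourier_le1.
      by rewrite divr_ge0// mulr_ge0// ltW.
    rewrite sumr_const card_ord -[_ *+ M]mulr_natl.
    by rewrite le_eqVlt; apply/orP; left; apply/eqP; field; rewrite !gt_eqF.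
  have := b true; have := b false.
  have -> : 4 * C ^+ 2 / (n%:R * M%:R) = 4 * (C ^+ 2 / (n%:R * M%:R)) by rewrite mulrA.
  by lra.
rewrite exchange_big/=; apply: (le_trans (ler_sum _ (fun t' _ => row t'))).
rewrite sumr_const card_ord -[_ *+ n]mulr_natl.
by rewrite le_eqVlt; apply/orP; left; apply/eqP; field; rewrite !gt_eqF.
Qed.

End FourierWeights.

(** * Second-order structure and the mean of the estimator *)

Lemma sum_symmetric_range (V : nmodType) (F : int -> V) N :
  \sum_(i < (2 * N).+1) F (i%:Z - N%:Z) = F 0 + \sum_(h < N) (F h.+1%:Z + F (- h.+1%:Z)).
Proof.
elim: N => [|N IH]; first by rewrite muln0 big_ord_recl !big_ord0 !addr0; congr (F _).
rewrite [in RHS]big_ord_recr/= addrA -IH.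
have -> : (2 * N.+1).+1 = (2 * N).+3 by lia.
rewrite big_ord_recr big_ord_recl/=.
have -> : \sum_(i < (2 * N).+1) F ((bump 0 i)%:Z - N.+1%:Z) = \sum_(i < (2 * N).+1) F (i%:Z - N%:Z).
  by apply: eq_bigr => i _; congr F; rewrite /bump/=; lia.
have -> : (2 * N).+2%:Z - N.+1%:Z = N.+1%:Z by lia.
have -> : 0%:Z - N.+1%:Z = - N.+1%:Z by lia.
by rewrite [F (- _) + _]addrC -addrA [F (- _) + _]addrC.
Qed.

Section SecondOrder.
Context {R : realType} {d : measure_display} {T : measurableType d}.
Variable P : probability T R.
Variables (m : nat) (X : int -> 'I_m -> T -> R).
Hypothesis mX : forall t a, measurable_fun setT (X t a).
Hypothesis statX : strictly_stationary P X.
Hypothesis L2X : forall t a, L2 P (X t a).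

Definition cent (t : int) (a : 'I_m) (x : T) : R := X t a x - mean P X a.

Lemma Ex_prod_shift n (tt : 'I_n -> int) (aa : 'I_n -> 'I_m) (h : int) :
  itg P (fun x => \prod_(i < n) X (tt i + h) (aa i) x) ->
  itg P (fun x => \prod_(i < n) X (tt i) (aa i) x) ->
  Ex P (fun x => \prod_(i < n) X (tt i + h) (aa i) x) = Ex P (fun x => \prod_(i < n) X (tt i) (aa i) x).
Proof. by move=> i1 i2; apply: Ex_prod_eq => // B mB; exact: statX. Qed.

Lemma Ex_X t a : Ex P (X t a) = mean P X a.
Proof.
rewrite /mean ExE.
have e s x : X s a x = \prod_(i < 1) X s a x by rewrite big_ord1.
rewrite (eq_Ex _ (e t)) (eq_Ex _ (e 0)).
rewrite -[in LHS](add0r t); apply: (@Ex_prod_shift 1 (fun=> 0) (fun=> a) t);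
  by apply: eq_itg (e _) _; exact: L2_itg.
Qed.

Lemma L2_cent t a : L2 P (cent t a).
Proof. by apply: L2B => //; exact: L2_cst. Qed.

Lemma Ex_XX t t' a b : Ex P (fun x => X t a x * X t' b x) = Ex P (fun x => X (t - t') a x * X 0 b x).
Proof.
pose tt i := nth 0 [:: t - t'; 0] i; pose aa i := nth a [:: a; b] i.
have e s x : \prod_(i < 2) X (tt i + s) (aa i) x = X (t - t' + s) a x * X s b x.
  by rewrite !big_ord_recl big_ord0 mulr1 /tt/= add0r.
have e0 x : \prod_(i < 2) X (tt i) (aa i) x = X (t - t') a x * X 0 b x.
  by rewrite !big_ord_recl big_ord0 mulr1.
have := @Ex_prod_shift 2 (fun i => tt i) (fun i => aa i) t'.
rewrite (eq_Ex _ e0) (eq_Ex _ (e t')) subrK; apply.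
  by apply: eq_itg (fun x => esym (e t' x)) _; rewrite subrK; exact: L2M.
by apply: eq_itg (fun x => esym (e0 x)) _; exact: L2M.
Qed.

Lemma Ex_cent2E t t' a b : Ex P (fun x => cent t a x * cent t' b x) =
  Ex P (fun x => X t a x * X t' b x) - mean P X a * mean P X b.
Proof.
have -> : (fun x => cent t a x * cent t' b x) = (fun x => (X t a x * X t' b x - mean P X b * X t a x) -
    (mean P X a * X t' b x - mean P X a * mean P X b)).
  by apply/funext => x; rewrite /cent; ring.
have i1 := L2M (L2X t a) (L2X t' b).
have i2 := itgZ (mean P X b) (L2_itg (L2X t a)).
have i3 := itgZ (mean P X a) (L2_itg (L2X t' b)).
have i4 := itg_cst P (mean P X a * mean P X b).
rewrite (ExB (itgB i1 i2) (itgB i3 i4)) (ExB i1 i2) (ExB i3 i4) Ex_cst.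
rewrite !ExZ; [|exact: L2_itg|exact: L2_itg].
by rewrite !Ex_X; ring.
Qed.

Lemma Ex_cent2 t t' a b : Ex P (fun x => cent t a x * cent t' b x) = autocov P X a b (t - t').
Proof. by rewrite Ex_cent2E Ex_XX -Ex_cent2E /autocov ExE. Qed.

Lemma autocovN a b h : autocov P X a b (- h) = autocov P X b a h.
Proof.
rewrite -[in LHS](sub0r h) -[in RHS](subr0 h) -!Ex_cent2.
by apply: eq_Ex => x; rewrite mulrC.
Qed.

Lemma autocov_le a b h : `|autocov P X a b h| <= autocov P X a a 0 + autocov P X b b 0.
Proof.
have -> : autocov P X a b h = Ex P (fun x => cent h a x * cent 0 b x) by rewrite Ex_cent2 subr0.
have -> : autocov P X a a 0 = Ex P (fun x => cent h a x * cent h a x) by rewrite Ex_cent2 subrr.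
have -> : autocov P X b b 0 = Ex P (fun x => cent 0 b x * cent 0 b x) by rewrite Ex_cent2 subrr.
have i1 := L2M (L2_cent h a) (L2_cent 0 b).
have i2 := L2M (L2_cent h a) (L2_cent h a).
have i3 := L2M (L2_cent 0 b) (L2_cent 0 b).
rewrite -(ExD i2 i3); apply: le_trans (le_abs_Ex i1) _; apply: le_Ex.
- exact: itg_abs.
- exact: itgD.
move=> x; rewrite ler_norml; have := sqr_ge0 (cent h a x - cent 0 b x).
have := sqr_ge0 (cent h a x + cent 0 b x); have := sqr_ge0 (cent h a x); have := sqr_ge0 (cent 0 b x).
by move=> *; apply/andP; split; nra.
Qed.

(** The coefficient of cos(h w) in 2 pi times the real part of the spectral density: the lags h and
    -h share this cosine, and lag 0 counts once. *)
Definition evencov a b (h : nat) : R :=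
  if h == 0%N then autocov P X a b 0 else autocov P X a b h%:Z + autocov P X a b (- h%:Z).

Lemma spec_ps_reE a b w N :
  spec_ps_re P X a b w N = \sum_(h < N.+1) evencov a b h * cos (h%:R * w).
Proof.
rewrite /spec_ps_re.
pose F (i : int) := cos (w * i%:~R) * autocov P X a b i.
transitivity (F 0 + \sum_(h < N) (F h.+1%:Z + F (- h.+1%:Z))); last first.
  rewrite big_ord_recl/= /F /evencov/= mulr0 mul0r mulrC; congr (_ * _ + _).
  apply: eq_bigr => h _; rewrite /bump/= add1n mulrDl intrN mulrN cosN.
  by rewrite -pmulrn [h.+1%:R * w]mulrC; ring.
exact: (sum_symmetric_range F).
Qed.

Lemma evencov_series a b w : spec_well_defined P X ->
  (fun N => \sum_(h < N) evencov a b h * cos (h%:R * w)) @ \oo --> 2 * pi * fre P X a b w.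
Proof.
move=> wd; have [cv _] := wd a b w.
rewrite -cvg_shiftS.
have -> : 2 * pi * fre P X a b w = limn (spec_ps_re P X a b w).
  by rewrite /fre mulrA divff ?mul1r// gt_eqF// mulr_gt0// pi_gt0.
have e : spec_ps_re P X a b w = (fun N => \sum_(h < N.+1) evencov a b h * cos (h%:R * w)).
  by apply/funext => N; rewrite spec_ps_reE.
by move: cv; rewrite e.
Qed.

Lemma evencov_bound a b : assumptionA P 4 X ->
  exists2 C, 0 <= C & forall h, (0 < h)%N -> `|evencov a b h| <= C / h%:R ^+ 2.
Proof.
move=> [wd cp]; have [[der cont] _] := cp a b.
have hB h : `|evencov a b h| <= 2 * (autocov P X a a 0 + autocov P X b b 0).
  have A0 : 0 <= autocov P X a a 0 + autocov P X b b 0 by exact: le_trans (autocov_le a b 0).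
  rewrite /evencov; case: ifP => _; first by have := autocov_le a b 0; lra.
  apply: (le_trans (ler_normD _ _)).
  have := autocov_le a b h%:Z; have := autocov_le a b (- h%:Z); lra.
pose g := fre P X a b.
have isd i x : (i < 4)%N -> is_derive x (1 : R) (derive1n i g) (derive1n i.+1 g x).
  by move=> i4; rewrite /= derive1E; apply/derivableP; exact: der.
have isd2 i x : (i < 4)%N -> is_derive x (1 : R) (fun y => 2 * pi * derive1n i g y) (2 * pi * derive1n i.+1 g x).
  move=> i4; exact: (@is_deriveZ _ _ _ (derive1n i g) (2 * pi) x 1 _ (isd i x i4)).
have c2 : continuous (fun y => 2 * pi * derive1n 2 g y).
  move=> y; apply: cvgMl_tmp; apply: differentiable_continuous.
  by apply/derivable1_diffP; exact: der.
have [C hC] := cos_series_coef_quadratic hB (fun w => @evencov_series a b w wd)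
  (fun z => isd2 0%N z isT) (fun z => isd2 1%N z isT) c2.
exists (Num.max C 0); first by rewrite le_max lexx orbT.
move=> h h0; apply: (le_trans (hC h h0)); rewrite ler_wpM2r ?invr_ge0 ?sqr_ge0//.
by rewrite le_max lexx.
Qed.

End SecondOrder.

(** * Equicontinuity of the partial sums and Cesaro means *)

Section MeanConvergence.
Context {R : realType}.

Lemma sum_inv_sqr_le (p q : nat) : (0 < p)%N -> \sum_(p <= h < q) (h%:R ^+ 2)^-1 <= 2 / p%:R :> R.
Proof.
move=> p0; have [qp|pq] := leqP q p; first by rewrite big_geq// divr_ge0.
apply: (@le_trans _ _ (\sum_(p <= h < q) (- (2 / h.+1%:R) - - (2 / h%:R)))).
  rewrite big_nat [leRHS]big_nat; apply: ler_sum => h /andP[ph _].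
  have h0 : 0 < h%:R :> R by rewrite ltr0n (leq_trans p0).
  have h1 : 1 <= h%:R :> R by rewrite ler1n (leq_trans p0).
  have -> : - (2 / h.+1%:R) - - (2 / h%:R) = 2 / (h%:R * (h%:R + 1)) :> R.
    by rewrite -[h.+1%:R]natr1; field; rewrite !gt_eqF// ltr_wpDl// ltW.
  rewrite -[2]invrK -invfM lef_pV2 ?posrE ?mulr_gt0 ?exprn_gt0 ?addr_gt0//.
  by nra.
rewrite telescope_sumr ?(ltnW pq)// opprK addrC lerBlDr lerDl divr_ge0//.
Qed.

Lemma cos_lipschitz (x y : R) : `|cos x - cos y| <= `|x - y|.
Proof.
wlog xy : x y / y < x.
  move=> h; have [lt|lt|->] := ltgtP x y; last by rewrite !subrr.
    by rewrite distrC [leRHS]distrC; exact: h.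
  exact: h.
have [|z _ e] := @MVT R cos (fun z => - sin z) y x xy (fun z _ => is_derive_cos z).
  by apply: continuous_subspaceT => z; exact: continuous_cos.
by rewrite e normrM normrN ler_piMl// sin_max.
Qed.

(** Terms of low order are Lipschitz in the frequency and the others are summably small. Uniformity
    in N matters because the Cesaro means involve partial sums of every order. *)
Lemma cos_series_equicontinuous (al : nat -> R) (C e : R) : 0 <= C -> 0 < e ->
  (forall h, (0 < h)%N -> `|al h| <= C / h%:R ^+ 2) ->
  exists2 del, 0 < del & forall w w' N, `|w - w'| <= del ->
    `|\sum_(h < N) al h * cos (h%:R * w) - \sum_(h < N) al h * cos (h%:R * w')| <= e.
Proof.
move=> C0 e0 alC.
(* The tail is at most 2 C times the sum of 1/h^2 from H on, hence at most 4 C / H <= e/2. *)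
pose H := (Num.truncn (8 * C / e)).+1.
have He : 4 * C / H%:R <= e / 2.
  have /andP[_ /ltW h] := truncn_itv (divr_ge0 (mulr_ge0 (ler0n _ 8) C0) (ltW e0)).
  rewrite ler_pdivrMr ?ltr0n// /H; move: h; rewrite ler_pdivrMr//.
  by move: ((Num.truncn (8 * C / e)).+1%:R) => y; lra.
have H0 : 0 < H%:R :> R by rewrite ltr0n.
(* Each of the H head terms is at most (C / h^2) (h del) <= C del, so together they stay below
   e/2. *)
pose del := e / (2 * (C + 1) * H%:R).
have d0 : 0 < del by rewrite divr_gt0// !mulr_gt0// ltr_wpDl.
exists del => // w w' N ww.
rewrite -sumrB; apply: (le_trans (ler_norm_sum _ _ _)).
pose f h := `|al h * cos (h%:R * w) - al h * cos (h%:R * w')|.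
have f0 h : 0 <= f h by exact: normr_ge0.
have fE h : f h = `|al h| * `|cos (h%:R * w) - cos (h%:R * w')| by rewrite /f -mulrBr normrM.
apply: (@le_trans _ _ (\sum_(0 <= h < maxn N H) f h)).
  rewrite -(big_mkord xpredT f) [leRHS](@big_cat_nat _ _ _ N 0 (maxn N H))//= ?leq_maxl//.
  by rewrite lerDl sumr_ge0.
rewrite (@big_cat_nat _ _ _ H 0 (maxn N H))//= ?leq_maxr//.
have -> : e = e / 2 + e / 2 by field.
apply: lerD.
  apply: (@le_trans _ _ (\sum_(0 <= h < H) C * del)).
    rewrite big_nat [leRHS]big_nat; apply: ler_sum => h _; rewrite fE.
    have [->|h0] := posnP h; first by rewrite !mul0r subrr normr0 mulr0 mulr_ge0// ltW.
    have hr : 0 < h%:R :> R by rewrite ltr0n.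
    have h1 : 1 <= h%:R :> R by rewrite ler1n.
    apply: (@le_trans _ _ (C / h%:R ^+ 2 * (h%:R * del))).
      apply: ler_pM => //; first exact: alC.
      apply: le_trans (cos_lipschitz _ _) _.
      by rewrite -mulrBr normrM (gtr0_norm hr) ler_wpM2l// ltW.
    have -> : C / h%:R ^+ 2 * (h%:R * del) = C * del / h%:R by field; rewrite gt_eqF.
    by rewrite ler_pdivrMr// ler_peMr// mulr_ge0// ltW.
  rewrite big_mkord sumr_const card_ord -[_ *+ H]mulr_natl /del.
  have -> : H%:R * (C * (e / (2 * (C + 1) * H%:R))) = (C / (C + 1)) * (e / 2).
    by field; rewrite !gt_eqF// ltr_wpDl.
  rewrite ler_piMl//; first by rewrite divr_ge0// ltW.
  by rewrite ler_pdivrMr ?ltr_wpDl// mul1r lerDl.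
apply: le_trans He; apply: (@le_trans _ _ (\sum_(H <= h < maxn N H) 2 * C * (h%:R ^+ 2)^-1)).
  rewrite big_nat [leRHS]big_nat; apply: ler_sum => h /andP[Hh _]; rewrite fE.
  have h0 : (0 < h)%N by exact: leq_trans Hh.
  have -> : 2 * C * (h%:R ^+ 2)^-1 = C / h%:R ^+ 2 * 2 by ring.
  apply: ler_pM => //; first exact: alC.
  have := cos_max (h%:R * w); have := cos_max (h%:R * w').
  by move=> c1 c2; apply: le_trans (ler_normB _ _) _; clear -c1 c2; lra.
rewrite -mulr_sumr.
have -> : 4 * C / H%:R = 2 * C * (2 / H%:R) by ring.
by rewrite ler_wpM2l ?mulr_ge0//; exact: sum_inv_sqr_le.
Qed.

(** Passing from n to n + 1 adds one row and one column of the array, whose entries at opposite lags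
    pair up into one symmetric partial sum. Division by n then yields a Cesaro mean. *)
Lemma sum_toeplitz (F : int -> R) n :
  \sum_(t < n) \sum_(t' < n) F (t%:Z - t'%:Z) =
  \sum_(t < n) \sum_(h < t.+1) (if h == 0%N :> nat then F 0 else F h%:Z + F (- h%:Z)).
Proof.
elim: n => [|n IH]; first by rewrite !big_ord0.
rewrite [RHS]big_ord_recr/= -IH big_ord_recr/=.
under eq_bigr do rewrite big_ord_recr/=.
rewrite big_split/= -addrA; congr (_ + _).
rewrite big_ord_recr/= subrr big_ord_recl/= addrA addrC; congr (_ + _).
rewrite -big_split/= [RHS](reindex_inj rev_ord_inj)/=; apply: eq_bigr => t _.
rewrite /bump/= addrC; have := ltn_ord t => tn.
by congr (F _ + F _); lia.
Qed.

End MeanConvergence.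

(** * Reduction of consistency to a first-moment concentration bound *)

Section Consistency.
Context {R : realType} {d : measure_display} {T : measurableType d}.
Variable P : probability T R.
Variables (m : nat) (X : int -> 'I_m -> T -> R).
Hypothesis mX : forall t a, measurable_fun setT (X t a).
Hypothesis statX : strictly_stationary P X.
Hypothesis L2X : forall t a, L2 P (X t a).
Variables j k : 'I_m.

(* The representation of the estimator [ftilde] as a quadratic form: [s.2]
   selects the cosine or the sine transform at the [s.1]-th frequency. *)
Definition fourier_form n M a (c : 'I_M -> R) (x : T) : R :=
  \sum_(s : 'I_M * bool) wfreq n c s *
    ((\sum_(t < n) trig_fourier n a s.1 s.2 t * cent P X t.+1%:Z j x) *
     (\sum_(t < n) trig_fourier n a s.1 s.2 t * cent P X t.+1%:Z k x)).

(** The interface with the two cases of assumption B. The constant may depend on the law of [X] and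
    on [C], but not on n, M, a, c or delta; the first absolute moment is used because it tolerates
    an approximation in L^1. *)
Definition fourier_form_concentration : Prop :=
  forall C : R, 0 < C -> exists2 K : R, 0 <= K & forall n M a (c : 'I_M -> R),
    (a + M <= n)%N -> (0 < M)%N -> (forall i, `|c i| <= C / M%:R) ->
    forall delta : R, 0 < delta ->
    Ex P (fun x => `|fourier_form n a c x - Ex P (fourier_form n a c)|) <= delta + K / (M%:R * delta).

Let L2_dft n (E : 'I_n -> R) b : L2 P (fun x => \sum_(t < n) E t * cent P X t.+1%:Z b x).
Proof. by apply: L2_sum => t _; apply: L2Z; exact: L2_cent. Qed.

Lemma itg_fourier_form n M a (c : 'I_M -> R) : itg P (fourier_form n a c).
Proof. by apply: itg_sum => s _; apply: itgZ; apply: L2M; exact: L2_dft. Qed.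

Lemma Ex_dft2 n (E E' : 'I_n -> R) a b :
  Ex P (fun x => (\sum_(t < n) E t * cent P X t.+1%:Z a x) * (\sum_(t < n) E' t * cent P X t.+1%:Z b x)) =
  \sum_(t < n) \sum_(t' < n) E t * E' t' * autocov P X a b (t%:Z - t'%:Z).
Proof.
rewrite Ex_bilinear; last by move=> *; apply: L2M; exact: L2_cent.
apply: eq_bigr => t _; apply: eq_bigr => t' _; rewrite Ex_cent2//; congr (_ * autocov _ _ _ _ _).
lia.
Qed.

Lemma Ex_fourier_form n M a (c : 'I_M -> R) :
  Ex P (fourier_form n a c) = \sum_(i < M) c i * ((2 * pi)^-1 *
    (n%:R^-1 * \sum_(t < n) \sum_(h < t.+1) evencov P X j k h * cos (h%:R * fourier_freq n (a + i)%N%:Z))).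
Proof.
rewrite /fourier_form Ex_sum; last by move=> s _; apply: itgZ; apply: L2M; exact: L2_dft.
rewrite -(pair_bigA _ (fun (i : 'I_M) (p : bool) => Ex P (fun x => wfreq n c (i, p) *
    ((\sum_(t < n) trig_fourier n a i p t * cent P X t.+1%:Z j x) *
     (\sum_(t < n) trig_fourier n a i p t * cent P X t.+1%:Z k x)))))/=.
apply: eq_bigr => i _; rewrite big_bool/= !ExZ; try by apply: L2M; exact: L2_dft.
rewrite !Ex_dft2 /wfreq/= -mulrDr -big_split/=.
have -> : (2 * pi)^-1 / n%:R * c i = c i * ((2 * pi)^-1 * n%:R^-1) :> R by ring.
rewrite -!mulrA; do 3 congr (_ * _).
pose w : R := fourier_freq n (a + i)%N%:Z.
pose F (h : int) : R := cos (w * h%:~R) * autocov P X j k h.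
transitivity (\sum_(t < n) \sum_(t' < n) F (t%:Z - t'%:Z)).
  apply: eq_bigr => t _; rewrite -big_split/=; apply: eq_bigr => t' _.
  rewrite -mulrDl /F; congr (_ * _); rewrite /trig_fourier/= -/w.
  have -> : w * (t%:Z - t'%:Z)%:~R = w * t.+1%:R - w * t'.+1%:R.
    by rewrite intrB -!pmulrn -[t.+1%:R]natr1 -[t'.+1%:R]natr1; ring.
  by rewrite cosB.
rewrite sum_toeplitz; apply: eq_bigr => t _; apply: eq_bigr => h _.
rewrite /evencov -/w /F; case: eqP => [->|_]; first by rewrite !mulr0 mul0r mulrC.
by rewrite intrN mulrN cosN -pmulrn [h%:R * w]mulrC; ring.
Qed.

Lemma Ex_fourier_form_cvg (theta C e : R) : assumptionA P 4 X -> 0 <= C -> 0 < e ->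
  exists2 del, 0 < del & exists n0, forall n M a (c : 'I_M -> R), (n0 <= n)%N ->
    \sum_i c i = 1 -> \sum_i `|c i| <= C ->
    (forall i : 'I_M, `|fourier_freq n (a + i)%N%:Z - theta| <= del) ->
    `|Ex P (fourier_form n a c) - fre P X j k theta| <= e.
Proof.
move=> aX C0 e0.
have [A A0 hA] := evencov_bound mX statX L2X j k aX.
(* Each ordinate has two errors of size eta, from moving the frequency to theta and from the Cesaro
   limit, and the factor 1/(2 pi) <= 1/2 reduces their sum to eta. The weights then contribute at
   most C. *)
pose eta := e / (C + 1).
have eta0 : 0 < eta by rewrite divr_gt0// ltr_wpDl.
have [del del0 hdel] := cos_series_equicontinuous A0 eta0 hA.
exists del => //.
pose s t w := \sum_(h < t.+1) evencov P X j k h * cos (h%:R * w).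
have cs : (fun t => s t theta) @ \oo --> 2 * pi * fre P X j k theta.
  by have := @evencov_series _ _ _ P m X j k theta (proj1 aX); rewrite -cvg_shiftS.
have [n0 _ hn0] : \forall n \near \oo,
    `|2 * pi * fre P X j k theta - n.+1%:R^-1 * \sum_(t < n.+1) s t theta| <= eta.
  have := @cesaro _ _ _ cs; move/cvgrPdist_le => /(_ _ eta0); apply: filterS => n.
  by rewrite /arithmetic_mean /series/= big_mkord.
exists n0.+1 => -[//|n] M a c nn c1 cC hw.
have -> : fre P X j k theta = \sum_i c i * fre P X j k theta by rewrite -mulr_suml c1 mul1r.
rewrite Ex_fourier_form -sumrB.
apply: (le_trans (ler_norm_sum _ _ _)).
apply: (@le_trans _ _ (\sum_(i < M) `|c i| * eta)); last first.
  rewrite -mulr_suml; apply: (@le_trans _ _ (C * eta)); first by rewrite ler_wpM2r// ltW.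
  by rewrite /eta mulrCA ler_piMr ?(ltW e0)// ler_pdivrMr ?ltr_wpDl// mul1r lerDl.
apply: ler_sum => i _; rewrite -mulrBr normrM ler_wpM2l//.
have pi0 := @pi_gt0 R; have pi2 := @pi_ge2 R.
have -> : (2 * pi)^-1 * (n.+1%:R^-1 * \sum_(t < n.+1) \sum_(h < t.+1) evencov P X j k h *
      cos (h%:R * fourier_freq n.+1 (a + i)%N%:Z)) - fre P X j k theta =
    (2 * pi)^-1 * (n.+1%:R^-1 * \sum_(t < n.+1) (s t (fourier_freq n.+1 (a + i)%N%:Z) - s t theta) -
     (2 * pi * fre P X j k theta - n.+1%:R^-1 * \sum_(t < n.+1) s t theta)).
  rewrite sumrB; move: (\sum_(t < n.+1) s t theta) => u.
  rewrite -/(\sum_(t < n.+1) s t (fourier_freq n.+1 (a + i)%N%:Z)).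
  move: (\sum_(t < n.+1) _) (n.+1%:R^-1 : R) => v w.
  have pi2' : 2 * pi != 0 :> R by rewrite gt_eqF// mulr_gt0.
  by rewrite [in RHS]mulrBr [X in _ = _ - X]mulrBr [(2 * pi)^-1 * (2 * pi * _)]mulrA mulVf// mul1r mulrBr mulrBr; ring.
rewrite normrM ger0_norm ?invr_ge0 ?mulr_ge0 ?(ltW pi0)//.
rewrite ler_pdivrMl ?mulr_gt0//; apply: (@le_trans _ _ (eta + eta)); last by nra.
apply: (le_trans (ler_normB _ _)); apply: lerD; last exact: hn0.
rewrite normrM ger0_norm ?invr_ge0// ler_pdivrMl//.
apply: (le_trans (ler_norm_sum _ _ _)).
apply: (@le_trans _ _ (\sum_(t < n.+1) eta)); last by rewrite sumr_const card_ord mulr_natl.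
by apply: ler_sum => t _; exact: hdel.
Qed.

Lemma cvge0_squeeze (u : nat -> \bar R) : (forall n, (0 <= u n)%E) ->
  (forall e : R, 0 < e -> \forall n \near \oo, (u n <= e%:E)%E) -> u @ \oo --> 0%E.
Proof.
move=> u0 ue; apply/fine_cvgP; split.
  apply: filterS (ue 1 ltr01) => n h; rewrite ge0_fin_numE//.
  by apply: le_lt_trans h _; rewrite ltry.
apply/cvgrPdist_le => e e0; apply: filterS (ue e e0) => n h.
rewrite sub0r normrN ger0_norm ?fine_ge0// -lee_fin fineK// ge0_fin_numE//.
by apply: le_lt_trans h _; rewrite ltry.
Qed.

Lemma fourier_form_consistency (theta : R) (M : nat -> nat) :
  assumptionA P 4 X -> (theta = 0 \/ theta = pi) ->
  ((fun n => (M n)%:R : R) @ \oo --> +oo) ->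
  ((fun n => (M n)%:R / n%:R : R) @ \oo --> 0) ->
  fourier_form_concentration ->
  forall eps : R, 0 < eps ->
  (fun n => P [set w | eps < `|ftilde X n (M n) theta j k w - fre P X j k theta|]) @ \oo --> 0%E.
Proof.
move=> aX th Moo Mn0 var eps eps0.
apply: cvge0_squeeze => [n|e e0]; first exact: measure_ge0.
have [C [C0 ols]] := @ols_weights R.
have [K K0 hK] := var C C0.
(* Markov's inequality divides by eps; the three shares are delta, K / (M delta) and the bias. *)
pose e1 := eps * e / 3.
have e10 : 0 < e1 by rewrite divr_gt0// mulr_gt0.
have [del del0 [n0 hn0]] := Ex_fourier_form_cvg theta aX (ltW C0) e10.
have pi0 := @pi_gt0 R.
near=> n.
have M2 : 2 <= (M n)%:R :> R by near: n; move/cvgryPge : Moo; apply.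
have MK : K / (e1 * e1) <= (M n)%:R by near: n; move/cvgryPge : Moo; apply.
have nn0 : (n0 <= n)%N by near: n; exact: nbhs_infty_ge.
have n0' : (0 < n)%N by near: n; exact: nbhs_infty_gt.
have nr : 0 < n%:R :> R by rewrite ltr0n.
(* The bound 1/2 gives 2 M <= n for the regression weights; the other keeps all frequencies within
   [del] of theta. *)
have Mn : `|(M n)%:R / n%:R| <= Num.min (2^-1) (del / (2 * pi)) :> R.
  near: n; have mp : 0 < Num.min (2^-1) (del / (2 * pi)) by rewrite lt_min invr_gt0 ltr0n/= divr_gt0 ?mulr_gt0.
  by move/cvgrPdist_le : Mn0 => /(_ _ mp); apply: filterS => n; rewrite sub0r normrN.
move: Mn; rewrite ger0_norm ?divr_ge0// le_min => /andP[Mn1 Mn2].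
have {}M2 : (2 <= M n)%N by rewrite -(ler_nat R).
have Mr : 0 < (M n)%:R :> R by rewrite ltr0n (leq_trans _ M2).
have {}Mn1 : (2 * M n <= n)%N.
  by rewrite -(ler_nat R) natrM; move: Mn1; rewrite ler_pdivrMr//; lra.
have [a [c [a0 aM c1 cC [wth ft]]]] := ols n (M n) theta M2 Mn1 th.
have fQ x : ftilde X n (M n) theta j k x = fourier_form n a c x.
  rewrite ft /fourier_form -(pair_bigA _ (fun (i : 'I_(M n)) (p : bool) => wfreq n c (i, p) *
    ((\sum_(t < n) trig_fourier n a i p t * cent P X t.+1%:Z j x) *
     (\sum_(t < n) trig_fourier n a i p t * cent P X t.+1%:Z k x))))/=.
  apply: eq_bigr => i _.
  rewrite (perio_re_fourier X j k (mean P X j) (mean P X k)); last first.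
    by have il := ltn_ord i; clear -a0 aM il; lia.
  rewrite big_bool /wfreq/= /trig_fourier/= /cent.
  have e5 f b (mu : R) : \sum_(t < n) (X t.+1%:Z b x - mu) * f (fourier_freq n (a + i)%N%:Z * t.+1%:R) =
     \sum_(t < n) f (fourier_freq n (a + i)%N%:Z * t.+1%:R) * (X t.+1%:Z b x - mu) :> R.
    by apply: eq_bigr => t _; rewrite mulrC.
  by rewrite !e5; ring.
under eq_set do rewrite fQ.
have iQ := itg_fourier_form n a c.
have iQf : itg P (fun x => fourier_form n a c x - fre P X j k theta).
  by apply: itgB => //; exact: itg_cst.
apply: le_trans (markov_Ex iQf eps0) _; rewrite lee_fin ler_pdivrMl//.
have cC' : \sum_i `|c i| <= C.
  apply: (le_trans (ler_sum _ (fun i _ => cC i))).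
  by rewrite sumr_const card_ord -[_ *+ M n]mulr_natl mulrCA divff ?mulr1// gt_eqF.
have hw (i : 'I_(M n)) : `|fourier_freq n (a + i)%N%:Z - theta| <= del.
  apply: (le_trans (wth i)); move: Mn2; rewrite ler_pdivlMr ?mulr_gt0// => h.
  by apply: le_trans h; rewrite le_eqVlt; apply/orP; left; apply/eqP; ring.
have h1 := hn0 n (M n) a c nn0 c1 cC' hw.
have h2 := hK n (M n) a c aM (leq_trans (isT : (0 < 2)%N) M2) cC _ e10.
have h3 : K / ((M n)%:R * e1) <= e1.
  rewrite ler_pdivrMr ?mulr_gt0//; move: MK; rewrite ler_pdivrMr ?mulr_gt0//.
  by move=> h; apply: le_trans h _; rewrite le_eqVlt; apply/orP; left; apply/eqP; ring.
have iQE : itg P (fun x => fourier_form n a c x - Ex P (fourier_form n a c)).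
  by apply: itgB => //; exact: itg_cst.
apply: (@le_trans _ _ (Ex P (fun x => `|fourier_form n a c x - Ex P (fourier_form n a c)| + e1))).
  apply: le_Ex; first exact: itg_abs.
    by apply: itgD; [exact: itg_abs|exact: itg_cst].
  move=> x; have -> : fourier_form n a c x - fre P X j k theta =
    (fourier_form n a c x - Ex P (fourier_form n a c)) + (Ex P (fourier_form n a c) - fre P X j k theta) by ring.
  by apply: (le_trans (ler_normD _ _)); rewrite lerD2l.
rewrite ExD ?Ex_cst; [|exact: itg_abs|exact: itg_cst].
have -> : eps * e = e1 + e1 + e1 by rewrite /e1; field.
lra.
Unshelve. all: by end_near.
Qed.

End Consistency.

(** * Cumulants *)

Section PartitionCodes.

(** The index in the list of values is the first point with the same value, so the code depends only
    on which values coincide. *)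
Definition kernel_code {r : nat} {U : eqType} (phi : 'I_r -> U) : seq nat :=
  [seq index (phi i) (codom phi) | i <- enum 'I_r].

Lemma nth_kernel_code (r : nat) (U : eqType) (phi : 'I_r -> U) (i : 'I_r) :
  nth 0%N (kernel_code phi) i = index (phi i) (codom phi).
Proof. by rewrite (nth_map i) ?size_enum_ord// nth_ord_enum. Qed.

Lemma nth_codom_ord (r : nat) (U : eqType) (phi : 'I_r -> U) (i : 'I_r) x0 :
  nth x0 (codom phi) i = phi i.
Proof. by rewrite (nth_map i) ?size_enum_ord// nth_ord_enum. Qed.

Lemma kernel_codeE (r : nat) (U : eqType) (phi : 'I_r -> U) (i j : 'I_r) :
  (nth 0 (kernel_code phi) i == nth 0 (kernel_code phi) j)%N = (phi i == phi j).
Proof.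
rewrite !nth_kernel_code; apply/eqP/eqP => [h|-> //].
have := nth_index (phi i) (codom_f phi i); rewrite h nth_index ?codom_f// => ->//.
Qed.

Lemma eq_kernel_code (r : nat) (U V : eqType) (phi : 'I_r -> U) (psi : 'I_r -> V) :
  (forall i j, (phi i == phi j) = (psi i == psi j)) -> kernel_code phi = kernel_code psi.
Proof.
move=> h; apply: eq_map => i.
rewrite /codom /image_mem; elim: (enum _) => //= a s IH.
by rewrite h IH.
Qed.

Definition code_partition (r : nat) (l : seq nat) : {set {set 'I_r}} :=
  preim_partition (fun i : 'I_r => nth 0%N l i) [set: 'I_r].

Lemma code_partition_kernel r (Q : {set {set 'I_r}}) : finset.partition Q [set: 'I_r] ->
  code_partition r (kernel_code (finset.pblock Q)) = Q.
Proof.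
move=> pQ; rewrite -[RHS](preim_partition_pblock pQ)/= /code_partition.
rewrite /preim_partition; apply: eq_in_imset => i _.
by apply/setP => j; rewrite !inE/= kernel_codeE.
Qed.

Lemma kernel_code_partition r (l : seq nat) :
  kernel_code (finset.pblock (code_partition r l)) = kernel_code (fun i : 'I_r => nth 0%N l i).
Proof.
apply: eq_kernel_code => i j.
have pp := preim_partitionP (fun i : 'I_r => nth 0%N l i) [set: 'I_r].
have [/eqP cP tI _] := and3P pp.
rewrite eq_pblock ?cP ?inE//.
by rewrite /code_partition /preim_partition pblock_equivalence_partition ?inE//;
  split => // /eqP ->.
Qed.

(* Partitions of ['I_r] are encoded by the map sending each point to the least
   element of its block; such codes can be enumerated explicitly. *)
Definition min_code (r : nat) (l : seq nat) : bool :=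
  (size l == r) && all (fun i => (nth 0 l i <= i)%N && (nth 0 l (nth 0 l i) == nth 0 l i)%N) (iota 0 r).

Lemma min_code_kernel r (U : eqType) (phi : 'I_r -> U) : min_code r (kernel_code phi).
Proof.
rewrite /min_code size_map size_enum_ord eqxx /=; apply/allP => i.
rewrite mem_iota add0n => /= ir; pose i' := Ordinal ir.
have := nth_kernel_code phi i'; rewrite /= => ->.
have le : (index (phi i') (codom phi) <= i)%N.
  rewrite leqNgt; apply/negP => h.
  by have := before_find (phi i') h; rewrite /= (nth_codom_ord phi i') eqxx.
rewrite le /=.
have lr := leq_ltn_trans le ir.
have := nth_kernel_code phi (Ordinal lr); rewrite /= => ->.
have <- : phi i' = phi (Ordinal lr).
  by rewrite -(nth_codom_ord phi (Ordinal lr) (phi i'))/= nth_index ?codom_f.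
by [].
Qed.

Lemma kernel_code_min r (l : seq nat) : min_code r l ->
  kernel_code (fun i : 'I_r => nth 0%N l i) = l.
Proof.
move=> /andP[/eqP sl /allP h]; apply: (@eq_from_nth _ 0%N).
  by rewrite size_map size_enum_ord.
move=> i; rewrite size_map size_enum_ord => ir.
have hi (k : nat) : (k < r)%N -> (nth 0 l k <= k)%N /\ nth 0%N l (nth 0%N l k) = nth 0%N l k.
  by move=> kr; have /(_ _)/andP[|? /eqP] := h k; rewrite ?mem_iota.
have := nth_kernel_code (fun i : 'I_r => nth 0%N l i) (Ordinal ir); rewrite /= => ->.
have [le e] := hi _ ir; have lr := leq_ltn_trans le ir.
set c := codom _.
have nc (k : nat) : (k < r)%N -> nth 0%N c k = nth 0%N l k.
  by move=> kr; rewrite (nth_codom_ord _ (Ordinal kr)).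
have cin : nth 0%N l i \in c.
  by rewrite -(nc _ ir) mem_nth// size_codom card_ord.
have ix : (index (nth 0%N l i) c < r)%N by move: cin; rewrite -index_mem size_codom card_ord.
have e2 : nth 0%N l (index (nth 0%N l i) c) = nth 0%N l i by rewrite -nc// nth_index.
apply/eqP; rewrite eqn_leq; apply/andP; split; last first.
  by rewrite -e2; have [+ _] := hi _ ix; rewrite e2.
rewrite leqNgt; apply/negP => hlt.
have := before_find 0%N hlt.
by rewrite /= nc// e eqxx.
Qed.

(** Codes and partitions correspond bijectively, so a complete explicit list of codes turns a
    cumulant into a finite expression that can be unfolded. *)
Lemma sum_partition_codes (A : nmodType) r (L : seq (seq nat)) (F : {set {set 'I_r}} -> A) :
  uniq L -> all (min_code r) L -> (forall l, min_code r l -> l \in L) ->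
  \sum_(Q : {set {set 'I_r}} | finset.partition Q [set: 'I_r]) F Q =
  \sum_(l <- L) F (code_partition r l).
Proof.
move=> uL aL mL.
have kK l : l \in L -> kernel_code (finset.pblock (code_partition r l)) = l.
  by move=> lL; rewrite kernel_code_partition kernel_code_min//; exact: (allP aL).
rewrite -(big_map (code_partition r) predT F) [RHS]big_uniq; last first.
  rewrite map_inj_in_uniq// => l l' lL l'L e.
  by rewrite -(kK _ lL) -(kK _ l'L) e.
apply: eq_bigl => Q; apply/idP/mapP => [pQ|[l lL ->]]; last exact: preim_partitionP.
exists (kernel_code (finset.pblock Q)); last by rewrite code_partition_kernel.
exact/mL/min_code_kernel.
Qed.

Lemma code_partition_imset r (l : seq nat) : min_code r l ->
  code_partition r l =
  ((fun x : 'I_r => [set y : 'I_r | nth 0%N l y == x :> nat]) @: [set x : 'I_r | nth 0%N l x == x :> nat])%SET.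
Proof.
move=> /andP[/eqP sl /allP h]; apply/setP => B; apply/imsetP/imsetP => [[x _ ->]|[x + ->]].
- have := h x; rewrite mem_iota ltn_ord => /(_ isT)/andP[le e].
  exists (Ordinal (leq_ltn_trans le (ltn_ord x))); first by rewrite inE.
  by apply/setP => y; rewrite !inE eq_sym.
- rewrite inE => /eqP e; exists x; rewrite ?inE//.
  by apply/setP => y; rewrite !inE e eq_sym.
Qed.

Lemma code_partition_card r (l : seq nat) : min_code r l ->
  #|code_partition r l| = (\sum_(x < r | nth 0%N l x == x :> nat) 1)%N.
Proof.
move=> ml; rewrite code_partition_imset// card_in_imset ?sum1dep_card//.
move=> x y; rewrite !inE => /eqP ex /eqP ey /setP/(_ x); rewrite !inE ex eqxx.
by move=> /esym/eqP/val_inj.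
Qed.

Lemma code_partition_prod (A : comNzRingType) r (l : seq nat) (F : {set 'I_r} -> A) : min_code r l ->
  \prod_(B in code_partition r l) F B =
  \prod_(x < r | nth 0%N l x == x :> nat) F [set y : 'I_r | nth 0%N l y == x :> nat]%SET.
Proof.
move=> ml; rewrite code_partition_imset// big_imset/=.
  by apply: eq_bigl => x; rewrite inE.
move=> x y; rewrite !inE => /eqP ex /eqP ey /setP/(_ x); rewrite !inE ex eqxx.
by move=> /esym/eqP/val_inj.
Qed.

Definition codes2 : seq (seq nat) := [:: [:: 0; 0]; [:: 0; 1]]%N.

(** The 15 partitions of four points by block sizes: 4; 3+1, four times; 2+2, three times; 2+1+1,
    six times; all singletons. *)
Definition codes4 : seq (seq nat) :=
  [:: [:: 0; 0; 0; 0]; [:: 0; 1; 1; 1]; [:: 0; 1; 0; 0]; [:: 0; 0; 2; 0]; [:: 0; 0; 0; 3];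
      [:: 0; 0; 2; 2]; [:: 0; 1; 0; 1]; [:: 0; 1; 1; 0];
      [:: 0; 0; 2; 3]; [:: 0; 1; 0; 3]; [:: 0; 1; 2; 0]; [:: 0; 1; 1; 3]; [:: 0; 1; 2; 1];
      [:: 0; 1; 2; 2]; [:: 0; 1; 2; 3]]%N.

Lemma codes2P l : min_code 2 l -> l \in codes2.
Proof.
case: l => [|[|?] [|a [|? ?]]]//; rewrite /min_code/= !andbT.
by case: a => [|[|a]].
Qed.

Lemma codes4P l : min_code 4 l -> l \in codes4.
Proof.
case: l => [|[|?] [|a [|b [|c [|? ?]]]]]//; rewrite /min_code/= ?andbT.
by case: a => [|[|a]]//; case: b => [|[|[|b]]]//; case: c => [|[|[|[|c]]]].
Qed.

End PartitionCodes.

Section CumulantFormulas.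
Context {d} {T : measurableType d} {R : realType} (P : probability T R).

Definition part_moment (r : nat) (y : nat -> T -> R) (p : pred nat) : R :=
  Ex P (fun w => \prod_(i < r | p i) y i w).

Lemma cum_codes r (y : nat -> T -> R) (L : seq (seq nat)) :
  uniq L -> all (min_code r) L -> (forall l, min_code r l -> l \in L) ->
  cum P (fun i : 'I_r => y i) = \sum_(l <- L)
    (-1) ^+ (\sum_(x < r | nth 0%N l x == x :> nat) 1)%N.-1 *
    ((\sum_(x < r | nth 0%N l x == x :> nat) 1)%N.-1)`!%:R *
    \prod_(x < r | nth 0%N l x == x :> nat) part_moment r y (fun i => nth 0%N l i == x).
Proof.
move=> uL aL mL; rewrite /cum (sum_partition_codes _ uL aL mL) !big_seq.
apply: eq_bigr => l lL; have ml := allP aL _ lL.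
rewrite code_partition_card// (code_partition_prod _ ml).
congr (_ * _); apply: eq_bigr => x _; rewrite ExE /part_moment; apply: eq_Ex => w.
by apply: eq_bigl => i; rewrite inE.
Qed.

Lemma cum2E (y : nat -> T -> R) :
  cum P (fun i : 'I_2 => y i) = Ex P (fun w => y 0%N w * y 1%N w) - Ex P (y 0%N) * Ex P (y 1%N).
Proof.
rewrite (@cum_codes 2 y codes2)//; last exact: codes2P.
rewrite /codes2 !big_cons big_nil.
rewrite !(big_mkcond (fun x : 'I_2 => _ == _)) !big_ord_recl !big_ord0/= /bump/= !addr0 !mulr1.
rewrite ?(add0n, addn0) expr1 mul1r mulN1r /part_moment; congr (_ - _ * _); apply: eq_Ex => w;
 by rewrite big_mkcond/= !big_ord_recl !big_ord0/= /bump/= ?mulr1 ?mul1r.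
Qed.

(** All joint moments of at most four variables take this one shape, an absent variable being the
    constant 1, so that the identity below becomes polynomial. Rotation reduces centring in any slot
    to centring in the first. *)
Let E4 (f g h k : T -> R) : R := Ex P (fun w => f w * (g w * (h w * k w))).

Let E4_rot f g h k : E4 f g h k = E4 g h k f.
Proof. by apply: eq_Ex => w; ring. Qed.

Let E4_sub f c g h k : L4 P f -> L4 P g -> L4 P h -> L4 P k ->
  E4 (fun w => f w - c) g h k = E4 f g h k - c * E4 (fun=> 1) g h k.
Proof.
move=> Lf Lg Lh Lk; rewrite /E4.
have i1 : itg P (fun w => g w * (h w * k w)).
  by apply: L2M; [exact: L4_L2|exact: L4M].
have i2 : itg P (fun w => f w * (g w * (h w * k w))).
  apply: eq_itg (L2M (L4M Lf Lg) (L4M Lh Lk)) => w; ring.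
rewrite -ExZ; last by apply: eq_itg i1 => w; rewrite mul1r.
rewrite -ExB//; last by apply: itgZ; apply: eq_itg i1 => w; rewrite mul1r.
by apply: eq_Ex => w; ring.
Qed.

Let E4_sub1 f g c h k : L4 P f -> L4 P g -> L4 P h -> L4 P k ->
  E4 f (fun w => g w - c) h k = E4 f g h k - c * E4 f (fun=> 1) h k.
Proof. by move=> *; rewrite E4_rot E4_sub// -(E4_rot f g) -(E4_rot f (fun=> 1)). Qed.

Let E4_sub2 f g h c k : L4 P f -> L4 P g -> L4 P h -> L4 P k ->
  E4 f g (fun w => h w - c) k = E4 f g h k - c * E4 f g (fun=> 1) k.
Proof. by move=> *; rewrite E4_rot E4_sub1// -(E4_rot f g h) -(E4_rot f g (fun=> 1)). Qed.

Let E4_sub3 f g h k c : L4 P f -> L4 P g -> L4 P h -> L4 P k ->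
  E4 f g h (fun w => k w - c) = E4 f g h k - c * E4 f g h (fun=> 1).
Proof. by move=> *; rewrite E4_rot E4_sub2// -(E4_rot f g h k) -(E4_rot f g h (fun=> 1)). Qed.

Lemma part_moment4E (y : nat -> T -> R) (p : pred nat) : part_moment 4 y p =
  E4 (if p 0%N then y 0%N else fun=> 1) (if p 1%N then y 1%N else fun=> 1)
     (if p 2%N then y 2%N else fun=> 1) (if p 3%N then y 3%N else fun=> 1).
Proof.
apply: eq_Ex => w; rewrite big_mkcond/= !big_ord_recl !big_ord0/= /bump/= ?(add0n, addn0) mulr1.
by do 4 case: (p _).
Qed.

Let card4E (p : pred nat) : (\sum_(x < 4 | p x) 1)%N = (p 0 + p 1 + p 2 + p 3)%N.
Proof.
rewrite big_mkcond/= !big_ord_recl !big_ord0/= /bump/=.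
by do 4 case: (p _).
Qed.

Let prod4E (p : pred nat) (F : nat -> R) : \prod_(x < 4 | p x) F x =
  (if p 0%N then F 0%N else 1) * ((if p 1%N then F 1%N else 1) *
  ((if p 2%N then F 2%N else 1) * (if p 3%N then F 3%N else 1))).
Proof. by rewrite big_mkcond/= !big_ord_recl !big_ord0/= /bump/= ?(add0n, addn0) mulr1. Qed.

(** A fourth cumulant is unchanged by centring, and for centred variables only partitions without
    singletons matter: the full block and the three pairings. The proof expands both sides. *)
Lemma Ex_centered4 (y : nat -> T -> R) : (forall i, L4 P (y i)) ->
  let c i := Ex P (y i) in
  let g i i' := Ex P (fun w => (y i w - c i) * (y i' w - c i')) in
  Ex P (fun w => (y 0%N w - c 0%N) * ((y 1%N w - c 1%N) * ((y 2%N w - c 2%N) * (y 3%N w - c 3%N)))) =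
  cum P (fun i : 'I_4 => y i) + g 0%N 1%N * g 2%N 3%N + g 0%N 2%N * g 1%N 3%N + g 0%N 3%N * g 1%N 2%N.
Proof.
move=> Ly c g.
have Lc i : L4 P (fun w => y i w - c i) by apply: L4B => //; exact: L4_cst.
have L1 := L4_cst P 1.
have gE i i' : g i i' = Ex P (fun w => y i w * y i' w) - c i * c i'.
  have iy i0 := L2_itg (L4_L2 (Ly i0)).
  have i1 := L2M (L4_L2 (Ly i)) (L4_L2 (Ly i')).
  have i2 := itgZ (c i') (iy i); have i3 := itgZ (c i) (iy i').
  have -> : g i i' = Ex P (fun w => (y i w * y i' w - c i' * y i w) - (c i * y i' w - c i * c i')).
    by apply: eq_Ex => w; ring.
  have i4 := itg_cst P (c i * c i').
  rewrite (ExB (itgB i1 i2) (itgB i3 i4)) (ExB i1 i2) (ExB i3 i4) Ex_cst !ExZ//.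
  by rewrite /c; ring.
rewrite !gE.
rewrite (@cum_codes 4 y codes4)//; last exact: codes4P.
under eq_bigr => l _ do rewrite (card4E (fun i => nth 0%N l i == i))
  (prod4E (fun i => nth 0%N l i == i) (fun x => part_moment 4 y (fun i => nth 0%N l i == x))).
rewrite /codes4 !big_cons big_nil /= !part_moment4E/=.
have -> : Ex P (fun w => (y 0%N w - c 0%N) * ((y 1%N w - c 1%N) * ((y 2%N w - c 2%N) * (y 3%N w - c 3%N)))) =
   E4 (fun w => y 0%N w - c 0%N) (fun w => y 1%N w - c 1%N) (fun w => y 2%N w - c 2%N) (fun w => y 3%N w - c 3%N) by [].
rewrite E4_sub// !E4_sub1// !E4_sub2// !E4_sub3//.
have e1 j : c j = E4 (y j) (fun=> 1) (fun=> 1) (fun=> 1) by apply: eq_Ex => w; ring.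
have e3 : E4 (fun=> 1) (fun=> 1) (fun=> 1) (fun=> 1) = 1.
  by rewrite -[RHS](Ex_cst P 1); apply: eq_Ex => w; ring.
have f1 : E4 (fun=> 1) (y 1%N) (fun=> 1) (fun=> 1) = c 1%N by apply: eq_Ex => w; ring.
have f2 : E4 (fun=> 1) (fun=> 1) (y 2%N) (fun=> 1) = c 2%N by apply: eq_Ex => w; ring.
have f3 : E4 (fun=> 1) (fun=> 1) (fun=> 1) (y 3%N) = c 3%N by apply: eq_Ex => w; ring.
have g01 : Ex P (fun w => y 0%N w * y 1%N w) = E4 (y 0%N) (y 1%N) (fun=> 1) (fun=> 1) by apply: eq_Ex => w; ring.
have g02 : Ex P (fun w => y 0%N w * y 2%N w) = E4 (y 0%N) (fun=> 1) (y 2%N) (fun=> 1) by apply: eq_Ex => w; ring.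
have g03 : Ex P (fun w => y 0%N w * y 3%N w) = E4 (y 0%N) (fun=> 1) (fun=> 1) (y 3%N) by apply: eq_Ex => w; ring.
have g12 : Ex P (fun w => y 1%N w * y 2%N w) = E4 (fun=> 1) (y 1%N) (y 2%N) (fun=> 1) by apply: eq_Ex => w; ring.
have g13 : Ex P (fun w => y 1%N w * y 3%N w) = E4 (fun=> 1) (y 1%N) (fun=> 1) (y 3%N) by apply: eq_Ex => w; ring.
have g23 : Ex P (fun w => y 2%N w * y 3%N w) = E4 (fun=> 1) (fun=> 1) (y 2%N) (y 3%N) by apply: eq_Ex => w; ring.
rewrite e3 f1 f2 f3 g01 g02 g03 g12 g13 g23 -!e1.
rewrite [2`!]/= [3`!]/= /factorial/=.
by ring.
Qed.

End CumulantFormulas.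

Lemma sum_le_of_esum (R : realType) (U : choiceType) (F : U -> R) :
  (forall u, 0 <= F u) -> (\esum_(u in [set: U]) (F u)%:E < +oo)%E ->
  exists2 C : R, 0 <= C & forall s : seq U, uniq s -> \sum_(u <- s) F u <= C.
Proof.
move=> F0 h; set S := esum _ _ in h.
have S0 : (0 <= S)%E by apply: esum_ge0 => u _; rewrite lee_fin.
have Sf : S \is a fin_num by rewrite ge0_fin_numE.
exists (fine S) => [|s us]; first exact: fine_ge0.
rewrite -lee_fin fineK// -sumEFin; apply: esum_ge; exists [set` s].
  by split => //; exact: finite_seq.
by rewrite -fsbig_seq.
Qed.

Lemma Ex_abs_le_sqr {d} {T : measurableType d} {R : realType} (P : probability T R) (f : T -> R) (delta : R) :
  L2 P f -> 0 < delta -> Ex P (fun x => `|f x|) <= delta + Ex P (fun x => f x ^+ 2) / delta.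
Proof.
move=> hf d0; have i2 := proj2 hf.
have -> : delta + Ex P (fun x => f x ^+ 2) / delta = Ex P (fun x => delta + delta^-1 * f x ^+ 2).
  by rewrite ExD ?ExZ ?Ex_cst ?[_^-1 * _]mulrC//; [exact: itg_cst|exact: itgZ].
apply: le_Ex; first exact/itg_abs/L2_itg.
  by apply: itgD; [exact: itg_cst|exact: itgZ].
move=> x; rewrite -[f x ^+ 2]real_normK ?num_real// -(ler_pM2l d0) mulrDr mulVKf ?gt_eqF//.
have := sqr_ge0 (`|f x| - delta); have := sqr_ge0 (`|f x| + delta).
move: (normr_ge0 (f x)); nra.
Qed.

Lemma qweight_form {R : realType} n M a (c : 'I_M -> R) (u v : 'I_n -> R) :
  \sum_(s : 'I_M * bool) wfreq n c s *
    ((\sum_(t < n) trig_fourier n a s.1 s.2 t * u t) * (\sum_(t < n) trig_fourier n a s.1 s.2 t * v t)) =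
  \sum_(p : 'I_n * 'I_n) qweight a c p.1 p.2 * (u p.1 * v p.2).
Proof.
rewrite -(pair_bigA _ (fun t t' : 'I_n => qweight a c t t' * (u t * v t')))/=.
transitivity (\sum_(s : 'I_M * bool) \sum_(t < n) \sum_(t' < n)
    wfreq n c s * (trig_fourier n a s.1 s.2 t * trig_fourier n a s.1 s.2 t') * (u t * v t')).
  apply: eq_bigr => s _; rewrite mulr_suml mulr_sumr; apply: eq_bigr => t _.
  by rewrite mulr_sumr mulr_sumr; apply: eq_bigr => t' _; ring.
rewrite exchange_big/=; apply: eq_bigr => t _; rewrite exchange_big/=; apply: eq_bigr => t' _.
by rewrite /qweight mulr_suml.
Qed.

(** * Concentration under summable cumulants *)

Section CumulantVariance.
Context {R : realType} {d : measure_display} {T : measurableType d}.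
Variable P : probability T R.
Variables (m : nat) (X : int -> 'I_m -> T -> R).
Hypothesis mX : forall t a, measurable_fun setT (X t a).
Hypothesis statX : strictly_stationary P X.
Hypothesis L4X : forall t a, L4 P (X t a).

Let L2X t a : L2 P (X t a). Proof. exact: L4_L2. Qed.

(** Every block moment is shift invariant by stationarity; with at most four factors it is
    integrable by the fourth moments. *)
Lemma cum_shift r (tt : 'I_r -> int) (aa : 'I_r -> 'I_m) (h : int) : (r <= 4)%N ->
  cum P (fun i => X (tt i + h) (aa i)) = cum P (fun i => X (tt i) (aa i)).
Proof.
move=> r4; apply: eq_bigr => Q _; congr (_ * _); apply: eq_bigr => B _.
rewrite !ExE.
have B4 : (#|B| <= 4)%N by rewrite (leq_trans (max_card _))// card_ord.
have e (t' : 'I_r -> int) x : \prod_(i in B) X (t' i) (aa i) x =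
    \prod_(l < #|B|) X (t' (enum_val l)) (aa (enum_val l)) x by rewrite big_enum_val.
rewrite (eq_Ex _ (e (fun i => tt i + h))) (eq_Ex _ (e tt)).
apply: (Ex_prod_shift (tt := fun l => tt (enum_val l)) (aa := fun l => aa (enum_val l)) mX statX);
  exact: (itg_prod_le4 B4).
Qed.

Lemma fourier_formE j k n M a (c : 'I_M -> R) x : fourier_form P X j k n a c x =
  \sum_(p : 'I_n * 'I_n) qweight a c p.1 p.2 * (cent P X p.1.+1%:Z j x * cent P X p.2.+1%:Z k x).
Proof.
exact: (qweight_form a c (fun t : 'I_n => cent P X t.+1%:Z j x) (fun t : 'I_n => cent P X t.+1%:Z k x)).
Qed.

Definition cum4 j k (t1 t2 t3 t4 : int) : R :=
  cum P (fun i : 'I_4 => nth (X 0 j) [:: X t1 j; X t2 k; X t3 j; X t4 k] i).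

Lemma Ex_cent4 j k t1 t2 t3 t4 :
  Ex P (fun x => (cent P X t1 j x * cent P X t2 k x) * (cent P X t3 j x * cent P X t4 k x)) =
  cum4 j k t1 t2 t3 t4 + autocov P X j k (t1 - t2) * autocov P X j k (t3 - t4) +
  autocov P X j j (t1 - t3) * autocov P X k k (t2 - t4) +
  autocov P X j k (t1 - t4) * autocov P X k j (t2 - t3).
Proof.
pose y i := nth (X 0 j) [:: X t1 j; X t2 k; X t3 j; X t4 k] i.
have Ly i : L4 P (y i) by rewrite /y; case: i => [|[|[|[|[|i]]]]] /=; exact: L4X.
have := Ex_centered4 Ly; rewrite /= /y/= !Ex_X// => h.
rewrite /cum4 -!(Ex_cent2 mX statX L2X) -h.
by apply: eq_Ex => x; rewrite /cent; ring.
Qed.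

Let cumX s (a : 'I_s.+2 -> 'I_m) (u : {ffun 'I_s.+1 -> int}) : R :=
  cum P (fun i : 'I_s.+2 => X (if unlift ord_max i is Some i' then u i' else 0) (a i)).

Lemma cum_summable s (a : 'I_s.+2 -> 'I_m) : assumptionB_cumulant P X ->
  exists2 C : R, 0 <= C & forall us : seq {ffun 'I_s.+1 -> int}, uniq us ->
    \sum_(u <- us) `|cumX a u| <= C.
Proof.
move=> [_ /(_ s a ord0)].
pose G (u : {ffun 'I_s.+1 -> int}) : R := (1 + `|u ord0|%:~R) * `|cumX a u|.
have n0 (u : {ffun 'I_s.+1 -> int}) : 0 <= `|u ord0|%:~R :> R by rewrite ler0z.
have G0 u : 0 <= G u by apply: mulr_ge0 => //; have := n0 u; lra.
move=> /(sum_le_of_esum G0)[C C0 hC]; exists C => // us uu.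
apply: le_trans (hC us uu); apply: ler_sum => u _; rewrite /G ler_peMl//.
by have := n0 u; lra.
Qed.

(** A cumulant of order two is an autocovariance, so this is the case r = 2 of the cumulant
    condition. *)
Lemma autocov_summable (a b : 'I_m) : assumptionB_cumulant P X ->
  exists2 C : R, 0 <= C & forall s : seq int, uniq s -> \sum_(h <- s) `|autocov P X a b h| <= C.
Proof.
move=> /(@cum_summable 0 (fun i => nth a [:: a; b] i))[C C0 hC]; exists C => // s us.
pose f (h : int) : {ffun 'I_1 -> int} := [ffun=> h].
have fi : injective f by move=> h h' /ffunP/(_ ord0); rewrite !ffunE.
have := hC (map f s); rewrite map_inj_uniq// => /(_ us); rewrite big_map.
apply: le_trans; apply: ler_sum => h _; rewrite le_eqVlt; apply/orP; left; apply/eqP.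
congr (`|_|); rewrite /cumX.
have -> : (fun i : 'I_2 => X (if unlift ord_max i is Some i' then f h i' else 0) (nth a [:: a; b] i)) =
   (fun i : 'I_2 => nth (X 0 a) [:: X h a; X 0 b] i).
  apply/funext => i; case: unliftP => [i' ->|->]; last by [].
  by rewrite ord1 ffunE.
rewrite (cum2E P (nth (X 0 a) [:: X h a; X 0 b]))/= !Ex_X//.
rewrite -Ex_cent2E// Ex_cent2// subr0//.
Qed.

(** Stationarity moves the last time to 0, and the triples of differences to it are distinct. *)
Lemma cum4_summable j k : assumptionB_cumulant P X ->
  exists2 C : R, 0 <= C & forall n (t4 : 'I_n),
    \sum_(t1 < n) \sum_(t2 < n) \sum_(t3 < n) `|cum4 j k t1.+1%:Z t2.+1%:Z t3.+1%:Z t4.+1%:Z| <= C.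
Proof.
pose aa (i : 'I_4) := nth j [:: j; k; j; k] i.
move=> /(@cum_summable 2 aa)[C C0 hC]; exists C => // n t4.
pose f (p : 'I_n * 'I_n * 'I_n) : {ffun 'I_3 -> int} :=
  [ffun i : 'I_3 => nth 0 [:: p.1.1%:Z - t4%:Z; p.1.2%:Z - t4%:Z; p.2%:Z - t4%:Z] i].
have fi : injective f.
  move=> [[x1 x2] x3] [[y1 y2] y3] /ffunP e.
  have := e (@Ordinal 3 0 isT); have := e (@Ordinal 3 1 isT); have := e (@Ordinal 3 2 isT).
  rewrite !ffunE/= => e3 e2 e1.
  by congr (_, _, _); apply: val_inj => /=; lia.
have := hC (map f (index_enum _)); rewrite map_inj_uniq// index_enum_uniq => /(_ isT); rewrite big_map.
apply: le_trans; rewrite le_eqVlt; apply/orP; left; apply/eqP.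
rewrite pair_bigA/= pair_bigA/=; apply: eq_bigr => [[[x1 x2] x3]] _ /=; congr (`|_|).
pose tt (i : 'I_4) : int := if unlift ord_max i is Some i' then f (x1, x2, x3) i' else 0.
rewrite /cumX -/tt -(@cum_shift 4 tt aa t4.+1%:Z)//; congr (cum P _).
apply/funext => i; rewrite /tt /aa; case: unliftP => [i' ->|->]; last by rewrite /= add0r.
rewrite ffunE/=; case: i' => [[|[|[|//]]] hi]/=; congr (X _ _); lia.
Qed.

Lemma cumulant_form_concentration j k : assumptionB_cumulant P X ->
  fourier_form_concentration P X j k.
Proof.
move=> aB C C0.
have [Ajj Ajj0 hjj] := autocov_summable j j aB.
have [Akk Akk0 hkk] := autocov_summable k k aB.
have [Ajk Ajk0 hjk] := autocov_summable j k aB.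
have [Akj Akj0 hkj] := autocov_summable k j aB.
have [K4 K40 h4] := cum4_summable j k aB.
exists (Ajj * Akk * (4 * C ^+ 2) + Ajk * Akj * (4 * C ^+ 2) + 4 * C ^+ 2 * K4).
  have C2 : 0 <= 4 * C ^+ 2 by rewrite mulr_ge0// sqr_ge0.
  by apply: addr_ge0; [apply: addr_ge0|]; apply: mulr_ge0 => //; exact: mulr_ge0.
move=> n M a c aM M0 hc delta d0.
have Mr : 0 < M%:R :> R by rewrite ltr0n.
have n0 : (0 < n)%N by rewrite (leq_trans M0)// (leq_trans _ aM)// leq_addl.
have nr : 0 < n%:R :> R by rewrite ltr0n.
set Q := fourier_form P X j k n a c.
pose W (p : 'I_n * 'I_n) x := cent P X p.1.+1%:Z j x * cent P X p.2.+1%:Z k x.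
pose q (t t' : 'I_n) := qweight a c t t'.
have L4c t b : L4 P (cent P X t b) by apply: L4B => //; exact: L4_cst.
have L2W p : L2 P (W p) by exact: L4M.
have QE : Q = fun x => \sum_p q p.1 p.2 * W p x by apply/funext => x; exact: fourier_formE.
have L2Q : L2 P Q by rewrite QE; apply: L2_sum => p _; exact: L2Z.
pose g a' b' (t t' : 'I_n) := autocov P X a' b' (t%:Z - t'%:Z).
have gE a' b' (t t' : 'I_n) : autocov P X a' b' (t.+1%:Z - t'.+1%:Z) = g a' b' t t'.
  by congr (autocov _ _ _ _ _); lia.
pose kap (t1 t2 t3 t4 : 'I_n) := cum4 j k t1.+1%:Z t2.+1%:Z t3.+1%:Z t4.+1%:Z.
have EQ : Ex P Q = \sum_p q p.1 p.2 * g j k p.1 p.2.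
  rewrite QE Ex_sum; last by move=> p _; apply: itgZ; exact: L2_itg (L2W p).
  by apply: eq_bigr => p _; rewrite (ExZ _ (L2_itg (L2W p))) /W (Ex_cent2 mX statX L2X) gE.
have rowb a' b' (A : R) : (forall s : seq int, uniq s -> \sum_(h <- s) `|autocov P X a' b' h| <= A) ->
    (forall t, \sum_t' `|g a' b' t t'| <= A) /\ (forall t', \sum_t `|g a' b' t t'| <= A).
  move=> hA; split => t.
    have := hA [seq t%:Z - t'%:Z | t' : 'I_n <- index_enum _].
    rewrite map_inj_uniq ?index_enum_uniq => [/(_ isT)|x y e]; last by apply: val_inj => /=; lia.
    by rewrite big_map.
  have := hA [seq t'%:Z - t%:Z | t' : 'I_n <- index_enum _].
  rewrite map_inj_uniq ?index_enum_uniq => [/(_ isT)|x y e]; last by apply: val_inj => /=; lia.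
  by rewrite big_map.
have fro : \sum_t \sum_t' q t t' ^+ 2 <= 4 * C ^+ 2 / M%:R by exact: (qweight_frobenius aM (ltW C0) hc M0).
have qa t t' : `|q t t'| <= 2 * C / n%:R by exact: (qweight_abs aM hc M0).
have var : Ex P (fun x => (Q x - Ex P Q) ^+ 2) <=
    (Ajj * Akk * (4 * C ^+ 2) + Ajk * Akj * (4 * C ^+ 2) + 4 * C ^+ 2 * K4) / M%:R.
  rewrite Ex_sqr_centered//.
  have -> : Ex P (fun x => Q x ^+ 2) = \sum_p \sum_r q p.1 p.2 * q r.1 r.2 * Ex P (fun x => W p x * W r x).
    by rewrite -Ex_bilinear; [apply: eq_Ex => x; rewrite QE expr2|move=> p r; exact: L2M].
  have -> : Ex P Q ^+ 2 = \sum_p \sum_r q p.1 p.2 * q r.1 r.2 * (g j k p.1 p.2 * g j k r.1 r.2).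
    by rewrite EQ expr2 big_distrlr/=; apply: eq_bigr => p _; apply: eq_bigr => r _; ring.
  rewrite -sumrB.
  (* The pairing within [p] and within [r] is the squared mean and cancels; the two crossed pairings
     and the fourth cumulant remain. *)
  have -> : \sum_p (\sum_r q p.1 p.2 * q r.1 r.2 * Ex P (fun x => W p x * W r x) -
      \sum_r q p.1 p.2 * q r.1 r.2 * (g j k p.1 p.2 * g j k r.1 r.2)) =
    \sum_p \sum_r q p.1 p.2 * q r.1 r.2 * (g j j p.1 r.1 * g k k p.2 r.2) +
    (\sum_p \sum_r q p.1 p.2 * q r.1 r.2 * (g j k p.1 r.2 * g k j p.2 r.1) +
     \sum_p \sum_r q p.1 p.2 * q r.1 r.2 * kap p.1 p.2 r.1 r.2).
    rewrite -!big_split/=; apply: eq_bigr => p _; rewrite -sumrB -!big_split/=; apply: eq_bigr => r _.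
    by rewrite /W Ex_cent4 !gE /kap; ring.
  have S4 (F : 'I_n -> 'I_n -> 'I_n -> 'I_n -> R) : \sum_p \sum_r F p.1 p.2 r.1 r.2 =
      \sum_t1 \sum_t2 \sum_t3 \sum_t4 F t1 t2 t3 t4.
    rewrite -(pair_bigA _ (fun t1 t2 : 'I_n => \sum_(r : 'I_n * 'I_n) F t1 t2 r.1 r.2))/=.
    apply: eq_bigr => t1 _; apply: eq_bigr => t2 _.
    by rewrite -(pair_bigA _ (fun t3 t4 : 'I_n => F t1 t2 t3 t4)).
  have swap23 (F : 'I_n -> 'I_n -> 'I_n -> 'I_n -> R) :
     \sum_p \sum_r F p.1 p.2 r.1 r.2 = \sum_p \sum_r F p.1 r.1 p.2 r.2.
    rewrite S4 (S4 (fun a b c d => F a c b d)); apply: eq_bigr => t1 _; exact: exchange_big.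
  have swap34 (F : 'I_n -> 'I_n -> 'I_n -> 'I_n -> R) :
     \sum_p \sum_r F p.1 p.2 r.1 r.2 = \sum_p \sum_r F p.1 p.2 r.2 r.1.
    rewrite S4 (S4 (fun a b c d => F a b d c)); apply: eq_bigr => t1 _; apply: eq_bigr => t2 _.
    exact: exchange_big.
  have b1 : \sum_p \sum_r q p.1 p.2 * q r.1 r.2 * (g j j p.1 r.1 * g k k p.2 r.2) <=
      Ajj * Akk * (4 * C ^+ 2) / M%:R.
    rewrite (swap23 (fun a b c d => q a b * q c d * (g j j a c * g k k b d))).
    have := schur_test q Ajj0 Akk0 (rowb _ _ _ hjj).1 (rowb _ _ _ hjj).2 (rowb _ _ _ hkk).1 (rowb _ _ _ hkk).2.
    move=> /le_trans; apply; rewrite -[leRHS]mulrA; apply: ler_wpM2l => //; exact: mulr_ge0.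
  have b2 : \sum_p \sum_r q p.1 p.2 * q r.1 r.2 * (g j k p.1 r.2 * g k j p.2 r.1) <=
      Ajk * Akj * (4 * C ^+ 2) / M%:R.
    rewrite (swap34 (fun a b c d => q a b * q c d * (g j k a d * g k j b c)))/=.
    (* After the permutation one kernel has its arguments reversed; the symmetry of [q] restores the
       form of Schur's test. *)
    rewrite (swap23 (fun a b c d => q a b * q d c * (g j k a c * g k j b d)))/=.
    have := schur_test q Ajk0 Akj0 (rowb _ _ _ hjk).1 (rowb _ _ _ hjk).2 (rowb _ _ _ hkj).1 (rowb _ _ _ hkj).2.
    move=> h; apply: (@le_trans _ _ (Ajk * Akj * \sum_t \sum_t' q t t' ^+ 2)).
      apply: le_trans h; rewrite le_eqVlt; apply/orP; left; apply/eqP.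
      by apply: eq_bigr => p _; apply: eq_bigr => r _; rewrite (_ : q r.2 p.2 = q p.2 r.2)//; exact: qweight_sym.
    by rewrite -[leRHS]mulrA; apply: ler_wpM2l => //; exact: mulr_ge0.
  (* Two entries of size 2 C / n against a total cumulant sum of at most n K4 leave O(1/n), which is
     O(1/M) since M <= n. *)
  have b3 : \sum_p \sum_r q p.1 p.2 * q r.1 r.2 * kap p.1 p.2 r.1 r.2 <= 4 * C ^+ 2 * K4 / M%:R.
    have qq t1 t2 t3 t4 : q t1 t2 * q t3 t4 * kap t1 t2 t3 t4 <= (2 * C / n%:R) ^+ 2 * `|kap t1 t2 t3 t4|.
      apply: (le_trans (ler_norm _)); rewrite !normrM ler_wpM2r// expr2; exact: ler_pM.
    apply: (@le_trans _ _ ((2 * C / n%:R) ^+ 2 * \sum_t4 \sum_t1 \sum_t2 \sum_t3 `|kap t1 t2 t3 t4|)).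
      rewrite (S4 (fun a b c d => q a b * q c d * kap a b c d)) .
      have -> : \sum_t4 \sum_t1 \sum_t2 \sum_t3 `|kap t1 t2 t3 t4| =
          \sum_t1 \sum_t2 \sum_t3 \sum_t4 `|kap t1 t2 t3 t4|.
        rewrite exchange_big; apply: eq_bigr => t1 _; rewrite exchange_big; apply: eq_bigr => t2 _.
        by rewrite exchange_big.
      rewrite mulr_sumr; apply: ler_sum => t1 _; rewrite mulr_sumr; apply: ler_sum => t2 _.
      rewrite mulr_sumr; apply: ler_sum => t3 _; rewrite mulr_sumr; apply: ler_sum => t4 _.
      exact: qq.
    apply: (@le_trans _ _ ((2 * C / n%:R) ^+ 2 * \sum_(t4 < n) K4)).
      by rewrite ler_wpM2l ?sqr_ge0//; apply: ler_sum => t4 _; exact: h4.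
    rewrite sumr_const card_ord -[K4 *+ n]mulr_natl.
    have -> : (2 * C / n%:R) ^+ 2 * (n%:R * K4) = 4 * C ^+ 2 * K4 / n%:R.
      by field; rewrite gt_eqF.
    apply: ler_wpM2l; first by do 2 apply: mulr_ge0 => //; exact: sqr_ge0.
    rewrite lef_pV2 ?posrE// ler_nat.
    by rewrite (leq_trans _ aM)// leq_addl.
  by rewrite !mulrDl; lra.
have L2D : L2 P (fun x => Q x - Ex P Q) by apply: L2B => //; exact: L2_cst.
apply: (le_trans (Ex_abs_le_sqr L2D d0)); rewrite lerD2l.
by rewrite [(_ * delta)^-1]invfM [leRHS]mulrA; apply: ler_wpM2r => //; rewrite invr_ge0 ltW.
Qed.

End CumulantVariance.

(** * Linear processes *)

(** The series defining a linear process converges almost everywhere; Fatou's lemma provides both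
    the integrability of the limit and its bound. *)
Lemma fatou_ae {d} {T : measurableType d} {R : realType} (P : probability T R)
    (f : nat -> T -> R) (g : T -> R) (B : R) :
  (forall n, itg P (f n)) -> measurable_fun setT g -> (forall n x, 0 <= f n x) -> (forall x, 0 <= g x) ->
  (forall n, Ex P (f n) <= B) -> {ae P, forall x, (fun n => f n x) @ \oo --> g x} ->
  itg P g /\ Ex P g <= B.
Proof.
move=> fi mg f0 g0 fB ae.
pose F n (x : T) := (f n x)%:E.
have mF n : measurable_fun setT (F n) by apply/measurable_EFinP; exact: itg_mf.
have F0 n x : setT x -> (0 <= F n x)%E by rewrite lee_fin.
have mlim : measurable_fun setT (fun x => limn_einf (F ^~ x)).
  apply: (measurableT_comp (f := fun y : \bar R => (- y)%E)); first exact: oppe_measurable.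
  by apply: (measurable_fun_limn_esup (f := fun n x => (- F n x)%E)) => n; exact: measurableT_comp.
have ie : (\int[P]_x (g x)%:E = \int[P]_x limn_einf (F ^~ x))%E.
  apply: ge0_ae_eq_integral => //.
  - exact/measurable_EFinP.
  - by move=> x _; rewrite lee_fin.
  - move=> x _; rewrite limn_einf_lim; apply: lime_ge; first exact: is_cvg_einfs.
    by apply: nearW => n; apply: le_ereal_inf_tmp => _ [k _ <-]; exact: F0.
  - apply: filterS ae => x h _; have h' : F ^~ x @ \oo --> (g x)%:E 
      by apply/fine_cvgP; split; [exact: nearW|exact: h].
    by rewrite (cvg_limn_einf_sup h').1.
have leB : (\int[P]_x (g x)%:E <= B%:E)%E.
  rewrite ie; apply: le_trans (fatou _ measurableT mF F0) _.
  rewrite limn_einf_lim; apply: lime_le; first exact: is_cvg_einfs.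
  apply: nearW => n; apply: (@le_trans _ _ (\int[P]_x F n x)%E).
    by apply: ereal_inf_lbound; exists n => /=.
  have -> : (\int[P]_x F n x)%E = (Ex P (f n))%:E by rewrite -ExpE// unlock.
  by rewrite lee_fin.
have ig : itg P g.
  apply/integrableP; split; first exact/measurable_EFinP.
  apply: le_lt_trans (ltry B); apply: le_trans leB; rewrite le_eqVlt; apply/orP; left; apply/eqP.
  by apply: eq_integral => x _ /=; rewrite ger0_norm.
split=> //; rewrite -lee_fin; apply: le_trans leB.
by rewrite -ExpE// unlock.
Qed.

Definition window (N : nat) : seq int := [seq i%:Z - N%:Z | i <- index_iota 0 (2 * N).+1].

Lemma mem_window N (l : int) : (l \in window N) = (- N%:Z <= l <= N%:Z).
Proof.
apply/mapP/andP => [[i + ->]|[h1 h2]].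
  by rewrite mem_index_iota; lia.
exists (absz (l + N%:Z)); first by rewrite mem_index_iota; lia.
lia.
Qed.

Lemma window_uniq N : uniq (window N).
Proof. by rewrite map_inj_uniq ?iota_uniq// => i j; lia. Qed.

Lemma sum_window (V : nmodType) N (F : int -> V) :
  \sum_(i < (2 * N).+1) F (i%:Z - N%:Z) = \sum_(l <- window N) F l.
Proof. by rewrite big_map big_mkord. Qed.

Lemma big_uniq_sub (I : eqType) (V : nmodType) (s s' : seq I) (F : I -> V) :
  uniq s -> uniq s' -> {subset s <= s'} ->
  \sum_(i <- s) F i = \sum_(i <- s') (if i \in s then F i else 0).
Proof.
move=> us us' ss; rewrite -big_mkcond -[RHS]big_filter; apply: perm_big.
apply: uniq_perm => //; first exact: filter_uniq.
by move=> i; rewrite mem_filter; case: (boolP (i \in s)) => //= /ss.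
Qed.

Lemma le_Ex_abs {d} {T : measurableType d} {R : realType} (P : probability T R) (f g : T -> R) :
  measurable_fun setT f -> itg P g -> (forall x, `|f x| <= g x) -> Ex P (fun x => `|f x|) <= Ex P g.
Proof.
by move=> mf ig fg; apply: le_Ex => //; apply: itg_abs; exact: le_itg ig.
Qed.

(** With a = f - f' and b = g - g', the difference of products is a g + b f - a b. Young's
    inequality with parameter [lam] charges lam V to the large factors, at most eta/2, and (1 +
    1/lam) ep = eta/4 to the small ones. Since [ep] depends on V and eta only, one truncation order
    serves all times and components. *)
Lemma Ex_mul_approx {R : realType} (V eta : R) : 0 <= V -> 0 < eta -> exists2 ep : R, 0 < ep &
  forall d (T : measurableType d) (P : probability T R) (f g f' g' : T -> R),
  L2 P f -> L2 P g -> L2 P f' -> L2 P g' ->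
  Ex P (fun x => f x ^+ 2) <= V -> Ex P (fun x => g x ^+ 2) <= V ->
  Ex P (fun x => (f x - f' x) ^+ 2) <= ep -> Ex P (fun x => (g x - g' x) ^+ 2) <= ep ->
  Ex P (fun x => `|f x * g x - f' x * g' x|) <= eta.
Proof.
move=> V0 eta0; pose lam := eta / (2 * (V + 1)).
have lam0 : 0 < lam by rewrite divr_gt0// mulr_gt0// ltr_wpDl.
pose ep := eta / (4 * (1 + lam^-1)).
have l0 : 0 < lam^-1 by rewrite invr_gt0.
have ep0 : 0 < ep by rewrite divr_gt0// mulr_gt0// addr_gt0.
exists ep => // d T P f g f' g' Lf Lg Lf' Lg' fV gV fe ge.
have Ld := L2B Lf Lf'; have Le := L2B Lg Lg'.
pose a x := f x - f' x; pose b x := g x - g' x.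
pose h x := lam^-1 / 2 * (a x ^+ 2 + b x ^+ 2) + lam / 2 * (f x ^+ 2 + g x ^+ 2) + 2^-1 * (a x ^+ 2 + b x ^+ 2).
have i1 := itgD (proj2 Ld) (proj2 Le); have i2 := itgD (proj2 Lf) (proj2 Lg).
have ih : itg P h by apply: itgD; [apply: itgD|]; exact: itgZ.
apply: (@le_trans _ _ (Ex P h)).
  apply: le_Ex_abs => //.
    exact: itg_mf (itgB (L2M Lf Lg) (L2M Lf' Lg')).
  move=> x; have -> : f x * g x - f' x * g' x = a x * g x + b x * f x - a x * b x by rewrite /a /b; ring.
  apply: (le_trans (ler_normB _ _)); apply: lerD.
    have yo (u v : R) : `|u * v| <= lam^-1 / 2 * u ^+ 2 + lam / 2 * v ^+ 2.
      rewrite normrM -[u ^+ 2]real_normK ?num_real// -[v ^+ 2]real_normK ?num_real//.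
      move: (`|u|) (`|v|) => U W.
      have h0 : 0 <= lam^-1 * (U - lam * W) ^+ 2 by rewrite mulr_ge0 ?sqr_ge0// ltW.
      have e : lam^-1 * (U - lam * W) ^+ 2 = lam^-1 * U ^+ 2 - 2 * (U * W) + lam * W ^+ 2.
        by field; rewrite gt_eqF.
      lra.
    apply: (le_trans (ler_normD _ _)); have := yo (a x) (g x); have := yo (b x) (f x); lra.
  rewrite -[a x ^+ 2]real_normK ?num_real// -[b x ^+ 2]real_normK ?num_real// normrM.
  by have := sqr_ge0 (`|a x| - `|b x|); nra.
rewrite /h ExD; [|by apply: itgD; exact: itgZ|exact: itgZ].
rewrite ExD; [|exact: itgZ|exact: itgZ].
rewrite (ExZ _ i1) (ExZ _ i2) (ExZ _ i1) (ExD (proj2 Ld) (proj2 Le)) (ExD (proj2 Lf) (proj2 Lg)).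
have e1 : (1 + lam^-1) * ep = eta / 4 by rewrite /ep; field; rewrite !gt_eqF// ?addr_gt0.
have e2 : lam * (V + 1) = eta / 2 by rewrite /lam; field; rewrite gt_eqF// ltr_wpDl.
move: (Ex P _) (Ex P _) (Ex P _) (Ex P _) fV gV fe ge => A B C D.
nra.
Qed.

Section LinearProcess.
Context {d} {T : measurableType d} {R : realType} (P : probability T R).
Variables (dZ : nat) (Z : int -> 'I_dZ -> T -> R).
Hypothesis mZ : forall t c, measurable_fun setT (Z t c).
Hypothesis indZ : indep_vectors P Z.
Hypothesis idZ : ident_distr P Z.
Hypothesis meanZ : forall t c, Ex P (Z t c) = 0.
Hypothesis L4Z_ : forall t c, L4 P (Z t c).
Variables (m : nat) (Psi : int -> 'M[R]_(m, dZ)).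

Definition ma_trunc N (t : int) (a : 'I_m) (x : T) : R :=
  \sum_(l <- window N) lform Z (Psi l a) (t - l) x.

Lemma L4_ma_trunc N t a : L4 P (ma_trunc N t a).
Proof. by apply: L4_sum => l _; exact: L4_lform. Qed.

Lemma Ex_ma_trunc N t a : Ex P (ma_trunc N t a) = 0.
Proof.
rewrite Ex_sum => [|l _]; last exact: L2_itg (L4_L2 (L4_lform L4Z_ _ _)).
by rewrite big1// => l _; exact: Ex_lform.
Qed.

Lemma Ex_lform_sum_sqr (s : seq int) (phi : int -> 'I_dZ -> R) (t : int) : uniq s ->
  Ex P (fun x => (\sum_(l <- s) lform Z (phi l) (t - l) x) ^+ 2) = \sum_(l <- s) lvar P Z (phi l).
Proof.
move=> us; pose L l x := lform Z (phi l) (t - l) x.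
have L2L l : L2 P (L l) by exact/L4_L2/L4_lform.
have -> : (fun x => (\sum_(l <- s) L l x) ^+ 2) = (fun x => \sum_(l <- s) \sum_(l' <- s) L l x * L l' x).
  by apply/funext => x; rewrite expr2 big_distrlr.
rewrite Ex_sum; last by move=> l _; apply: itg_sum => l' _; exact: L2M.
rewrite big_seq [RHS]big_seq; apply: eq_bigr => l ls.
rewrite Ex_sum; last by move=> l' _; exact: L2M.
rewrite (bigD1_seq l)//= big1 ?addr0.
  by rewrite -(Ex_lform_sqr mZ idZ L4Z_ _ (t - l)); apply: eq_Ex => x; rewrite expr2.
move=> l' ll'; apply: (Ex_lform2_neq mZ indZ meanZ L4Z_).
by apply: contra ll' => /eqP e; apply/eqP; move: e; clear; lia.
Qed.

Definition ma_weight (l : int) : R := \sum_(a < m) \sum_(c < dZ) Psi l a c ^+ 2.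

Lemma ma_weight_ge0 l : 0 <= ma_weight l.
Proof. by apply: sumr_ge0 => a _; apply: sumr_ge0 => c _; exact: sqr_ge0. Qed.

Lemma ma_weight_row l a : \sum_(c < dZ) Psi l a c ^+ 2 <= ma_weight l.
Proof.
rewrite /ma_weight (bigD1 a)//= lerDl; apply: sumr_ge0 => b _; apply: sumr_ge0 => c _; exact: sqr_ge0.
Qed.

Lemma Ex_ma_trunc_diff (Cv : R) N N' t a : 0 <= Cv ->
  (forall phi, lvar P Z phi <= Cv * \sum_(c < dZ) phi c ^+ 2) -> (N <= N')%N ->
  Ex P (fun x => (ma_trunc N' t a x - ma_trunc N t a x) ^+ 2) <=
  Cv * (\sum_(l <- window N') ma_weight l - \sum_(l <- window N) ma_weight l).
Proof.
move=> Cv0 hC NN.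
have ss : {subset window N <= window N'}.
  by move=> l; rewrite !mem_window; clear -NN; lia.
pose phi l c := if l \in window N then 0 else Psi l a c.
have e x : ma_trunc N' t a x - ma_trunc N t a x = \sum_(l <- window N') lform Z (phi l) (t - l) x.
  rewrite /ma_trunc (big_uniq_sub _ (window_uniq N) (window_uniq N') ss) -sumrB.
  apply: eq_bigr => l _; rewrite /phi; case: ifP => _; last by rewrite subr0.
  by rewrite subrr /lform big1// => c _; rewrite mul0r.
have -> : (fun x => (ma_trunc N' t a x - ma_trunc N t a x) ^+ 2) =
   (fun x => (\sum_(l <- window N') lform Z (phi l) (t - l) x) ^+ 2) by apply/funext => x; rewrite e.
rewrite Ex_lform_sum_sqr ?window_uniq//.
rewrite (big_uniq_sub _ (window_uniq N) (window_uniq N') ss) -sumrB mulr_sumr.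
apply: ler_sum => l _; apply: (le_trans (hC _)); apply: ler_wpM2l => //.
rewrite /phi; case: ifP => _; first by rewrite subrr big1// => c _; rewrite expr0n.
by rewrite subr0 ma_weight_row.
Qed.

Hypothesis sumPsi : (\esum_(l in [set: int]) (ma_weight l)%:E < +oo)%E.

Lemma ma_weight_bound : exists2 B : R, 0 <= B & forall s : seq int, uniq s -> \sum_(l <- s) ma_weight l <= B.
Proof. exact: sum_le_of_esum ma_weight_ge0 sumPsi. Qed.

Lemma ma_weight_tail (e : R) : 0 < e -> exists N0, forall N, (N0 <= N)%N ->
  \sum_(l <- window N) ma_weight l - \sum_(l <- window N0) ma_weight l <= e.
Proof.
move=> e0; pose S N := \sum_(l <- window N) ma_weight l.
have [B _ hB] := ma_weight_bound.
have ndS : nondecreasing_seq S.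
  move=> N N' NN; rewrite /S.
  have ss : {subset window N <= window N'} by move=> l; rewrite !mem_window; clear -NN; lia.
  rewrite (big_uniq_sub _ (window_uniq N) (window_uniq N') ss); apply: ler_sum => l _.
  by case: ifP => // _; exact: ma_weight_ge0.
have cS : cvgn S by apply: nondecreasing_is_cvgn => //; exists B => _ [N _ <-]; apply: hB; exact: window_uniq.
have [N0 _ hN0] : \forall N \near \oo, `|limn S - S N| <= e by move/cvgrPdist_le : cS; apply.
exists N0 => N NN0; apply: le_trans (hN0 N0 (leqnn _)); apply: le_trans (ler_norm _).
by rewrite lerD2r; exact: nondecreasing_cvgn_le.
Qed.

Variable X : int -> 'I_m -> T -> R.
Variable mu : 'I_m -> R.
Hypothesis mX : forall t a, measurable_fun setT (X t a).
Hypothesis limX : forall (t : int) (a : 'I_m), {ae P, forall w,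
  (fun N : nat => \sum_(i < (2 * N).+1) \sum_(c < dZ) Psi (i%:Z - N%:Z) a c * Z (t - (i%:Z - N%:Z)) c w)
    @ \oo --> X t a w - mu a}.

Lemma ma_trunc_approx (e : R) : 0 < e -> exists N, forall t a,
  L2 P (fun x => X t a x - mu a - ma_trunc N t a x) /\
  Ex P (fun x => (X t a x - mu a - ma_trunc N t a x) ^+ 2) <= e.
Proof.
move=> e0; have [Cv Cv0 hCv] := lvar_bound L4Z_.
have e1 : 0 < e / (Cv + 1) by rewrite divr_gt0// ltr_wpDl.
have [N0 hN0] := ma_weight_tail e1; exists N0 => t a.
have L2Y N : L2 P (ma_trunc N t a) by exact/L4_L2/L4_ma_trunc.
have mg : measurable_fun setT (fun x => X t a x - mu a - ma_trunc N0 t a x).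
  by apply: measurable_funB; [apply: measurable_funB|case: (L2Y N0)].
have hB n : Ex P (fun x => (ma_trunc (N0 + n) t a x - ma_trunc N0 t a x) ^+ 2) <= e.
  apply: (le_trans (Ex_ma_trunc_diff t a Cv0 hCv (leq_addr n N0))).
  apply: (@le_trans _ _ (Cv * (e / (Cv + 1)))); first by rewrite ler_wpM2l// hN0// leq_addr.
  by rewrite mulrA ler_pdivrMr ?ltr_wpDl//; nra.
have hl : {ae P, forall x, (fun n => (ma_trunc (N0 + n) t a x - ma_trunc N0 t a x) ^+ 2) @ \oo -->
    (X t a x - mu a - ma_trunc N0 t a x) ^+ 2}.
  apply: filterS (limX t a) => x hx.
  have h1 : (fun N => ma_trunc N t a x) @ \oo --> X t a x - mu a.
    rewrite (_ : (fun N => ma_trunc N t a x) = fun N : nat =>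
      \sum_(i < (2 * N).+1) \sum_(c < dZ) Psi (i%:Z - N%:Z) a c * Z (t - (i%:Z - N%:Z)) c x)//.
    by apply/funext => N; rewrite (sum_window N (fun l => \sum_(c < dZ) Psi l a c * Z (t - l) c x)).
  have h2 : (fun n => ma_trunc (N0 + n) t a x) @ \oo --> X t a x - mu a.
    have -> : (fun n => ma_trunc (N0 + n) t a x) = (fun n => ma_trunc (n + N0) t a x).
      by apply/funext => n; rewrite addnC.
    by rewrite (cvg_shiftn N0 (fun n => ma_trunc n t a x)).
  have h3 : (fun n => ma_trunc (N0 + n) t a x - ma_trunc N0 t a x) @ \oo --> X t a x - mu a - ma_trunc N0 t a x.
    by apply: cvgB => //; exact: cvg_cst.
  exact: (cvgM h3 h3).
have [ig eg] := fatou_ae (fun n => proj2 (L2B (L2Y (N0 + n)%N) (L2Y N0))) (measurable_funX 2 mg)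
  (fun n x => sqr_ge0 _) (fun x => sqr_ge0 _) hB hl.
by [].
Qed.

Lemma L2_ma t a : L2 P (X t a).
Proof.
have [N /(_ t a)[h _]] := ma_trunc_approx ltr01.
have := L2D (L2D h (L4_L2 (L4_ma_trunc N t a))) (L2_cst P (mu a)).
by congr (L2 P _); apply/funext => x; ring.
Qed.

(** The truncations have mean zero and approximate X - mu in mean square, so by the Cauchy-Schwarz
    inequality the squared mean of X - mu is below every positive number. *)
Lemma Ex_ma t a : Ex P (X t a) = mu a.
Proof.
have iX := L2_itg (L2_ma t a).
apply/eqP; rewrite -subr_eq0 -[_ == 0]sqrf_eq0 eq_le sqr_ge0 andbT.
apply/ler_addgt0Pl => e e0; rewrite addr0.
have [N /(_ t a)[h he]] := ma_trunc_approx e0; apply: le_trans he.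
have := Ex_CS h (L2_cst P 1).
have -> : Ex P (fun=> 1 ^+ 2) = 1 by rewrite Ex_cst expr1n.
rewrite mulr1; apply: le_trans; rewrite le_eqVlt; apply/orP; left; apply/eqP; congr (_ ^+ 2).
have iY := L2_itg (L4_L2 (L4_ma_trunc N t a)).
transitivity (Ex P (fun x => X t a x - mu a - ma_trunc N t a x)); last by apply: eq_Ex => x; rewrite mulr1.
have ic := itg_cst P (mu a).
by rewrite (ExB (itgB iX ic) iY) (ExB iX ic) Ex_cst Ex_ma_trunc subr0.
Qed.

(* The coefficients of the innovation at time [v] in the transform, with
   weights [E], of the truncated moving average. *)
Definition ma_coef n N (E : 'I_n -> R) (a : 'I_m) (v : int) (c : 'I_dZ) : R :=
  \sum_(t < n) (if t.+1%:Z - v \in window N then Psi (t.+1%:Z - v) a c else 0) * E t.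

(** For 1 <= t <= n and lags in [-N, N] the innovation times lie in [-(n + N), n + N]. A symmetric
    range is taken so that [window] applies; the extra times have zero coefficients. *)
Lemma ma_trunc_windowE n N (E : 'I_n -> R) a x :
  \sum_(t < n) E t * ma_trunc N t.+1%:Z a x =
  \sum_(u < (2 * (n + N)).+1) lform Z (ma_coef N E a (u%:Z - (n + N)%:Z)) (u%:Z - (n + N)%:Z) x.
Proof.
rewrite (sum_window (n + N) (fun v => lform Z (ma_coef N E a v) v x)).
have e (t : 'I_n) : ma_trunc N t.+1%:Z a x = \sum_(v <- window (n + N)) \sum_(c < dZ)
    (if t.+1%:Z - v \in window N then Psi (t.+1%:Z - v) a c else 0) * Z v c x.
  pose s := [seq t.+1%:Z - l | l <- window N].
  have tn := ltn_ord t.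
  have us : uniq s by rewrite map_inj_uniq ?window_uniq// => l l'; clear; lia.
  have ss : {subset s <= window (n + N)}.
    by move=> v /mapP[l + ->]; rewrite !mem_window; clear -tn; lia.
  have ms v : (v \in s) = (t.+1%:Z - v \in window N).
    apply/mapP/idP => [[l ls ->]|h]; first by rewrite subKr.
    by exists (t.+1%:Z - v) => //; rewrite subKr.
  transitivity (\sum_(v <- s) lform Z (Psi (t.+1%:Z - v) a) v x).
    by rewrite big_map; apply: eq_bigr => l _; rewrite subKr.
  rewrite (big_uniq_sub _ us (window_uniq _) ss); apply: eq_bigr => v _; rewrite ms.
  by case: ifP => _ //; rewrite big1// => c _; rewrite mul0r.
transitivity (\sum_(t < n) \sum_(v <- window (n + N)) \sum_(c < dZ) E t *
    ((if t.+1%:Z - v \in window N then Psi (t.+1%:Z - v) a c else 0) * Z v c x)).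
  by apply: eq_bigr => t _; rewrite e mulr_sumr; apply: eq_bigr => v _; rewrite mulr_sumr.
rewrite exchange_big/=; apply: eq_bigr => v _; rewrite exchange_big/=; apply: eq_bigr => c _.
by rewrite /ma_coef mulr_suml; apply: eq_bigr => t _; rewrite mulrA [E t * _]mulrC.
Qed.

(** For one innovation, the coefficients at the various frequencies are the transforms of the same
    truncated sequence Psi(t - v), so Bessel's inequality over the frequencies gives a bound free of
    N and M. *)
Lemma ma_coef_freq_sum n M i0 N a v (Cv B : R) : 0 <= Cv ->
  (forall phi, lvar P Z phi <= Cv * \sum_(c < dZ) phi c ^+ 2) ->
  (forall s : seq int, uniq s -> \sum_(l <- s) ma_weight l <= B) ->
  (i0 + M <= n)%N ->
  \sum_(s : 'I_M * bool) lvar P Z (ma_coef N (fun t : 'I_n => trig_fourier n i0 s.1 s.2 t) a v) <= Cv * (n%:R * B).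
Proof.
move=> Cv0 hC hB iM; pose y t c := if t.+1%:Z - v \in window N then Psi (t.+1%:Z - v) a c else 0.
apply: (@le_trans _ _ (Cv * \sum_(c < dZ) \sum_(s : 'I_M * bool)
    (\sum_(t < n) y t c * trig_fourier n i0 s.1 s.2 t) ^+ 2)).
  by rewrite exchange_big/= mulr_sumr; apply: ler_sum => s _; exact: hC.
apply: ler_wpM2l => //.
apply: (@le_trans _ _ (\sum_(c < dZ) n%:R * \sum_(t < n) y t c ^+ 2)).
  by apply: ler_sum => c _; exact: (bessel_freq iM (fun t : 'I_n => y t c)).
rewrite -mulr_sumr exchange_big/=; apply: ler_wpM2l => //.
have := hB [seq t.+1%:Z - v | t : 'I_n <- index_enum _].
rewrite map_inj_uniq ?index_enum_uniq => [/(_ isT)|t t' e]; last first.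
  by apply: val_inj => /=; move: e; clear; lia.
rewrite big_map; apply: le_trans; apply: ler_sum => t _.
rewrite /y; have [_|_] := boolP (t.+1%:Z - v \in window N); first exact: ma_weight_row.
by rewrite big1 ?ma_weight_ge0// => c _; rewrite expr0n.
Qed.

Hypothesis statX : strictly_stationary P X.

Let L2X := L2_ma.

(** The autocovariance of a single component is even, so the decay of the symmetrized covariances is
    its own decay. *)
Lemma autocov_row_bound a : assumptionA P 4 X -> exists2 G : R, 0 <= G & forall n (t : 'I_n),
  \sum_(t' < n) `|autocov P X a a (t%:Z - t'%:Z)| <= G.
Proof.
move=> /(evencov_bound mX statX L2X a a)[C C0 hC].
exists (`|autocov P X a a 0| + C * 2); first by rewrite addr_ge0 ?mulr_ge0.
move=> n t; pose F (l : int) : R := `|autocov P X a a l|.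
pose s := [seq t%:Z - t'%:Z | t' : 'I_n <- index_enum _].
have us : uniq s.
  by rewrite map_inj_uniq ?index_enum_uniq// => x y e; apply: val_inj => /=; move: e; clear; lia.
have ss : {subset s <= window n}.
  move=> _ /mapP[t' _ ->]; rewrite mem_window; have := ltn_ord t; have := ltn_ord t'; clear; lia.
have -> : \sum_(t' < n) `|autocov P X a a (t%:Z - t'%:Z)| = \sum_(l <- s) F l by rewrite big_map.
apply: (@le_trans _ _ (\sum_(l <- window n) F l)).
  by rewrite (big_uniq_sub F us (window_uniq n) ss); apply: ler_sum => l _; case: ifP => // _; exact: normr_ge0.
rewrite -sum_window sum_symmetric_range lerD2l.
apply: (@le_trans _ _ (\sum_(1 <= h < n.+1) C * (h%:R ^+ 2)^-1)); last first.
  by rewrite -mulr_sumr ler_wpM2l//; have := @sum_inv_sqr_le R 1 n.+1 isT; rewrite divr1.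
rewrite big_add1 big_mkord; apply: ler_sum => h _; apply: le_trans (hC h.+1 isT).
rewrite /F autocovN//= /evencov/= autocovN//.
by rewrite -mulr2n -[in leRHS]mulr2n -[_ *+ 2]mulr_natl -[in leRHS]mulr_natl normrM normr_nat.
Qed.

Lemma cent_ma_approx (eta : R) : 0 < eta -> exists N, forall t t' a b,
  Ex P (fun x => `|cent P X t a x * cent P X t' b x - ma_trunc N t a x * ma_trunc N t' b x|) <= eta.
Proof.
move=> eta0; pose V := \sum_a autocov P X a a 0.
have cE t a : Ex P (fun x => cent P X t a x ^+ 2) = autocov P X a a 0.
  by rewrite -(subrr t) -(Ex_cent2 mX statX L2X); apply: eq_Ex => x; rewrite expr2.
have c0 a : 0 <= autocov P X a a 0 by rewrite -(cE 0); apply: Ex_ge0 => x; exact: sqr_ge0.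
have V0 : 0 <= V by exact: sumr_ge0.
have cV t a : Ex P (fun x => cent P X t a x ^+ 2) <= V.
  by rewrite cE /V (bigD1 a)//= lerDl; exact: sumr_ge0.
have [ep ep0 hep] := Ex_mul_approx V0 eta0.
have [N hN] := ma_trunc_approx ep0; exists N => t t' a b.
have meanE c : mean P X c = mu c by rewrite -(Ex_X mX statX L2X 0) Ex_ma.
have hN' s c : Ex P (fun x => (cent P X s c x - ma_trunc N s c x) ^+ 2) <= ep.
  by rewrite /cent meanE; case: (hN s c).
have LY s c : L2 P (ma_trunc N s c) by exact/L4_L2/L4_ma_trunc.
have Lc s c : L2 P (cent P X s c) by exact: L2_cent.
exact: hep.
Qed.

Lemma gram_ma_coef (J : finType) n N (E : J -> 'I_n -> R) a s s' :
  gram P Z (fun u : 'I_(2 * (n + N)).+1 => u%:Z - (n + N)%:Z)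
    (fun s (u : 'I_(2 * (n + N)).+1) => ma_coef N (E s) a (u%:Z - (n + N)%:Z)) s s' =
  \sum_t \sum_t' E s t * E s' t' * Ex P (fun x => ma_trunc N t.+1%:Z a x * ma_trunc N t'.+1%:Z a x).
Proof.
rewrite /gram -Ex_bilinear; last by move=> t t'; apply: L2M; exact/L4_L2/L4_ma_trunc.
by apply: eq_Ex => x; rewrite !ma_trunc_windowE.
Qed.

Lemma gram_diag (J : finType) K (tau : 'I_K -> int) (A : J -> 'I_K -> 'I_dZ -> R) s : injective tau ->
  gram P Z tau A s s = \sum_u lvar P Z (A s u).
Proof.
(* The coefficients are transported along [tau] to a function of time, so that the variance formula
   for sums over lags applies at t = 0 with lags - [tau u]. *)
move=> it; pose phi v c := \sum_(u | tau u == v) A s u c.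
have it' : injective (fun u => - tau u) by move=> u v /oppr_inj/it.
have us : uniq [seq - tau u | u <- index_enum 'I_K] by rewrite map_inj_uniq ?index_enum_uniq.
have pE u : phi (- - tau u) = A s u.
  by apply/funext => c; rewrite /phi opprK (big_pred1 u)// => v; rewrite (inj_eq it).
have := @Ex_lform_sum_sqr _ (fun l => phi (- l)) 0 us; rewrite !big_map => h.
transitivity (\sum_u lvar P Z (phi (- - tau u))); last by apply: eq_bigr => u _; rewrite pE.
rewrite -h; apply: eq_Ex => x; rewrite -expr2; congr (_ ^+ 2).
by rewrite big_map; apply: eq_bigr => u _; rewrite pE sub0r opprK.
Qed.

Lemma ma_form_variance (C C4 Cv B Gj Gk : R) (j k : 'I_m) n M i0 N (c : 'I_M -> R) :
  0 < C -> 0 <= C4 -> 0 <= Cv -> 0 <= B -> 0 <= Gj -> 0 <= Gk ->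
  (forall phi psi u, Ex P (fun x => lform Z phi u x ^+ 2 * lform Z psi u x ^+ 2) <= C4 * lvar P Z phi * lvar P Z psi) ->
  (forall phi, lvar P Z phi <= Cv * \sum_(c < dZ) phi c ^+ 2) ->
  (forall s : seq int, uniq s -> \sum_(l <- s) ma_weight l <= B) ->
  (forall t : 'I_n, \sum_(t' < n) `|Ex P (fun x => ma_trunc N t.+1%:Z j x * ma_trunc N t'.+1%:Z j x)| <= Gj) ->
  (forall t : 'I_n, \sum_(t' < n) `|Ex P (fun x => ma_trunc N t.+1%:Z k x * ma_trunc N t'.+1%:Z k x)| <= Gk) ->
  (i0 + M <= n)%N -> (0 < M)%N -> (forall i, `|c i| <= C / M%:R) ->
  forall Q : T -> R, (Q = fun x => \sum_(s : 'I_M * bool) wfreq n c s *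
    ((\sum_(t < n) trig_fourier n i0 s.1 s.2 t * ma_trunc N t.+1%:Z j x) *
     (\sum_(t < n) trig_fourier n i0 s.1 s.2 t * ma_trunc N t.+1%:Z k x))) ->
  Ex P (fun x => (Q x - Ex P Q) ^+ 2) <=
    2 * (Gj * Gk * (4 * C ^+ 2) + C4 * C ^+ 2 * (2 * Cv * B) * (2 * (Gj + Gk))) / M%:R.
Proof.
move=> C0 C40 Cv0 B0 Gj0 Gk0 hC4 hCv hB hGj hGk iM M0 hc Q Qdef.
have Mr : 0 < M%:R :> R by rewrite ltr0n.
have n0 : (0 < n)%N by rewrite (leq_trans M0)// (leq_trans _ iM)// leq_addl.
have nr : 0 < n%:R :> R by rewrite ltr0n.
pose tau (u : 'I_(2 * (n + N)).+1) : int := u%:Z - (n + N)%:Z.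
have itau : injective tau by move=> u v; rewrite /tau => e; apply: val_inj => /=; move: e; clear; lia.
pose E (s : 'I_M * bool) (t : 'I_n) : R := trig_fourier n i0 s.1 s.2 t.
pose A b (s : 'I_M * bool) (u : 'I_(2 * (n + N)).+1) := ma_coef N (E s) b (tau u).
have gs b (t t' : 'I_n) : Ex P (fun x => ma_trunc N t.+1%:Z b x * ma_trunc N t'.+1%:Z b x) =
   Ex P (fun x => ma_trunc N t'.+1%:Z b x * ma_trunc N t.+1%:Z b x).
  by apply: eq_Ex => x; rewrite mulrC.
have QE : Q = fun x => \sum_s wfreq n c s *
    ((\sum_u lform Z (A j s u) (tau u) x) * (\sum_u lform Z (A k s u) (tau u) x)).
  by rewrite Qdef; apply/funext => x; apply: eq_bigr => s _; rewrite -!(ma_trunc_windowE N (E s)).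
rewrite QE; apply: (le_trans (@quadratic_form_variance d T R P dZ Z mZ indZ idZ meanZ L4Z_ _ (wfreq n c) _ tau (A j) (A k) itau
  C4 _ C40 hC4 (wfreq_le iM hc M0))).
rewrite -[leRHS]mulrA; apply: ler_wpM2l => //; rewrite [leRHS]mulrDl; apply: lerD.
  have hGj' (t' : 'I_n) : \sum_(t < n) `|Ex P (fun x => ma_trunc N t.+1%:Z j x * ma_trunc N t'.+1%:Z j x)| <= Gj.
    by apply: le_trans (hGj t'); apply: ler_sum => t _; rewrite gs.
  have hGk' (t' : 'I_n) : \sum_(t < n) `|Ex P (fun x => ma_trunc N t.+1%:Z k x * ma_trunc N t'.+1%:Z k x)| <= Gk.
    by apply: le_trans (hGk t'); apply: ler_sum => t _; rewrite gs.
  have h := schur_test_factored (wfreq n c) E Gj0 Gk0 hGj hGj' hGk hGk'.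
  apply: (@le_trans _ _ (Gj * Gk * (4 * C ^+ 2 / M%:R))); last by rewrite mulrA.
  apply: (@le_trans _ _ (Gj * Gk * \sum_t \sum_t' qweight i0 c t t' ^+ 2)).
    apply: le_trans h; rewrite le_eqVlt; apply/orP; left; apply/eqP.
    by apply: eq_bigr => s _; apply: eq_bigr => s' _; rewrite !gram_ma_coef.
  apply: ler_wpM2l; first exact: mulr_ge0.
  exact: (qweight_frobenius iM (ltW C0) hc M0).
(* The sum of H^2 is at most the supremum of H times its sum. The supremum is O(n) by Bessel over
   the frequencies and the sum is O(n M) by the Gram diagonals; against the squared weight (C / (n
   M))^2 this leaves O(1/M). *)
pose H u := \sum_s (lvar P Z (A j s u) + lvar P Z (A k s u)).
have H0 u : 0 <= H u by apply: sumr_ge0 => s _; apply: addr_ge0; exact: lvar_ge0.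
have Hsup u : H u <= 2 * Cv * (n%:R * B).
  rewrite /H big_split/=.
  have h b := @ma_coef_freq_sum n M i0 N b (tau u) Cv B Cv0 hCv hB iM.
  by have := lerD (h j) (h k); rewrite /A /E; lra.
have Hsum : \sum_u H u <= 2 * M%:R * (n%:R * (Gj + Gk)).
  rewrite exchange_big/=.
  have gd b (G : R) s : (forall t : 'I_n, \sum_(t' < n) `|Ex P (fun x => ma_trunc N t.+1%:Z b x * ma_trunc N t'.+1%:Z b x)| <= G) ->
     \sum_u lvar P Z (A b s u) <= n%:R * G.
    move=> hG; rewrite -(gram_diag (A b) s itau) gram_ma_coef.
    apply: (@le_trans _ _ (\sum_(t < n) G)); last by rewrite sumr_const card_ord mulr_natl.
    apply: ler_sum => t _; apply: le_trans (hG t); apply: ler_sum => t' _.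
    apply: (le_trans (ler_norm _)); rewrite !normrM -[leRHS]mul1r; apply: ler_wpM2r => //.
    by rewrite -[leRHS]mulr1; apply: ler_pM => //; exact: trig_fourier_le1.
  apply: (@le_trans _ _ (\sum_(s : 'I_M * bool) n%:R * (Gj + Gk))).
    by apply: ler_sum => s _; rewrite big_split/= mulrDr; apply: lerD; exact: gd.
  by rewrite sumr_const card_prod card_ord card_bool -[_ *+ _]mulr_natl natrM; lra.
apply: (@le_trans _ _ (C4 * (C / (n%:R * M%:R)) ^+ 2 * (2 * Cv * (n%:R * B) * (2 * M%:R * (n%:R * (Gj + Gk)))))).
  apply: ler_wpM2l; first by apply: mulr_ge0 => //; exact: sqr_ge0.
  apply: (@le_trans _ _ (\sum_u (2 * Cv * (n%:R * B)) * H u)).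
    by apply: ler_sum => u _; rewrite expr2; exact: (ler_wpM2r (H0 u) (Hsup u)).
  rewrite -mulr_sumr; apply: ler_wpM2l => //.
  by do 2 apply: mulr_ge0 => //; exact: mulr_ge0.
rewrite le_eqVlt; apply/orP; left; apply/eqP; field.
by rewrite !gt_eqF.
Qed.

(** The truncation order N depends on n and on the error [e], while the constant does not: the
    covariances of the truncated process are bounded through those of [X], not through the
    coefficients. *)
Lemma linear_form_concentration j k : assumptionA P 4 X ->
  fourier_form_concentration P X j k.
Proof.
move=> aA C C0.
have [C4 C40 hC4] := lform_moment4 mZ idZ L4Z_.
have [Cv Cv0 hCv] := lvar_bound L4Z_.
have [B B0 hB] := ma_weight_bound.
have [Gj Gj0 hGj] := autocov_row_bound j aA.
have [Gk Gk0 hGk] := autocov_row_bound k aA.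
have Gj1 : 0 <= Gj + 1 by rewrite addr_ge0.
have Gk1 : 0 <= Gk + 1 by rewrite addr_ge0.
pose K := 2 * ((Gj + 1) * (Gk + 1) * (4 * C ^+ 2) + C4 * C ^+ 2 * (2 * Cv * B) * (2 * (Gj + 1 + (Gk + 1)))).
exists K.
  have C2 := sqr_ge0 C.
  apply: mulr_ge0 => //; apply: addr_ge0; first by do 2 apply: mulr_ge0 => //; exact: mulr_ge0.
  by apply: mulr_ge0; [apply: mulr_ge0; [exact: mulr_ge0|do 2 apply: mulr_ge0 => //]|apply: mulr_ge0 => //; exact: addr_ge0].
move=> n M a c aM M0 hc delta d0.
have Mr : 0 < M%:R :> R by rewrite ltr0n.
have n0 : (0 < n)%N by rewrite (leq_trans M0)// (leq_trans _ aM)// leq_addl.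
have nr : 0 < n%:R :> R by rewrite ltr0n.
set F := fourier_form P X j k n a c.
have iF : itg P F by exact: itg_fourier_form.
apply/ler_addgt0Pr => e e0.
(* An error 1/n per covariance adds at most 1 to each row sum, whence Gj + 1 and Gk + 1. The second
   bound, over n^2 pairs with weights at most 2 C / n, makes the L^1 distance of the two forms at
   most e/2. *)
pose eta := Num.min n%:R^-1 (e / (4 * C * n%:R)).
have eta0 : 0 < eta by rewrite lt_min invr_gt0 nr divr_gt0// !mulr_gt0.
have [N hN] := cent_ma_approx eta0.
have L2Y t b : L2 P (ma_trunc N t b) by exact/L4_L2/L4_ma_trunc.
have L2c t b : L2 P (cent P X t b) by exact: L2_cent.
have near_cov b (t t' : 'I_n) : `|Ex P (fun x => ma_trunc N t.+1%:Z b x * ma_trunc N t'.+1%:Z b x)| <=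
    `|autocov P X b b (t%:Z - t'%:Z)| + n%:R^-1.
  have -> : t%:Z - t'%:Z = t.+1%:Z - t'.+1%:Z by clear; lia.
  rewrite -(Ex_cent2 mX statX L2X) -lerBlDl; apply: (le_trans (lerB_dist _ _)).
  rewrite distrC -ExB; [|exact: L2M|exact: L2M].
  apply: (le_trans (le_abs_Ex (itgB (L2M (L2c _ _) (L2c _ _)) (L2M (L2Y _ _) (L2Y _ _))))).
  by apply: (le_trans (hN _ _ _ _)); rewrite ge_min lexx.
have rowY b (G : R) : (forall n (t : 'I_n), \sum_(t' < n) `|autocov P X b b (t%:Z - t'%:Z)| <= G) ->
    forall t : 'I_n, \sum_(t' < n) `|Ex P (fun x => ma_trunc N t.+1%:Z b x * ma_trunc N t'.+1%:Z b x)| <= G + 1.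
  move=> hG t; apply: (le_trans (ler_sum _ (fun t' _ => near_cov b t t'))).
  rewrite big_split/=; apply: lerD; first exact: hG.
  by rewrite sumr_const card_ord -[_ *+ n]mulr_natl divff// gt_eqF.
pose Q x := \sum_(s : 'I_M * bool) wfreq n c s *
    ((\sum_(t < n) trig_fourier n a s.1 s.2 t * ma_trunc N t.+1%:Z j x) *
     (\sum_(t < n) trig_fourier n a s.1 s.2 t * ma_trunc N t.+1%:Z k x)).
have var := ma_form_variance C0 C40 Cv0 B0 Gj1 Gk1 hC4 hCv hB (rowY j Gj hGj) (rowY k Gk hGk) aM M0 hc (erefl Q).
have L2Q : L2 P Q.
  have -> : Q = fun x => \sum_(p : 'I_n * 'I_n) qweight a c p.1 p.2 * (ma_trunc N p.1.+1%:Z j x * ma_trunc N p.2.+1%:Z k x).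
    by apply/funext => x; exact: (qweight_form a c (fun t : 'I_n => ma_trunc N t.+1%:Z j x) (fun t : 'I_n => ma_trunc N t.+1%:Z k x)).
  by apply: L2_sum => p _; apply: L2Z; apply: L4M; exact: L4_ma_trunc.
have iQ := L2_itg L2Q.
have dist : Ex P (fun x => `|F x - Q x|) <= e / 2.
  pose W (p : 'I_n * 'I_n) x := cent P X p.1.+1%:Z j x * cent P X p.2.+1%:Z k x -
     ma_trunc N p.1.+1%:Z j x * ma_trunc N p.2.+1%:Z k x.
  have iW p : itg P (W p) by apply: itgB; apply: L2M.
  have FQ x : F x - Q x = \sum_(p : 'I_n * 'I_n) qweight a c p.1 p.2 * W p x.
    rewrite /F fourier_formE /Q (qweight_form a c (fun t : 'I_n => ma_trunc N t.+1%:Z j x) (fun t : 'I_n => ma_trunc N t.+1%:Z k x)).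
    by rewrite -sumrB; apply: eq_bigr => p _; rewrite [RHS]mulrBr.
  have iS : itg P (fun x => \sum_(p : 'I_n * 'I_n) `|qweight a c p.1 p.2| * `|W p x|).
    by apply: itg_sum => p _; apply: itgZ; exact: itg_abs.
  apply: (@le_trans _ _ (Ex P (fun x => \sum_(p : 'I_n * 'I_n) `|qweight a c p.1 p.2| * `|W p x|))).
    apply: le_Ex => //; first by apply: itg_abs; exact: itgB.
    by move=> x; rewrite FQ; apply: (le_trans (ler_norm_sum _ _ _)); apply: ler_sum => p _; rewrite normrM.
  rewrite Ex_sum; last by move=> p _; apply: itgZ; exact: itg_abs.
  apply: (@le_trans _ _ (\sum_(p : 'I_n * 'I_n) (2 * C / n%:R) * (e / (4 * C * n%:R)))).
    apply: ler_sum => p _; rewrite (ExZ _ (itg_abs (iW p))); apply: ler_pM => //.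
    - by apply: Ex_ge0 => x.
    - exact: (qweight_abs aM hc M0).
    - by apply: (le_trans (hN _ _ _ _)); rewrite ge_min lexx orbT.
  rewrite sumr_const card_prod !card_ord -[_ *+ (n * n)]mulr_natl natrM.
  by rewrite le_eqVlt; apply/orP; left; apply/eqP; field; rewrite !gt_eqF.
have L2D : L2 P (fun x => Q x - Ex P Q) by apply: L2B => //; exact: L2_cst.
have mid : Ex P (fun x => `|Q x - Ex P Q|) <= delta + K / (M%:R * delta).
  apply: (le_trans (Ex_abs_le_sqr L2D d0)); rewrite lerD2l.
  by rewrite [(_ * delta)^-1]invfM [leRHS]mulrA; apply: ler_wpM2r => //; rewrite invr_ge0 ltW.
have EFQ : `|Ex P F - Ex P Q| <= e / 2.
  by rewrite -ExB//; apply: le_trans dist; apply: le_abs_Ex; exact: itgB.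
have i1 : itg P (fun x => `|F x - Q x|) by apply: itg_abs; exact: itgB.
have i2 : itg P (fun x => `|Q x - Ex P Q|) by exact/itg_abs/L2_itg.
apply: (@le_trans _ _ (Ex P (fun x => `|F x - Q x| + `|Q x - Ex P Q| + e / 2))).
  apply: le_Ex.
  - by apply: itg_abs; apply: itgB => //; exact: itg_cst.
  - by apply: itgD; [exact: itgD|exact: itg_cst].
  move=> x; have -> : F x - Ex P F = (F x - Q x) + (Q x - Ex P Q) + (Ex P Q - Ex P F) by ring.
  apply: (le_trans (ler_normD _ _)); apply: lerD; first exact: ler_normD.
  by rewrite distrC.
rewrite ExD; [|exact: itgD|exact: itg_cst].
rewrite Ex_cst (ExD i1 i2); lra.
Qed.

End LinearProcess.

Lemma L4_of_moment {d} {T : measurableType d} {R : realType} (P : probability T R) (f g : T -> R) :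
  measurable_fun setT f -> (forall x, g x = f x ^+ 4) -> ('E_P[g] < +oo)%E -> L4 P f.
Proof.
move=> mf fg h; split => //.
have m4 : measurable_fun setT (fun x => f x ^+ 4) by exact: measurable_funX.
apply/integrableP; split; first exact/measurable_EFinP.
move: h; rewrite unlock; apply: le_lt_trans.
rewrite le_eqVlt; apply/orP; left; apply/eqP; apply: eq_integral => x _.
rewrite fg /= ger0_norm//.
by rewrite -[4%N]/(2 * 2)%N exprM sqr_ge0.
Qed.

Theorem theorem4p1 (R : realType) (d : measure_display) (T : measurableType d)
    (P : probability T R) (m : nat) (X : int -> 'I_m -> T -> R)
    (j k : 'I_m) (theta : R) (M : nat -> nat) :
  (forall (t : int) (a : 'I_m), measurable_fun setT (X t a)) ->
  assumptionA P 4 X ->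
  assumptionB P X ->
  (theta = 0 \/ theta = pi) ->
  ((fun n => (M n)%:R : R) @ \oo --> +oo) ->
  ((fun n => (M n)%:R / n%:R : R) @ \oo --> 0) ->
  forall eps : R, 0 < eps ->
    (fun n => P [set w | eps < `|ftilde X n (M n) theta j k w
                                   - fre P X j k theta|])
      @ \oo --> 0%E.
Proof.
move=> mX aA [statX [linX|cumX]] th Moo Mn.
- have [dZ [mu [Z [Psi [mZ [indZ [idZ [meanZ [L4Z [sumPsi limX]]]]]]]]]] := linX.
  have L4Z' t c : L4 P (Z t c) by exact: L4_of_moment (L4Z t c).
  have mZ0 t c : Ex P (Z t c) = 0 by rewrite -ExE meanZ.
  have L2X := L2_ma mZ indZ idZ mZ0 L4Z' sumPsi mX limX.
  apply: (fourier_form_consistency mX statX L2X aA th Moo Mn).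
  exact: (linear_form_concentration mZ indZ idZ mZ0 L4Z' sumPsi mX limX).
- have L4X t a : L4 P (X t a).
    apply: L4_of_moment (proj1 cumX t a 4%N) => // x.
    by rewrite -[4%N]/(2 * 2)%N !exprM real_normK ?num_real.
  apply: (fourier_form_consistency mX statX (fun t a => L4_L2 (L4X t a)) aA th Moo Mn).
  exact: (cumulant_form_concentration mX statX L4X).
Qed.
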